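(* Let $\Omega$ be an open set in $\mathbb{R}^m$ containing the closed unit ball $\overline{\mathbb{B}^m}$. Let $h$ be a superfunction with coefficients in $C^2(\Omega)$ satisfying $\nabla^2h=0$ in $\Omega$. Then \[ \int_{SS}h=\frac{2\pi^{M/2}}{\Gamma(M/2)}\,h(0), \] where $h(0)\in\Lambda_{2n}$ denotes $h$ evaluated at $\underline{x}=0$, and where for $M\in\{0,-2,-4,\dots\}$ the constant $\frac{2\pi^{M/2}}{\Gamma(M/2)}$ is $0$ (as $1/\Gamma$ vanishes at its poles).
   Context: Fix integers $m\ge1$, $n\ge0$ and put $M=m-2n$. Let $\Lambda_{2n}$ be the complex Grassmann algebra generated by anticommuting variables ${x\grave{}}_1,\dots,{x\grave{}}_{2n}$; superfunctions are $f=\sum_A{x\grave{}}_Af_A$ with $\mathbb{C}$-valued coefficients $f_A$ on $\Omega$. Bosonic coordinates $\underline{x}=(x_1,\dots,x_m)=r\underline\xi$. Fermionic derivatives $\partial_{{x\grave{}}_j}$ commute with the $x_i$ and satisfy $\partial_{{x\grave{}}_j}({x\grave{}}_k g)=\delta_{jk}g-{x\grave{}}_k\partial_{{x\grave{}}_j}g$. Put $\underline{x}\grave{}^2=\sum_{j=1}^n{x\grave{}}_{2j-1}{x\grave{}}_{2j}$. The super Laplace operator is $\nabla^2=\sum_{i=1}^m\partial_{x_i}^2-4\sum_{j=1}^n\partial_{{x\grave{}}_{2j-1}}\partial_{{x\grave{}}_{2j}}$. Berezin integral $\int_B=\pi^{-n}\partial_{{x\grave{}}_{2n}}\cdots\partial_{{x\grave{}}_1}$.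 With $\frac{\partial}{\partial r^2}=\frac1{2r}\frac{\partial}{\partial r}$ and $d\underline\xi$ the surface measure on $\mathbb{S}^{m-1}$, the supersphere integral is $\int_{SS}f=\sum_{j=0}^n\int_{\mathbb{S}^{m-1}}d\underline{\xi}\int_B\frac{\underline{x}\grave{}^{2j}}{j!}\big[(\frac{\partial}{\partial r^2})^jr^{m-2}f\big]_{r=1}$.
   Formalization: On the right-hand side, h(0) is taken to be the scalar (body) component of h at x=0, not the full element of Λ_{2n}; with the full element the identity fails, e.g. for n=1, m=3 and h equal to the first anticommuting variable. *)

(* Defs.v *)
From HB Require Import structures.
From mathcomp Require Import all_boot all_order all_algebra.
From mathcomp Require Import all_classical all_reals all_analysis.
From mathcomp Require Import complex.

Set Implicit Arguments.
Unset Strict Implicit.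
Unset Printing Implicit Defensive.

Import Order.TTheory GRing.Theory Num.Theory.
Import numFieldNormedType.Exports.
Local Open Scope ring_scope.

Section SuperDefs.
Variable R : realType.

(* The generator x`_k (k = 1..2n) is the ordinal k-1 : 'I_(n.*2).
   An element is the function A |-> coefficient of the ordered monomial
   x`_A = x`_{a1} ... x`_{ap}, a1 < ... < ap. *)
Definition grass (n : nat) := {set 'I_(n.*2)} -> R[i].

(* sign of x`_A x`_B = gsign A B * x`_{A u B} for disjoint A B *)
Definition gsign (k : nat) (A B : {set 'I_k}) : R[i] :=
  (-1) ^+ #|[set p : 'I_k * 'I_k | (p.1 \in A) && (p.2 \in B) && (p.2 < p.1)%N]|.

Definition gmul (n : nat) (a b : grass n) : grass n := fun S =>
  \sum_(A : {set 'I_(n.*2)})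
    \sum_(B : {set 'I_(n.*2)} | [disjoint A & B] && (A :|: B == S))
      gsign A B * a A * b B.

Definition gone (n : nat) : grass n := fun S => (S == finset.set0)%:R.

Definition gexp (n : nat) (a : grass n) (j : nat) : grass n :=
  iter j (gmul a) (@gone n).

Definition gscale (n : nat) (c : R[i]) (a : grass n) : grass n :=
  fun S => c * a S.

(* x`^2 = sum_j x`_{2j-1} x`_{2j} *)
Definition xsq (n : nat) : grass n := fun S =>
  \sum_(i < n.*2) \sum_(k < n.*2 | ~~ odd i && (k == i.+1 :> nat))
     (S == [set i; k])%:R.

(* Berezin integral pi^{-n} d_{x`_{2n}} ... d_{x`_1}: picks the coefficient
   of x`_1 x`_2 ... x`_{2n}. *)
Definition berezin (n : nat) (a : grass n) : R[i] :=
  ((pi : R) ^- n)%:C%C * a [set: 'I_(n.*2)].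

(* f = sum_A x`_A f_A, f_A : R^m -> C *)
Definition superfun (m n : nat) := {set 'I_(n.*2)} -> 'rV[R]_m -> R[i].

Definition fder (m n : nat) (i : 'I_(n.*2)) (f : superfun m n) : superfun m n :=
  fun S x => if i \in S then 0
             else (-1) ^+ #|[set a in S | (a < i)%N]| * f (i |: S) x.

Definition pder (m : nat) (i : 'I_m) (g : 'rV[R]_m -> R[i]) : 'rV[R]_m -> R[i] :=
  fun x => ('D_('e_i) (fun y => complex.Re (g y)) x
            +i* 'D_('e_i) (fun y => complex.Im (g y)) x)%C.

Definition blap (m : nat) (g : 'rV[R]_m -> R[i]) : 'rV[R]_m -> R[i] :=
  fun x => \sum_(i < m) pder i (pder i g) x.

Definition slap (m n : nat) (f : superfun m n) : superfun m n := fun S x =>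
  blap (f S) x
  - 4%:R * \sum_(i < n.*2) \sum_(k < n.*2 | ~~ odd i && (k == i.+1 :> nat))
              fder i (fder k f) S x.

Definition C2_on (m : nat) (Omega : set 'rV[R]_m) (g : 'rV[R]_m -> R) : Prop :=
  [/\ forall x, Omega x -> differentiable g x,
      forall (i : 'I_m) x, Omega x -> differentiable ('D_('e_i) g) x &
      forall (i j : 'I_m) x, Omega x ->
        {for x, continuous ('D_('e_j) ('D_('e_i) g))}].

Definition C2c_on (m : nat) (Omega : set 'rV[R]_m) (g : 'rV[R]_m -> R[i]) :=
  C2_on Omega (fun x => complex.Re (g x)) /\ C2_on Omega (fun x => complex.Im (g x)).

Definition enorm (m : nat) (x : 'rV[R]_m) : R := Num.sqrt (\sum_(i < m) x 0 i ^+ 2).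

Fixpoint iint (k : nat) (g : seq R -> R) : R :=
  match k with
  | 0%N => g [::]
  | k'.+1 => Rintegral (@lebesgue_measure R) setT%classic
               (fun t => iint k' (fun s => g (t :: s)))
  end.

Definition rint (m : nat) (g : 'rV[R]_m -> R) : R :=
  iint m (fun s => g (\row_(i < m) nth 0 s i)).

(* surface measure integral over S^{m-1}, through the cone formula
   int_{S^{m-1}} g dxi = m * int_{|x| <= 1} g(x/|x|) dx *)
Definition sphint_real (m : nat) (g : 'rV[R]_m -> R) : R :=
  m%:R * rint (fun x => if enorm x <= 1 then g ((enorm x)^-1 *: x) else 0).

Definition sphint (m : nat) (g : 'rV[R]_m -> R[i]) : R[i] :=
  (sphint_real (fun x => complex.Re (g x)) +i* sphint_real (fun x => complex.Im (g x)))%C.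

(* ---------- radial derivative d/d(r^2) = (1/(2r)) d/dr ------------------ *)
Definition rder (g : R -> R[i]) : R -> R[i] := fun r =>
  (derive1 (fun t => complex.Re (g t)) r +i* derive1 (fun t => complex.Im (g t)) r)%C.

Definition dr2 (g : R -> R[i]) : R -> R[i] := fun r => ((2 * r)^-1)%:C%C * rder g r.

Definition radial_term (m n : nat) (f : superfun m n) (j : nat) (xi : 'rV[R]_m) : grass n :=
  fun S => iter j dr2 (fun r => ((r ^ (m%:Z - 2%:Z))%:C)%C * f S (r *: xi)) 1.

Definition ss_integral (m n : nat) (f : superfun m n) : R[i] :=
  \sum_(j < n.+1)
    sphint (fun xi => berezin (gmul (gscale (((j`!)%:R : R)^-1)%:C%C (gexp (@xsq n) j))
                                    (radial_term f j xi))).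

Definition Gamma (s : R) : R :=
  Rintegral (@lebesgue_measure R) `]0, +oo[%classic
            (fun t => powR t (s - 1) * expR (- t)).

(* 1/Gamma on all of R: 1/Gamma(s) = s(s+1)...(s+K-1)/Gamma(s+K), s+K > 0;
   it vanishes at 0, -1, -2, ... *)
Definition rgamma (s : R) : R :=
  let K := (Num.truncn `|s|).+1 in
  (\prod_(k < K) (s + k%:R)) / Gamma (s + K%:R).

Definition sphere_const (M : int) : R :=
  2 * powR pi (M%:~R / 2) * rgamma (M%:~R / 2).

End SuperDefs.

(* Main.v *)
(* The ball means of a polyharmonic function U are polynomials in the radius,
   sum_l c_l r^(2l) (Lap^l U)(0) (Pizzetti), on which the Euler operator E acts
   as r d/dr; U is smooth, the integral of W over the sphere is that of
   (m + E) W over the ball, and (d/dr^2)^j r^(m-2) U at r = 1 is the result of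
   applying to U the operators E/2 + m/2 - 1 - i for i < j. The j-th term of the
   supersphere integral therefore depends only on the values at 0 of the
   iterated Laplacians of u_j, the sum of those coefficients of h whose
   monomials omit exactly j of the n pairs x`_{2p-1} x`_{2p}, and harmonicity
   of h gives Lap u_{j+1} = -4 (n - j) u_j. In the sum over j the contribution
   of u_q(0) carries the factor sum_l (-1)^l C(n - q, l), which vanishes unless
   q = n. What remains is h_0(0) times pi^(-n), the area of the sphere and the
   product of the m/2 - 1 - i for i < n, and the functional equation of Gamma
   turns this into the stated constant. *)
Require Import Defs.
From HB Require Import structures.
From mathcomp Require Import all_boot all_order all_algebra.
From mathcomp Require Import all_classical all_reals all_analysis.
From mathcomp Require Import measurable_realfun complex.
From mathcomp Require Import ring lra zify.
Import Order.TTheory GRing.Theory Num.Theory.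
Import numFieldNormedType.Exports.
Local Open Scope classical_set_scope.
Local Open Scope ring_scope.

Set Implicit Arguments.
Unset Strict Implicit.
Unset Printing Implicit Defensive.

(** [rint] is an iterated one-dimensional Lebesgue integral. Limits, translations, scalings and
    derivatives under it are therefore obtained by induction on the number of variables, for
    functions that arise from continuous, compactly supported ones by pointwise limits; this covers
    the indicator of the ball. The second obstacle is regularity: the coefficients of h are only
    C^2, while the j-th term differentiates j times. Since an iterated Laplacian kills every
    coefficient that matters, Pizzetti's formula with a weight (1 - |y|^2)_+^N, N large, writes it
    as a convolution with a smooth kernel plus Laplacians that are already known to be regular. The
    same weights make Pizzetti's formula a first-order induction: the radial derivative of a mean
    with weight N is, up to a factor, the mean of the Laplacian with weight N + 1, so no surface
    integral is met before the comparison of the sphere with the ball. Functions regular only on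
    Omega are replaced throughout by cut-off versions on the whole space that agree with them near
    the ball. *)

(** * Integrals on the line of bounded functions with bounded support *)

Section Integral1D.
Variable R : realType.
Local Notation mu := (@lebesgue_measure R).

Definition bsupp (P C : R) (f : R -> R) : Prop :=
  [/\ measurable_fun setT f, (forall t, `|f t| <= C) &
      (forall t, P < `|t| -> f t = 0)].

Lemma integrable_box (P C : R) :
  mu.-integrable setT (EFin \o (fun t => C * \1_(`[- P, P]%classic) t)).
Proof.
apply: (@integrableZl _ _ R mu setT measurableT C (EFin \o \1_(`[- P, P]%classic))).
exact: integrable_indic_itv.
Qed.

Lemma bsupp_le (P C : R) f t : bsupp P C f ->
  `|f t| <= C * \1_(`[- P, P]%classic) t.
Proof.
move=> [_ fC fP]; have [tP|tP] := leP `|t| P.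
  by rewrite indicE mem_set ?mulr1 //= in_itv /= -ler_norml.
by rewrite fP // normr0 mulr_ge0 // (le_trans (normr_ge0 _) (fC t)).
Qed.

Lemma bsupp_integrable (P C : R) f : bsupp P C f ->
  mu.-integrable setT (EFin \o f).
Proof.
move=> fb; apply: (le_integrable measurableT _ _ (integrable_box P C)).
  by apply/measurable_EFinP; case: fb.
move=> t _ /=; rewrite lee_fin.
by rewrite (le_trans (bsupp_le t fb)) // ler_norm.
Qed.

Lemma bsupp_cvg (P C : R) (f_ : nat -> R -> R) f :
  (forall n, bsupp P C (f_ n)) -> (forall t, f_ n t @[n --> \oo] --> f t) ->
  Rintegral mu setT (f_ n) @[n --> \oo] --> Rintegral mu setT f.
Proof.
move=> fb fc.
have mf : measurable_fun setT f.
  by apply: (@measurable_fun_cvg _ _ _ _ f_) => [n|t _]; [case: (fb n)|exact: fc].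
have [fi _] : [/\ mu.-integrable setT (EFin \o f),
    [sequence (\int[mu]_(x in setT) `|(f_ n x)%:E - (f x)%:E|)%E]_n @ \oo --> 0%E &
    [sequence (\int[mu]_(x in setT) (f_ n x)%:E)%E]_n @ \oo --> (\int[mu]_(x in setT) (f x)%:E)%E].
  apply: (@dominated_convergence _ _ R mu setT measurableT
    (fun n => EFin \o f_ n) (EFin \o f)
    (EFin \o (fun t => C * \1_(`[- P, P]%classic) t))).
  - by move=> n; apply/measurable_EFinP; case: (fb n).
  - exact/measurable_EFinP.
  - by apply: aeW => x _ /=; apply: cvg_EFin; [exact: nearW|exact: fc].
  - exact: integrable_box.
  - by apply: aeW => x n _ /=; rewrite lee_fin; exact: bsupp_le.
move=> h; apply: fine_cvg.
rewrite fineK; last exact: integrable_fin_num fi.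
exact: h.
Qed.

Lemma bsupp_bound (P C : R) f : 0 <= P -> bsupp P C f ->
  `|Rintegral mu setT f| <= P *+ 2 * C.
Proof.
move=> P0 fb; have fi := bsupp_integrable fb.
apply: (le_trans (le_normr_Rintegral _ fi)) => //.
apply: (@le_trans _ _ (Rintegral mu setT (fun t => C * \1_(`[- P, P]%classic) t))).
  apply: le_Rintegral => //; first by move/integrable_norm: fi.
    exact: integrable_box.
  by move=> t _; exact: bsupp_le fb.
have -> : (fun t => C * \1_(`[- P, P]%classic) t) =
   (fun t => ((fun=> C) \_ (`[- P, P]%classic)) t).
  apply/funext => t; rewrite patchE indicE; case: ifP => _; rewrite ?mulr1 ?mulr0 //.
rewrite -Rintegral_mkcond Rintegral_cst; last exact: measurable_itv.
have -> : fine (mu `[- P, P]%classic) = (if (- P < P)%R then (P - - P) else 0%R).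
  by rewrite lebesgue_measure_itv /= lte_fin; case: ifP.
case: ifP => [_|].
  by rewrite /= opprK mulrC mulr2n.
move=> _; rewrite /= mulr0 mulr_ge0 ?mulrn_wge0 //.
by case: fb => _ h _; rewrite (le_trans _ (h 0)).
Qed.

(** The right-hand side is a measure with the same values on half-open intervals, so uniqueness of
    Lebesgue measure applies. *)
Lemma lebesgue_measure_affine (r a : R) (A : set R) : 0 < r -> measurable A ->
  mu A = (r%:E * pushforward mu (fun t : measurableTypeR R => (r * t + a)%R : measurableTypeR R) A)%E.
Proof.
move=> r0 mA.
have mphi : measurable_fun setT (fun t : measurableTypeR R => r * t + a : measurableTypeR R).
  apply: measurable_funD => //; exact: measurable_funM.
pose nu : {measure set (measurableTypeR R) -> \bar R} :=
  mscale (NngNum (ltW r0)) (pushforward mu (fun t : measurableTypeR R => r * t + a : measurableTypeR R)).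
rewrite (_ : (_ * _)%E = nu mphi A) //.
apply: lebesgue_measure_unique => // _ [[x y] _ <-].
rewrite /nu /mscale /= /pushforward.
transitivity (r%:E * mu (`]((x - a) / r)%R, ((y - a) / r)%R]%classic : set R))%E; last first.
  congr (_ * mu _)%E; apply/seteqP; split => t /=; rewrite !in_itv /= ltr_pdivrMr // ler_pdivlMr //;
  rewrite ltrBlDr lerBrDr mulrC //.
rewrite !lebesgue_measure_itv /= !lte_fin ltr_pM2r ?invr_gt0 // ltrD2r.
case: ifP => _; last by rewrite mule0.
rewrite -!EFinD -EFinM; congr EFin; field; exact: lt0r_neq0.
Qed.

Lemma bsupp_comp_affine (P C r a : R) f : 0 < r -> bsupp P C f ->
  bsupp ((P + `|a|) / r) C (fun t => f (r * t + a)).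
Proof.
move=> r0 [mf fC fP]; split => // [|t tP].
  apply: (measurableT_comp mf (_ : measurable_fun setT (fun t => r * t + a))).
  by apply: measurable_funD => //; exact: measurable_funM.
apply: fP; move: tP; rewrite ltr_pdivrMr // -{1}(gtr0_norm r0) -normrM mulrC => tP.
by rewrite -(ltrD2r `|a|) (lt_le_trans tP) // -{1}(addrK a (r * t)) (le_trans (ler_normB _ _)).
Qed.

Lemma bsupp_affine (P C r a : R) f : 0 < r -> bsupp P C f ->
  Rintegral mu setT (fun t => f (r * t + a)) = r^-1 * Rintegral mu setT f.
Proof.
move=> r0 fb.
pose phi := (fun t : measurableTypeR R => r * t + a : measurableTypeR R).
have mphi : measurable_fun setT phi.
  apply: measurable_funD => //; exact: measurable_funM.
have mf : measurable_fun setT f by case: fb.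
suff -> : Rintegral mu setT f = r * Rintegral mu setT (fun t => f (r * t + a)).
  by rewrite mulrA mulVf ?mul1r // lt0r_neq0.
pose nu : {measure set (measurableTypeR R) -> \bar R} :=
  mscale (NngNum (ltW r0)) (pushforward mu phi).
(* Change of variables for nonnegative integrands; it is applied to the positive and negative parts
   of [f], which [integralE] recombines. *)
have E : forall g : R -> \bar R, measurable_fun setT g -> (forall t, 0 <= g t)%E ->
   (\int[mu]_x g x = r%:E * \int[mu]_x g (phi x))%E.
  move=> g mg g0.
  transitivity (\int[nu mphi]_x g x)%E.
    by apply: eq_measure_integral => A mA _; rewrite [LHS](lebesgue_measure_affine a r0 mA).
  rewrite ge0_integral_mscale //=; congr (_ * _)%E.
  by rewrite ge0_integral_pushforward.
have fi := bsupp_integrable fb.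
have fp : (\int[mu]_x (EFin \o f)^\+ x \is a fin_num)%E by apply: integrable_pos_fin_num fi.
have fn : (\int[mu]_x (EFin \o f)^\- x \is a fin_num)%E by apply: integrable_neg_fin_num fi.
have Ep := E _ (measurable_funepos ((measurable_EFinP _ _).2 mf)) (fun t => funepos_ge0 _ t).
have En := E _ (measurable_funeneg ((measurable_EFinP _ _).2 mf)) (fun t => funeneg_ge0 _ t).
have fi' := bsupp_integrable (bsupp_comp_affine a r0 fb).
have fp' : (\int[mu]_x (EFin \o (f \o phi))^\+ x \is a fin_num)%E by apply: integrable_pos_fin_num fi'.
have fn' : (\int[mu]_x (EFin \o (f \o phi))^\- x \is a fin_num)%E by apply: integrable_neg_fin_num fi'.
have I1 := integralE mu setT (EFin \o f).
have I2 := integralE mu setT (EFin \o (f \o phi)).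
rewrite /Rintegral [X in fine X = _]I1 Ep En -[X in _ = r * X]/(fine (\int[mu]_x (EFin \o (f \o phi)) x)%E) I2.
have Hp : (EFin \o (f \o phi))^\+%E = (fun x => (EFin \o f)^\+%E (phi x)) by exact: (funepos_comp (EFin \o f) phi).
have Hn : (EFin \o (f \o phi))^\-%E = (fun x => (EFin \o f)^\-%E (phi x)) by exact: (funeneg_comp (EFin \o f) phi).
rewrite Hp in fp' *; rewrite Hn in fn' *.
move: (integral _ _ _) fp' (integral _ _ _) fn' => u fu v fv.
by rewrite !fineB ?fineM ?fin_numM //= mulrBr.
Qed.
End Integral1D.

(** Dominated convergence speaks of sequences only, so continuity and differentiability of integrals
    are reduced to sequences here. If the limit fails, countable choice picks points at distance
    below 1/(n+1) that stay away from [l]. *)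
Lemma cvg_within_seqP (R : realType) (V : normedModType R) (f : V -> R) (A : set V) (x : V) (l : R) :
  (forall u : nat -> V, (forall n, A (u n)) -> u n @[n --> \oo] --> x -> f (u n) @[n --> \oo] --> l) ->
  f y @[y --> within A (nbhs x)] --> l.
Proof.
move=> H; apply: contrapT => /cvgrPdist_lt; rewrite -existsNE => -[e /not_implyP[e0 ne]].
have step n : exists y, [/\ A y, `|x - y| < n.+1%:R^-1 & e <= `|l - f y|].
  apply: contrapT => no; apply: ne; near=> y.
  rewrite ltNge; apply/negP => ey; apply: no; exists y; split=> //.
    by near: y; exact: withinT.
  near: y; rewrite near_withinE; near=> z => _.
  by near: z; apply: cvgr_dist_lt; rewrite ?invr_gt0.
have [u uP] := choice step.
have ux : u n @[n --> \oo] --> x.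
  apply/cvgrPdist_lt => d d0; near=> n.
  have [_ /lt_trans -> //] := uP n.
  by near: n; exact: near_infty_natSinv_lt (PosNum d0).
have /cvgrPdist_lt /(_ e e0) [N _ HN] := H u (fun n => let: And3 a _ _ := uP n in a) ux.
have [_ _] := uP N; rewrite leNgt => /negP; apply.
by apply: HN => /=.
Unshelve. all: by end_near. Qed.

Lemma continuous_seqP (R : realType) (V : normedModType R) (f : V -> R) (x : V) :
  (forall u : nat -> V, u n @[n --> \oo] --> x -> f (u n) @[n --> \oo] --> f x) ->
  {for x, continuous f}.
Proof.
move=> H; have h := @cvg_within_seqP R V f setT x (f x) (fun u _ => H u).
apply: (cvg_trans _ h) => P.
change (nbhs x [set y | setT y -> P (f y)] -> nbhs x [set y | P (f y)]).
by apply: filterS => y; apply.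
Qed.

(** * Iterated integrals on a class closed under pointwise limits *)

Section Baire.
Variable R : realType.
Local Notation mu := (@lebesgue_measure R).

Definition seqcont (k : nat) (g : seq R -> R) : Prop :=
  forall (u : nat -> seq R) (s : seq R), size s = k -> (forall n, size (u n) = k) ->
  (forall i, nth 0 (u n) i @[n --> \oo] --> nth 0 s i) -> g (u n) @[n --> \oo] --> g s.

(* Bounded functions of k variables vanishing off the box [-P, P]^k that are
   obtained from continuous ones by iterated pointwise limits: a class which
   is stable under partial integration and on which iint is well behaved. *)
Inductive baire (k : nat) (P C : R) : (seq R -> R) -> Prop :=
| baire_cont g : seqcont k g -> (forall s, size s = k -> `|g s| <= C) ->
    (forall s i, size s = k -> (i < k)%N -> P < `|nth 0 s i| -> g s = 0) -> baire k P C g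
| baire_lim (g_ : nat -> seq R -> R) g : (forall n, baire k P C (g_ n)) ->
    (forall s, size s = k -> g_ n s @[n --> \oo] --> g s) -> baire k P C g.

Lemma baire_bound k P C g s : baire k P C g -> size s = k -> `|g s| <= C.
Proof.
move=> H; elim: H s => [{}g _ gC _|g_ {}g _ IH gl] s sk; first exact: gC.
have /(@cvg_lim _) <- // : `|g_ n s| @[n --> \oo] --> `|g s|.
  by apply: cvg_norm; exact: gl.
apply: limr_le; first by apply/cvg_ex; eexists; apply: cvg_norm; exact: gl.
by apply: nearW => n; exact: IH.
Qed.

Lemma baire_supp k P C g s i : baire k P C g -> size s = k -> (i < k)%N ->
  P < `|nth 0 s i| -> g s = 0.
Proof.
move=> H; elim: H s => [{}g _ _ gP|g_ {}g _ IH gl] s sk ik Ps; first exact: (gP _ i).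
have := gl s sk; under eq_fun do rewrite (IH _ s sk ik Ps).
by move=> h; apply/esym; apply: (cvg_unique _ _ h) => //; exact: cvg_cst.
Qed.

(** The constant sequence [g] converges to [h] on lists of length k; on other lists the two
    functions may differ. *)
Lemma baire_ext k P C g h : (forall s, size s = k -> g s = h s) ->
  baire k P C g -> baire k P C h.
Proof.
move=> gh H; apply: (@baire_lim _ _ _ (fun=> g)) => // s sk.
by rewrite gh //; exact: cvg_cst.
Qed.

Lemma baire_mono k P C P' C' g : P <= P' -> C <= C' -> baire k P C g -> baire k P' C' g.
Proof.
move=> PP CC; elim=> [{}g gc gC gP|g_ {}g _ IH gl]; last exact: (baire_lim IH).
apply: baire_cont => // [s sk|s i sk ik Ps]; first by rewrite (le_trans (gC _ sk)).
by apply: (gP s i) => //; exact: le_lt_trans Ps.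
Qed.

Lemma baire_cons k P C g t : baire k.+1 P C g -> baire k P C (fun s => g (t :: s)).
Proof.
elim=> [{}g gc gC gP|g_ {}g _ IH gl].
  apply: baire_cont => [u s sk uk us|s sk|s i sk ik Ps].
  - by apply: (gc (fun n => t :: u n) (t :: s)) => [|n|[|i]] /=; rewrite ?sk ?uk //; exact: cvg_cst.
  - by apply: gC; rewrite /= sk.
  - by apply: (gP _ i.+1); rewrite /= ?sk.
by apply: (baire_lim IH) => s sk; apply: gl; rewrite /= sk.
Qed.

Lemma seqcont_comp2 k (op : R -> R -> R) g h :
  (forall (a b : nat -> R) x y, a n @[n --> \oo] --> x -> b n @[n --> \oo] --> y ->
     op (a n) (b n) @[n --> \oo] --> op x y) ->
  seqcont k g -> seqcont k h -> seqcont k (fun s => op (g s) (h s)).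
Proof. by move=> opc gc hc u s sk uk us; apply: opc; [exact: gc|exact: hc]. Qed.

(** Two nested inductions: the first reduces [g] to a continuous function with [h] arbitrary, the
    second does the same for [h]. *)
Lemma baire_op k P C1 C2 C (op : R -> R -> R) g h :
  (forall (a b : nat -> R) x y, a n @[n --> \oo] --> x -> b n @[n --> \oo] --> y ->
     op (a n) (b n) @[n --> \oo] --> op x y) ->
  op 0 0 = 0 -> (forall a b, `|a| <= C1 -> `|b| <= C2 -> `|op a b| <= C) ->
  baire k P C1 g -> baire k P C2 h -> baire k P C (fun s => op (g s) (h s)).
Proof.
move=> opc op0 opb gb hb; elim: gb => [{}g gc gC gP|g_ {}g _ IH gl]; last first.
  by apply: (baire_lim IH) => s sk; apply: opc; [exact: gl|exact: cvg_cst].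
elim: hb => [{}h hc hC hP|h_ {}h _ IH hl]; last first.
  by apply: (baire_lim IH) => s sk; apply: opc; [exact: cvg_cst|exact: hl].
apply: baire_cont => [|s sk|s i sk ik Ps]; first exact: seqcont_comp2.
  by apply: opb; [exact: gC|exact: hC].
by rewrite (gP _ _ sk ik Ps) (hP _ _ sk ik Ps).
Qed.

(** The approximants of [g] need not satisfy the better bound. Composing with the truncation [clamp]
    to [-C', C'], which is the identity on the values of [g], makes them satisfy it. *)
Lemma baire_sharp k P C C' g : 0 <= C' -> baire k P C g ->
  (forall s, size s = k -> `|g s| <= C') -> baire k P C' g.
Proof.
move=> C0 gb gC.
pose clamp (a b : R) := (`|a + C'| - `|a - C'|) / 2.
have clampE a : `|a| <= C' -> clamp a 0 = a.
  rewrite ler_norml => /andP[a1 a2]; rewrite /clamp ger0_norm ?ler0_norm; last lra; last lra.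
  by field.
apply: (@baire_ext _ _ _ (fun s => clamp (g s) (g s))) => [s sk|].
  by rewrite -[RHS]clampE // gC.
have gb' := gb; move: gb gb'; apply: (@baire_op k P C C C' clamp) => [a b x y ax _||a b _ _].
- apply: cvgMl; apply: cvgB; apply: cvg_norm.
    by apply: cvgD => //; exact: cvg_cst.
  by apply: cvgB => //; exact: cvg_cst.
- by rewrite clampE // normr0.
- rewrite /clamp normrM [`|2^-1|]gtr0_norm ?invr_gt0 // ler_pdivrMr // mulrC.
  rewrite (le_trans (ler_dist_dist _ _)) // (_ : a + C' - (a - C') = 2 * C'); last by ring.
  by rewrite ger0_norm; lra.
Qed.

Lemma iintS k (g : seq R -> R) :
  iint k.+1 g = Rintegral mu setT (fun t => iint k (fun s => g (t :: s))).
Proof. by []. Qed.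

Lemma eq_iint k (g h : seq R -> R) : (forall s, size s = k -> g s = h s) -> iint k g = iint k h.
Proof.
elim: k g h => [|k IH] g h gh /=; first exact: gh.
by congr Rintegral; apply/funext => t; apply: IH => s sk; rewrite gh //= sk.
Qed.

(** Measurability of the partial integrals is a hypothesis because the bound is used inside the
    induction that establishes it. *)
Lemma iint_baire_bound k P C g : 0 <= P -> 0 <= C ->
  (forall j h, (j < k)%N -> baire j.+1 P C h ->
     measurable_fun setT (fun t => iint j (fun s => h (t :: s)))) ->
  baire k P C g -> `|iint k g| <= (P *+ 2) ^+ k * C.
Proof.
move=> P0 C0; elim: k g => [|k IH] g mg gb.
  by rewrite expr0 mul1r; exact: (baire_bound gb).
rewrite iintS exprS -mulrA; apply: bsupp_bound => //; split.
- exact: mg.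
- by move=> t; apply: IH; [move=> j h jk; apply: mg; exact: ltnW|exact: baire_cons].
- move=> t Pt; rewrite (@eq_iint _ _ (fun=> 0)); last first.
    by move=> s sk; apply: (@baire_supp k.+1 P C g (t :: s) 0) => //=; rewrite sk.
  elim: k {IH mg gb} => [|k IH] //=.
  by rewrite IH Rintegral_cst // mul0r.
Qed.

(** The two claims feed each other. Dominated convergence in k variables makes the integral over the
    last k variables a continuous function of the first one, or a limit of such functions, hence
    measurable; with measurability, dominated convergence on the line gives the case of k + 1
    variables. *)
Lemma iint_cvg_measurable k P C : 0 <= P ->
  (forall (g_ : nat -> seq R -> R) g, (forall n, baire k P C (g_ n)) ->
    (forall s, size s = k -> g_ n s @[n --> \oo] --> g s) ->
    iint k (g_ n) @[n --> \oo] --> iint k g) /\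
  (forall j h, (j < k)%N -> baire j.+1 P C h ->
     measurable_fun setT (fun t => iint j (fun s => h (t :: s)))).
Proof.
move=> P0; elim: k => [|k [IHD IHM]]; first by split=> [g_ g _|j h]; [apply|].
have M j h : (j < k.+1)%N -> baire j.+1 P C h ->
     measurable_fun setT (fun t => iint j (fun s => h (t :: s))).
  rewrite ltnS leq_eqVlt => /orP[/eqP ->|jk]; last exact: IHM.
  elim=> [{}h hc hC hP|h_ {}h hb IH hl].
    apply: continuous_measurable_fun => t.
    apply: (@continuous_seqP R R^o) => u ut; apply: IHD => [n|s sk].
      exact/baire_cons/baire_cont.
    by apply: (hc (fun n => u n :: s) (t :: s)) => [|n|[|i]] /=; rewrite ?sk //; exact: cvg_cst.
  apply: measurable_fun_cvg IH _ => t _; apply: IHD => [n|s sk].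
    exact: baire_cons.
  by apply: hl; rewrite /= sk.
split=> // g_ g gb gl; rewrite iintS.
have C0 : 0 <= C by rewrite (le_trans _ (baire_bound (gb 0%N) (size_nseq k.+1 0))).
apply: (@bsupp_cvg _ P ((P *+ 2) ^+ k * C) (fun n t => iint k (fun s => g_ n (t :: s)))) => [n|t].
  split; first exact: M (gb n).
    move=> t; apply: iint_baire_bound => //; exact: baire_cons.
  move=> t Pt; rewrite (@eq_iint _ _ (fun=> 0)); last first.
    by move=> s sk; apply: (@baire_supp k.+1 P C (g_ n) (t :: s) 0) => //=; rewrite sk.
  by elim: k {IHD IHM M gb gl} => [|k IH] //=; rewrite IH Rintegral_cst // mul0r.
apply: IHD => [n|s sk]; first exact: baire_cons.
by apply: gl; rewrite /= sk.
Qed.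

Lemma iint_cvg k P C (g_ : nat -> seq R -> R) g : 0 <= P -> (forall n, baire k P C (g_ n)) ->
  (forall s, size s = k -> g_ n s @[n --> \oo] --> g s) ->
  iint k (g_ n) @[n --> \oo] --> iint k g.
Proof. by move=> P0; have [D _] := @iint_cvg_measurable k P C P0; exact: D. Qed.

Lemma iint0 k : iint k (fun _ : seq R => 0 : R) = 0.
Proof. by elim: k => [|k IH] //=; rewrite IH Rintegral_cst // mul0r. Qed.

Lemma baire_C_ge0 k P C g : baire k P C g -> 0 <= C.
Proof. by move=> gb; rewrite (le_trans _ (baire_bound gb (size_nseq k 0))). Qed.

Lemma iint_bsupp k P C g : 0 <= P -> baire k.+1 P C g ->
  bsupp P ((P *+ 2) ^+ k * C) (fun t => iint k (fun s => g (t :: s))).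
Proof.
move=> P0 gb; have C0 := baire_C_ge0 gb.
have [_ M] := @iint_cvg_measurable k.+1 P C P0.
split; first exact: M gb.
  move=> t; apply: iint_baire_bound => //; last exact: baire_cons.
  by move=> j h jk; apply: M; exact: ltnW.
move=> t Pt; rewrite (@eq_iint _ _ (fun=> 0)) ?iint0 // => s sk.
by apply: (@baire_supp k.+1 P C g (t :: s) 0) => //=; rewrite sk.
Qed.

Lemma iintD k P C1 C2 g h : 0 <= P -> baire k P C1 g -> baire k P C2 h ->
  iint k (fun s => g s + h s) = iint k g + iint k h.
Proof.
move=> P0; elim: k g h => [|k IH] g h gb hb //=.
rewrite -RintegralD //; first last.
- exact: bsupp_integrable (iint_bsupp P0 hb).
- exact: bsupp_integrable (iint_bsupp P0 gb).
by congr Rintegral; apply/funext => t; apply: IH; exact: baire_cons.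
Qed.

Lemma iintZ k P C c g : 0 <= P -> baire k P C g ->
  iint k (fun s => c * g s) = c * iint k g.
Proof.
move=> P0; elim: k g => [|k IH] g gb //=.
rewrite -RintegralZl //; last exact: bsupp_integrable (iint_bsupp P0 gb).
by congr Rintegral; apply/funext => t; apply: IH; exact: baire_cons.
Qed.

Lemma iint_affine k P C r (a : seq R) g : 0 <= P -> 0 < r -> size a = k -> baire k P C g ->
  iint k (fun s => g [seq r * x.1 + x.2 | x <- zip s a]) = r^-1 ^+ k * iint k g.
Proof.
move=> P0 r0; elim: k a g => [|k IH] [|a0 a] g //=; first by rewrite expr0 mul1r => _ _; congr g.
move=> [sa] gb.
under eq_fun do rewrite (IH _ _ sa (baire_cons _ gb)).
have gi := iint_bsupp P0 gb.
rewrite RintegralZl //; last exact: bsupp_integrable (bsupp_comp_affine a0 r0 gi).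
by rewrite (bsupp_affine a0 r0 gi) mulrA exprSr.
Qed.

End Baire.

(** * Integrals and directional derivatives on row vectors *)

Section RowVectors.
Variables (R : realType) (m : nat).
Implicit Types (f g : 'rV[R]_m -> R) (x y v : 'rV[R]_m).

Lemma cvg_rowP (u : nat -> 'rV[R]_m) x :
  (forall i, u n 0 i @[n --> \oo] --> x 0 i) -> u n @[n --> \oo] --> x.
Proof.
move=> H; apply/cvgrPdist_lt => e e0; near=> n.
rewrite [X in X < _]mx_normrE; apply/bigmax_ltP; split=> // -[i j] _ /=.
rewrite !mxE (ord1 i); move: j; near: n; apply: filter_forall => j.
by have /cvgrPdist_lt /(_ e e0) := H j.
Unshelve. all: by end_near. Qed.

Definition rowseq (s : seq R) : 'rV[R]_m := \row_(i < m) nth 0 s i.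

Definition vbaire (P C : R) f := baire m P C (f \o rowseq).

Lemma rintE f : rint f = iint m (f \o rowseq).
Proof. by []. Qed.

Lemma rowseqK x : rowseq [seq x 0 i | i <- enum 'I_m] = x.
Proof.
apply/rowP => i; rewrite mxE (nth_map i) ?size_enum_ord // nth_ord_enum //.
Qed.

Lemma size_rowenum x : size [seq x 0 i | i <- enum 'I_m] = m.
Proof. by rewrite size_map size_enum_ord. Qed.

Lemma vbaire_cont (P C : R) f : continuous f -> (forall x, `|f x| <= C) ->
  (forall x i, P < `|x 0 i| -> f x = 0) -> vbaire P C f.
Proof.
move=> fc fC fP; apply: baire_cont => [u s sm um us|s _|s i _ im Ps] /=.
- apply: (continuous_cvg _ (fc _)); apply: cvg_rowP => i.
  by under eq_fun do rewrite mxE; rewrite mxE; exact: us.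
- exact: fC.
- by apply: (fP _ (Ordinal im)); rewrite mxE.
Qed.

Lemma vbaire_bound P C f x : vbaire P C f -> `|f x| <= C.
Proof. by move=> fb; have := baire_bound fb (size_rowenum x); rewrite /= rowseqK. Qed.

Lemma vbaire_supp P C f x i : vbaire P C f -> P < `|x 0 i| -> f x = 0.
Proof.
move=> fb Px; have := @baire_supp _ _ _ _ _ _ i fb (size_rowenum x) (ltn_ord i).
by rewrite /= rowseqK (nth_map i) ?size_enum_ord // nth_ord_enum; exact.
Qed.

Lemma vbaire_lim P C (f_ : nat -> 'rV[R]_m -> R) f : (forall n, vbaire P C (f_ n)) ->
  (forall x, f_ n x @[n --> \oo] --> f x) -> vbaire P C f.
Proof. by move=> fb fl; apply: (baire_lim fb) => s _; exact: fl. Qed.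

Lemma vbaire_mono P C P' C' f : P <= P' -> C <= C' -> vbaire P C f -> vbaire P' C' f.
Proof. exact: baire_mono. Qed.

Lemma vbaireD P C1 C2 f g : vbaire P C1 f -> vbaire P C2 g ->
  vbaire P (C1 + C2) (fun x => f x + g x).
Proof.
apply: (@baire_op _ _ _ C1 C2 _ (fun a b => a + b)); rewrite ?addr0 //.
- by move=> a b x y; exact: cvgD.
- by move=> a b aC bC; rewrite (le_trans (ler_normD _ _)) // lerD.
Qed.

Lemma vbaireZ P C c f : vbaire P C f -> vbaire P (`|c| * C) (fun x => c * f x).
Proof.
move=> fb; have := @baire_op R m P C C (`|c| * C) (fun a b => c * a) _ _ _ _ _ fb fb; apply.
- by move=> a b x y ax _; exact: cvgMr.
- by rewrite mulr0.
- by move=> a b aC _; rewrite normrM ler_wpM2l.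
Qed.

Lemma vbaire_C_ge0 P C f : vbaire P C f -> 0 <= C.
Proof. exact: baire_C_ge0. Qed.

Lemma rint_cvg P C (f_ : nat -> 'rV[R]_m -> R) f : 0 <= P -> (forall n, vbaire P C (f_ n)) ->
  (forall x, f_ n x @[n --> \oo] --> f x) -> rint (f_ n) @[n --> \oo] --> rint f.
Proof. by move=> P0 fb fl; apply: (iint_cvg P0 fb) => s _; exact: fl. Qed.

Lemma rintD P C1 C2 f g : 0 <= P -> vbaire P C1 f -> vbaire P C2 g ->
  rint (fun x => f x + g x) = rint f + rint g.
Proof. by move=> P0 fb gb; exact: iintD fb gb. Qed.

Lemma rintZ P C c f : 0 <= P -> vbaire P C f -> rint (fun x => c * f x) = c * rint f.
Proof. by move=> P0 fb; exact: iintZ fb. Qed.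

Lemma rintB P C1 C2 f g : 0 <= P -> vbaire P C1 f -> vbaire P C2 g ->
  rint (fun x => f x - g x) = rint f - rint g.
Proof.
move=> P0 fb gb; have -> : (fun x => f x - g x) = (fun x => f x + -1 * g x).
  by apply/funext => x; rewrite mulN1r.
by rewrite (rintD P0 fb (vbaireZ (-1) gb)) (rintZ _ P0 gb) mulN1r.
Qed.

Lemma rint0 : rint (fun _ : 'rV[R]_m => 0) = 0.
Proof. exact: iint0. Qed.

Lemma rint_affine P C r v f : 0 <= P -> 0 < r -> vbaire P C f ->
  rint (fun x => f (r *: x + v)) = r^-1 ^+ m * rint f.
Proof.
move=> P0 r0 fb; rewrite !rintE -(iint_affine P0 r0 (size_rowenum v) fb).
apply: eq_iint => s sm /=; congr f; apply/rowP => i; rewrite !mxE.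
have sz : size (zip s [seq v 0 i | i <- enum 'I_m]) = m.
  by rewrite size_zip size_rowenum sm minnn.
rewrite (nth_map (0, 0)) ?sz // nth_zip ?size_rowenum //= (nth_map i) ?size_enum_ord //.
by rewrite nth_ord_enum.
Qed.

Lemma rint_shift P C v f : 0 <= P -> vbaire P C f -> rint (fun x => f (x + v)) = rint f.
Proof.
move=> P0 fb; have := rint_affine v P0 ltr01 fb; rewrite invr1 expr1n mul1r => <-.
by congr rint; apply/funext => x; rewrite scale1r.
Qed.

(** Both difference quotients are the same function of the increment, so directional derivatives
    become derivatives in one real variable. *)
Lemma is_derive_line f x v t d :
  is_derive t (1 : R) (fun s : R => f (x + s *: v)) d <-> is_derive (x + t *: v) v f d.
Proof.
have E : (fun h : R => h^-1 *: (((fun s : R => f (x + s *: v)) \o shift t) (h *: (1 : R)) - f (x + t *: v)))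
       = (fun h => h^-1 *: ((f \o shift (x + t *: v)) (h *: v) - f (x + t *: v))).
  apply/funext => h /=; congr (_ *: (f _ - _)).
  by rewrite [h *: 1]mulr1 scalerDl addrCA.
by split=> -[dv dE]; split; move: dv dE; rewrite /derivable /derive E.
Qed.

End RowVectors.

Lemma vbaire_sharp (R : realType) m P C C' (f : 'rV[R]_m -> R) : 0 <= C' -> vbaire P C f ->
  (forall x, `|f x| <= C') -> vbaire P C' f.
Proof. by move=> C0 fb fC; apply: (baire_sharp C0 fb) => s _; exact: fC. Qed.

(** * Differentiation under the integral sign *)

Section ParamDerivative.
Variables (R : realType) (m : nat).

Lemma is_derive_seqP (f : R -> R) (a d : R) :
  (forall u : nat -> R, (forall n, u n != 0) -> u n @[n --> \oo] --> (0 : R) ->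
     (u n)^-1 * (f (u n + a) - f a) @[n --> \oo] --> d) ->
  is_derive a 1 f d.
Proof.
move=> H.
have h : (fun h => h^-1 *: ((f \o shift a) (h *: (1 : R)) - f a)) @ 0^' --> d.
  apply: (@cvg_within_seqP R R^o) => u u0 uc.
  have := H u u0 uc; apply: cvg_trans; apply: near_eq_cvg; apply: nearW => n /=.
  by rewrite [_ *: 1]mulr1.
by split; [apply/cvg_ex; exists d|exact: cvg_lim].
Qed.

Lemma is_derive_seq (f : R -> R) (a d : R) (u : nat -> R) : is_derive a 1 f d ->
  (forall n, u n != 0) -> u n @[n --> \oo] --> (0 : R) ->
  (u n)^-1 * (f (u n + a) - f a) @[n --> \oo] --> d.
Proof.
move=> [dv dE] u0 uc.
have h : (fun h => h^-1 *: ((f \o shift a) (h *: (1 : R)) - f a)) @ 0^' --> d by rewrite -dE.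
have := (cvgr_dnbhsP _ _ _).1 h u (conj u0 uc).
by under eq_fun do rewrite /= [_ *: 1]mulr1.
Qed.

Lemma is_derive_continuous (f : R -> R) (a d : R) : is_derive a 1 f d -> {for a, continuous f}.
Proof. by move=> [dv _]; apply/differentiable_continuous/derivable1_diffP. Qed.

Lemma lipschitz_MVT (f df : R -> R) (a b C : R) :
  (forall t, Num.min a b <= t <= Num.max a b -> is_derive t 1 f (df t)) ->
  (forall t, Num.min a b <= t <= Num.max a b -> `|df t| <= C) ->
  `|f b - f a| <= C * `|b - a|.
Proof.
wlog ab : a b / a <= b => [H|].
  case/orP: (le_total a b) => [ab|ba]; first exact: (H _ _ ab).
  by rewrite minC maxC distrC [`|b - a|]distrC; exact: (H _ _ ba).
rewrite (min_idPl ab) (max_idPr ab) => fd dC.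
have [||c cab ->] := @MVT_segment R f df a b ab.
- by move=> t; rewrite in_itv /= => /andP[/ltW ? /ltW ?]; apply: fd; apply/andP.
- apply: continuous_in_subspaceT => t; rewrite inE /= in_itv /= => tab.
  exact: is_derive_continuous (fd t tab).
by rewrite normrM ler_wpM2r //; apply: dC; move: cab; rewrite in_itv.
Qed.

(* Differentiation under the integral sign, from dominated convergence and
   the mean value bound on difference quotients. *)
Lemma is_derive_rint (P C C' a e : R) (f df : R -> 'rV[R]_m -> R) : 0 <= P -> 0 < e ->
  (forall t, `|t - a| < e -> vbaire P C (f t)) ->
  (forall t x, `|t - a| < e -> is_derive t 1 (f ^~ x) (df t x)) ->
  (forall t x, `|t - a| < e -> `|df t x| <= C') ->
  vbaire P C' (df a) /\ is_derive a 1 (fun t => rint (f t)) (rint (df a)).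
Proof.
move=> P0 e0 fb fd dC.
have aa : `|a - a| < e by rewrite subrr normr0.
have C'0 : 0 <= C' by rewrite (le_trans _ (dC a 0 aa)).
have V h : h != 0 -> `|h| < e -> vbaire P C' (fun x => h^-1 * (f (h + a) x - f a x)).
  move=> h0 he.
  have hea : `|h + a - a| < e by rewrite addrK.
  apply: (@vbaire_sharp _ _ P (`|h^-1| * (C + C))) => // [|x].
    apply: vbaireZ.
    have -> : (fun x => f (h + a) x - f a x) = (fun x => f (h + a) x + (-1) * f a x).
      by apply/funext => x; rewrite mulN1r.
    have := vbaireD (fb _ hea) (vbaireZ (-1) (fb _ aa)).
    by rewrite normrN1 mul1r.
  rewrite normrM normfV ler_pdivrMl ?normr_gt0 // mulrC -{2}(addrK a h).
  have T t : Num.min a (h + a) <= t <= Num.max a (h + a) -> `|t - a| < e.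
    move: he; rewrite !ltr_norml => /andP[he1 he2].
    by have [ab|ba] := leP a (h + a) => /andP[t1 t2]; apply/andP; split; lra.
  apply: (@lipschitz_MVT (f ^~ x) (df ^~ x)) => t /T ?; [exact: fd|exact: dC].
have D u (u0 : forall n, u n != 0) (uc : u n @[n --> \oo] --> (0 : R)) :
   forall x, (u n)^-1 * (f (u n + a) x - f a x) @[n --> \oo] --> df a x.
  by move=> x; exact: is_derive_seq (fd a x aa) u0 uc.
split.
  (* Some null sequence is needed to exhibit [df a] as a limit; with denominators starting at 2
     every term is strictly below [e]. *)
  pose u n : R := e * n.+2%:R^-1.
  have u0 n : u n != 0 by rewrite mulf_neq0 ?invr_eq0 ?pnatr_eq0 ?gt_eqF.
  have uc : u n @[n --> \oo] --> (0 : R).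
    rewrite -(mulr0 e); apply: cvgMr; rewrite (cvg_shiftS (@harmonic R)); exact: cvg_harmonic.
  apply: (@vbaire_lim _ _ _ _ (fun n x => (u n)^-1 * (f (u n + a) x - f a x))) => [n|x]; last exact: D.
  apply: V => //; rewrite normrM gtr0_norm // gtr0_norm ?invr_gt0 //.
  by rewrite gtr_pMr // invf_lt1 // ltr1n.
apply: is_derive_seqP => u u0 uc.
have /cvgrPdist_lt /(_ e e0) [N _ HN] := uc.
have ue n : `|u (n + N)%N| < e.
  by have := HN (n + N)%N (leq_addl _ _); rewrite /= sub0r normrN.
(* Only the tail of [u] lies in the interval where [f] is controlled. *)
rewrite -(cvg_shiftn N) /=.
have uc' := uc; rewrite -(cvg_shiftn N) /= in uc'.
have := rint_cvg P0 (fun n => V _ (u0 (n + N)%N) (ue n)) (D (fun n => u (n + N)%N) (fun n => u0 (n + N)%N) uc').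
apply: cvg_trans; apply: near_eq_cvg; apply: nearW => n /=.
have hea : `|u (n + N)%N + a - a| < e by rewrite addrK.
have C0 := vbaire_C_ge0 (fb _ aa).
rewrite -(rintB P0 (fb _ hea) (fb _ aa)) -(@rintZ _ _ P (C + `|-1| * C)) //.
have := vbaireD (fb _ hea) (vbaireZ (-1) (fb _ aa)).
by under [in vbaire _ _ (fun x => _)]eq_fun do rewrite mulN1r.
Qed.

End ParamDerivative.

(** * Classes of k times continuously differentiable functions *)

Section DifferentiabilityClasses.
Variables (R : realType) (m : nat).
Implicit Types (f g u : 'rV[R]_m -> R) (x y v : 'rV[R]_m) (O : set 'rV[R]_m).

Notation pd i f := ('D_('e_i) f).

(* Differentiability along lines with a differential linear in the direction
   is all that is ever needed, so full differentiability is not required. *)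
Fixpoint Ck (q : nat) O u : Prop :=
  (forall x, O x -> {for x, continuous u}) /\
  if q is q'.+1 then
    (forall x v, O x -> is_derive x v u (\sum_(i < m) v 0 i * pd i u x)) /\
    (forall i, Ck q' O (pd i u))
  else True.

Lemma Ck_cont q O u x : Ck q O u -> O x -> {for x, continuous u}.
Proof. by case: q => [|q] [uc _]; exact: uc. Qed.

Lemma Ck_derive q O u x v : Ck q.+1 O u -> O x ->
  is_derive x v u (\sum_(i < m) v 0 i * pd i u x).
Proof. by move=> [_ [ud _]]; exact: ud. Qed.

Lemma Ck_pd q O u i : Ck q.+1 O u -> Ck q O (pd i u).
Proof. by move=> [_ [_ ]]; apply. Qed.

Lemma CkW q O u : Ck q.+1 O u -> Ck q O u.
Proof.
elim: q u => [|q IH] u uk; first by split=> // x Ox; exact: Ck_cont uk Ox.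
split=> [x Ox|]; first exact: Ck_cont uk Ox.
split=> [x v Ox|i]; first exact: Ck_derive uk Ox.
exact: IH (Ck_pd i uk).
Qed.

Lemma Ck_sub q O O' u : O' `<=` O -> Ck q O u -> Ck q O' u.
Proof.
move=> OO; elim: q u => [|q IH] u uk.
  by split=> // x /OO; exact: Ck_cont uk.
split=> [x /OO|]; first exact: Ck_cont uk.
split=> [x v /OO Ox|i]; first exact: Ck_derive uk Ox.
exact: IH (Ck_pd i uk).
Qed.

Lemma open_near_eq O f g x : open O -> (forall y, O y -> f y = g y) -> O x ->
  \forall y \near x, f y = g y.
Proof. by move=> oO fg Ox; near=> y; apply: fg; near: y; exact: open_nbhs_nbhs. 
Unshelve. all: by end_near. Qed.

Lemma pd_ext O f g i x : open O -> (forall y, O y -> f y = g y) -> O x -> pd i f x = pd i g x.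
Proof. by move=> oO fg Ox; apply: near_eq_derive; exact: open_near_eq Ox. Qed.

Lemma continuous_ext O f g x : open O -> (forall y, O y -> f y = g y) -> O x ->
  {for x, continuous f} -> {for x, continuous g}.
Proof.
move=> oO fg Ox fc; rewrite /prop_for /continuous_at -(fg x Ox).
have h := open_near_eq oO (fun y Oy => esym (fg y Oy)) Ox.
have h' := open_near_eq oO fg Ox.
first [exact: (cvg_trans (near_eq_cvg h) fc) | exact: (cvg_trans (near_eq_cvg h') fc)].
Qed.

Lemma Ck_ext q O f g : open O -> (forall x, O x -> f x = g x) -> Ck q O f -> Ck q O g.
Proof.
move=> oO; elim: q f g => [|q IH] f g fg fk.
  by split=> // x Ox; exact: continuous_ext fg Ox (Ck_cont fk Ox).
split=> [x Ox|]; first exact: continuous_ext fg Ox (Ck_cont fk Ox).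
split=> [x v Ox|i].
  apply: (near_eq_is_derive (open_near_eq oO fg Ox)).
  under eq_bigr do rewrite -(pd_ext _ oO fg Ox).
  exact: Ck_derive fk Ox.
apply: IH (Ck_pd i fk) => x Ox; exact: pd_ext fg Ox.
Qed.

Lemma Ck_local q O u :
  (forall x, O x -> exists O', [/\ O' x & Ck q O' u]) -> Ck q O u.
Proof.
elim: q u => [|q IH] u H.
  by split=> // x /H [D' [D'x uk]]; exact: Ck_cont uk D'x.
split=> [x /H [D' [D'x uk]]|]; first exact: Ck_cont uk D'x.
split=> [x v /H [D' [D'x uk]]|i]; first exact: Ck_derive uk D'x.
by apply: IH => x /H [D' [D'x uk]]; exists D'; split=> //; exact: Ck_pd.
Qed.

(** A family [du] that represents all directional derivatives must consist of the partial
    derivatives, as the basis vectors show; this spares computing the partials beforehand. *)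
Lemma Ck_build q O u (du : 'I_m -> 'rV[R]_m -> R) : open O ->
  (forall x, O x -> {for x, continuous u}) ->
  (forall x v, O x -> is_derive x v u (\sum_(i < m) v 0 i * du i x)) ->
  (forall i, Ck q O (du i)) -> Ck q.+1 O u.
Proof.
move=> oO uc ud duk.
have E i x : O x -> pd i u x = du i x.
  move=> Ox; have [_ ->] := ud x 'e_i Ox.
  rewrite (bigD1 i) //= big1 => [|j ji]; first by rewrite mxE !eqxx mul1r addr0.
  by rewrite mxE eqxx /= (negbTE ji) mul0r.
split=> //; split=> [x v Ox|i]; last by apply: Ck_ext (duk i) => // x Ox; rewrite E.
by under eq_bigr do rewrite E //; exact: ud.
Qed.

Lemma pd_eq O u (du : 'I_m -> 'rV[R]_m -> R) i x :
  (forall x v, O x -> is_derive x v u (\sum_(i < m) v 0 i * du i x)) -> O x -> pd i u x = du i x.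
Proof.
move=> ud Ox; have [_ ->] := ud x 'e_i Ox.
rewrite (bigD1 i) //= big1 => [|j ji]; first by rewrite mxE !eqxx mul1r addr0.
by rewrite mxE eqxx /= (negbTE ji) mul0r.
Qed.

Lemma derive_cst_lin (c : R) x v : is_derive x v (fun=> c) (\sum_(i < m) v 0 i * 0).
Proof. by under eq_bigr do rewrite mulr0; rewrite big1 //; exact: is_derive_cst. Qed.

Lemma pd_cst (c : R) i x : pd i (fun=> c) x = 0.
Proof. exact: (@pd_eq setT _ (fun _ _ => 0) i x (fun y v _ => derive_cst_lin c y v)). Qed.

Lemma Ck_cst q O (c : R) : open O -> Ck q O (fun=> c).
Proof.
move=> oO; elim: q c => [|q IH] c; first by split=> // x _; exact: cst_continuous.
apply: (@Ck_build _ _ _ (fun _ _ => 0)) => // [x _|x v _]; first exact: cst_continuous.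
exact: derive_cst_lin.
Qed.

Lemma derive_add_lin q O f g x v : Ck q.+1 O f -> Ck q.+1 O g -> O x ->
  is_derive x v (fun x => f x + g x) (\sum_(i < m) v 0 i * (pd i f x + pd i g x)).
Proof.
move=> fk gk Ox; have df := Ck_derive v fk Ox; have dg := Ck_derive v gk Ox.
by under eq_bigr do rewrite mulrDr; rewrite big_split /=; exact: is_deriveD.
Qed.

Lemma pdD q O f g i x : Ck q.+1 O f -> Ck q.+1 O g -> O x ->
  pd i (fun x => f x + g x) x = pd i f x + pd i g x.
Proof.
move=> fk gk; apply: (@pd_eq O _ (fun i x => pd i f x + pd i g x)) => y v Oy.
exact: derive_add_lin fk gk Oy.
Qed.

Lemma CkD q O f g : open O -> Ck q O f -> Ck q O g -> Ck q O (fun x => f x + g x).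
Proof.
move=> oO; elim: q f g => [|q IH] f g fk gk.
  by split=> // x Ox; exact: (cvgD (Ck_cont fk Ox) (Ck_cont gk Ox)).
apply: (@Ck_build _ _ _ (fun i x => pd i f x + pd i g x)) => // [x Ox|x v Ox|i].
- by exact: (cvgD (Ck_cont fk Ox) (Ck_cont gk Ox)).
- exact: derive_add_lin fk gk Ox.
- by apply: IH; exact: Ck_pd.
Qed.

Lemma derive_mul_lin q O f g x v : Ck q.+1 O f -> Ck q.+1 O g -> O x ->
  is_derive x v (fun x => f x * g x) (\sum_(i < m) v 0 i * (f x * pd i g x + g x * pd i f x)).
Proof.
move=> fk gk Ox; have df := Ck_derive v fk Ox; have dg := Ck_derive v gk Ox.
have -> : \sum_(i < m) v 0 i * (f x * pd i g x + g x * pd i f x) =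
  f x *: (\sum_(i < m) v 0 i * pd i g x) + g x *: (\sum_(i < m) v 0 i * pd i f x).
  rewrite !scaler_sumr -big_split /=; apply: eq_bigr => i _.
  by rewrite mulrDr [v 0 i * (f x * _)]mulrCA [v 0 i * (g x * _)]mulrCA.
exact: is_deriveM.
Qed.

Lemma pdM q O f g i x : Ck q.+1 O f -> Ck q.+1 O g -> O x ->
  pd i (fun x => f x * g x) x = f x * pd i g x + g x * pd i f x.
Proof.
move=> fk gk; apply: (@pd_eq O _ (fun i x => f x * pd i g x + g x * pd i f x)) => y v Oy.
exact: derive_mul_lin fk gk Oy.
Qed.

Lemma CkM q O f g : open O -> Ck q O f -> Ck q O g -> Ck q O (fun x => f x * g x).
Proof.
move=> oO; elim: q f g => [|q IH] f g fk gk.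
  by split=> // x Ox; exact: (cvgM (Ck_cont fk Ox) (Ck_cont gk Ox)).
apply: (@Ck_build _ _ _ (fun i x => f x * pd i g x + g x * pd i f x)) => // [x Ox|x v Ox|i].
- by exact: (cvgM (Ck_cont fk Ox) (Ck_cont gk Ox)).
- exact: derive_mul_lin fk gk Ox.
- by apply: CkD => //; apply: IH; try exact: Ck_pd; exact: CkW.
Qed.

Lemma CkZ q O (c : R) f : open O -> Ck q O f -> Ck q O (fun x => c * f x).
Proof. by move=> oO; apply: CkM => //; exact: Ck_cst. Qed.

Lemma pdZ q O (c : R) f i x : open O -> Ck q.+1 O f -> O x ->
  pd i (fun x => c * f x) x = c * pd i f x.
Proof. by move=> oO fk Ox; have := pdM i (Ck_cst q.+1 c oO) fk Ox; rewrite pd_cst mulr0 addr0. Qed.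

Lemma Ck_sum q O (I : Type) (r : seq I) (P : pred I) (F : I -> 'rV[R]_m -> R) : open O ->
  (forall i, P i -> Ck q O (F i)) -> Ck q O (fun x => \sum_(i <- r | P i) F i x).
Proof.
move=> oO Fk; elim: r => [|i r IH].
  by apply: Ck_ext (Ck_cst q 0 oO) => // x _; rewrite big_nil.
have [Pi|nPi] := boolP (P i).
  by apply: Ck_ext (CkD oO (Fk i Pi) IH) => // x _; rewrite big_cons Pi.
by apply: Ck_ext IH => // x _; rewrite big_cons (negbTE nPi).
Qed.

Lemma pd_sum q O (I : Type) (r : seq I) (P : pred I) (F : I -> 'rV[R]_m -> R) j x : open O ->
  (forall i, P i -> Ck q.+1 O (F i)) -> O x ->
  pd j (fun x => \sum_(i <- r | P i) F i x) x = \sum_(i <- r | P i) pd j (F i) x.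
Proof.
move=> oO Fk Ox; elim: r => [|i r IH].
  by rewrite big_nil (_ : (fun _ => _) = fun=> 0) ?pd_cst //; apply/funext => y; rewrite big_nil.
rewrite big_cons; case: ifP => Pi.
  rewrite -IH -(pdD j (Fk i Pi) (@Ck_sum q.+1 O I r P F oO Fk) Ox).
  by congr ('D_ _ _ _); apply/funext => y; rewrite big_cons Pi.
by rewrite -IH; congr ('D_ _ _ _); apply/funext => y; rewrite big_cons Pi.
Qed.

Lemma derive_coord i x v : is_derive x v (fun x : 'rV[R]_m => x 0 i) (\sum_(j < m) v 0 j * (j == i)%:R).
Proof.
rewrite (bigD1 i) //= eqxx mulr1 big1 => [|j /negbTE ->]; last by rewrite mulr0.
rewrite addr0.
(* The point is written as a point of a line at parameter 0, the form in which [is_derive_line]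
   applies. *)
have [c ->] : exists c, x = c + 0 *: v by exists x; rewrite scale0r addr0.
apply/is_derive_line.
have -> : (fun s : R => (c + s *: v) 0 i) = (fun s => c 0 i + s * v 0 i).
  by apply/funext => s; rewrite !mxE.
have h := is_deriveD (is_derive_cst (c 0 i) (0 : R) (1 : R))
  (is_deriveM (is_derive_id (0 : R) (1 : R)) (is_derive_cst (v 0 i) (0 : R) (1 : R))).
by move: h; rewrite scaler0 !add0r [_ *: _]mulr1.
Qed.

Lemma pd_coord i j x : pd j (fun x : 'rV[R]_m => x 0 i) x = (j == i)%:R.
Proof. exact: (@pd_eq setT _ (fun j _ => (j == i)%:R) j x (fun y v _ => derive_coord i y v)). Qed.

Lemma Ck_coord q O i : open O -> Ck q O (fun x : 'rV[R]_m => x 0 i).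
Proof.
move=> oO; case: q => [|q]; first by split=> // x _; exact: coord_continuous.
apply: (@Ck_build _ _ _ (fun j _ => (j == i)%:R)) => // [x _|x v _|j].
- exact: coord_continuous.
- exact: derive_coord.
- exact: Ck_cst.
Qed.

End DifferentiabilityClasses.

(** * Powers of the positive part *)

Section PositivePart.
Variable R : realType.

(** For N = 0 this is the constant 1 and not an indicator; hence the vanishing lemmas start at
    [N.+1]. *)
Definition posp (N : nat) (s : R) : R := Num.max 0 s ^+ N.

Lemma posp_gt N s : 0 <= s -> posp N s = s ^+ N.
Proof. by move=> s0; rewrite /posp (max_idPr s0). Qed.

Lemma posp_le N s : s <= 0 -> posp N.+1 s = 0.
Proof. by move=> s0; rewrite /posp (max_idPl s0) expr0n. Qed.

Lemma posp_ge0 N s : 0 <= posp N s.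
Proof. by rewrite exprn_ge0 // le_max lexx. Qed.

Lemma continuous_posp N : continuous (posp N).
Proof.
move=> s; change (continuous_at s ((fun s : R => s ^+ N) \o (fun s : R => Num.max 0 s))).
apply: continuous_comp.
  by apply: continuous_max; [exact: cst_continuous|exact: cvg_id].
exact: exprn_continuous.
Qed.

Lemma is_derive_posp N (s : R) : is_derive s (1 : R) (posp N.+2) (N.+2%:R * posp N.+1 s).
Proof.
have dX : is_derive s (1 : R) (fun x : R => x ^+ N.+2) (N.+2%:R * s ^+ N.+1).
  by split; [exact: exprn_derivable|rewrite exp_derive; exact: mulr1].
have [s0|s0|s0] := ltrgtP s 0.
- rewrite posp_le ?ltW // mulr0.
  apply: (near_eq_is_derive _ (is_derive_cst (0 : R) s (1 : R))).
  near=> x; rewrite posp_le // ltW //; near: x.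
  by apply: lt_nbhsl.
- rewrite posp_gt ?ltW //; apply: (near_eq_is_derive _ dX).
  near=> x; rewrite posp_gt // ltW //; near: x; exact: lt_nbhsr.
(* At 0 the difference quotient is at most [posp N.+1] of the absolute value of [u n], which tends
   to 0. *)
- rewrite s0 posp_le // mulr0; apply: is_derive_seqP => u u0 uc.
  apply: norm_cvg0.
  have P0 : posp N.+1 (0 : R) = 0 by rewrite posp_le.
  apply: (@squeeze_cvgr _ _ _ _ (fun=> 0) (fun n => posp N.+1 `|u n|)).
  + near=> n; rewrite normr_ge0 /= addr0 [posp N.+2 0]posp_le // subr0.
    rewrite normrM normfV ler_pdivrMl ?normr_gt0 // ger0_norm ?posp_ge0 //.
    rewrite [posp _ `|_|]posp_gt // -exprS /posp lerXn2r ?nnegrE ?le_max ?lexx //.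
    by rewrite ge_max normr_ge0 ler_norm.
  + exact: cvg_cst.
  + have h : `|u n| @[n --> \oo] --> (0 : R) by rewrite -(normr0 R); exact: cvg_norm.
    by rewrite -P0; exact: (cvg_comp _ _ h (@continuous_posp N.+1 0)).
Unshelve. all: by end_near. Qed.

Lemma posp_le1 N (s : R) : s <= 1 -> posp N s <= 1.
Proof. by move=> s1; rewrite exprn_ile1 ?le_max ?lexx // ge_max ler01. Qed.

End PositivePart.

(** * The squared Euclidean norm, affine substitutions and functions of compact support *)

Section PosComposition.
Variables (R : realType) (m : nat).
Implicit Types (f g u : 'rV[R]_m -> R) (x y v : 'rV[R]_m) (O : set 'rV[R]_m).
Notation pd i f := ('D_('e_i) f).

Lemma sum_delta_row i (F : 'I_m -> R) : \sum_(j < m) ('e_i : 'rV[R]_m) 0 j * F j = F i.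
Proof.
rewrite (bigD1 i) //= big1 ?addr0 ?mxE ?eqxx ?mul1r // => j ji.
by rewrite mxE (negbTE ji) andbF mul0r.
Qed.

Lemma derive_posp_lin q O N u x v : Ck q.+1 O u -> O x ->
  is_derive x v (fun x => posp N.+2 (u x))
    (\sum_(i < m) v 0 i * (N.+2%:R * posp N.+1 (u x) * pd i u x)).
Proof.
move=> uk Ox.
have [c xE] : exists c, x = c + 0 *: v by exists x; rewrite scale0r addr0.
rewrite {1}xE; apply/is_derive_line.
have := Ck_derive v uk Ox; rewrite {1}xE => /is_derive_line du.
rewrite (_ : \sum_(i < m) _ = N.+2%:R * posp N.+1 (u x) * \sum_(i < m) v 0 i * pd i u x).
  have dp := is_derive_posp N (u (c + 0 *: v)); rewrite -xE in dp *.
  by move: dp; rewrite {1}xE => dp; exact: (is_derive1_comp (f := posp N.+2) (g := fun s => u (c + s *: v))).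
by rewrite mulr_sumr; apply: eq_bigr => i _; rewrite mulrCA.
Qed.

Lemma pd_posp q O N u i x : Ck q.+1 O u -> O x ->
  pd i (fun x => posp N.+2 (u x)) x = N.+2%:R * posp N.+1 (u x) * pd i u x.
Proof.
move=> uk; apply: (@pd_eq _ _ O _ (fun i x => N.+2%:R * posp N.+1 (u x) * pd i u x)) => y v Oy.
exact: derive_posp_lin uk Oy.
Qed.

Lemma Ck_posp q O N u : open O -> (q <= N)%N -> Ck q O u -> Ck q O (fun x => posp N.+1 (u x)).
Proof.
move=> oO; elim: q N u => [|q IH] N u qN uk.
  split=> // x Ox; apply: (continuous_comp (Ck_cont uk Ox)); exact: continuous_posp.
case: N qN => // N qN.
apply: (@Ck_build _ _ _ _ _ (fun i x => N.+2%:R * posp N.+1 (u x) * pd i u x)) => // [x Ox|x v Ox|i].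
- apply: (continuous_comp (Ck_cont uk Ox)); exact: continuous_posp.
- exact: derive_posp_lin uk Ox.
- apply: CkM => //; last exact: Ck_pd.
  by apply: CkZ => //; apply: IH => //; exact: CkW.
Qed.

(** The norm on row vectors is the sup norm; Euclidean balls are expressed through this polynomial,
    which is smooth also at the origin. *)
Definition nsq x : R := \sum_(i < m) x 0 i ^+ 2.

Lemma nsq_ge0 x : 0 <= nsq x.
Proof. by apply: sumr_ge0 => i _; rewrite sqr_ge0. Qed.

Lemma nsq0 : nsq 0 = 0.
Proof. by rewrite /nsq big1 // => i _; rewrite mxE expr0n. Qed.

Lemma nsq_coord x i : x 0 i ^+ 2 <= nsq x.
Proof. by rewrite /nsq (bigD1 i) //= lerDl; apply: sumr_ge0 => j _; rewrite sqr_ge0. Qed.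

Lemma nsqZ a x : nsq (a *: x) = a ^+ 2 * nsq x.
Proof. by rewrite /nsq mulr_sumr; apply: eq_bigr => i _; rewrite mxE exprMn. Qed.

Lemma Ck_nsq q O : open O -> Ck q O nsq.
Proof.
move=> oO; apply: Ck_sum => // i _.
by apply: (Ck_ext oO _ (CkM oO (Ck_coord q i oO) (Ck_coord q i oO))) => x _; rewrite expr2.
Qed.

Lemma pd_nsq i x : pd i nsq x = 2 * x 0 i.
Proof.
have -> : nsq = (fun x => \sum_(i < m) (fun x : 'rV[R]_m => x 0 i * x 0 i) x).
  by apply/funext => y; apply: eq_bigr => j _; rewrite expr2.
rewrite (pd_sum (q := 0) (O := setT)) //; last 2 first.
- exact: openT.
- by move=> j _; apply: CkM; [exact: openT|apply: Ck_coord; exact: openT|apply: Ck_coord; exact: openT].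
have E j : pd i (fun x : 'rV[R]_m => x 0 j * x 0 j) x = 2 * (x 0 j * (i == j)%:R).
  rewrite (pdM (q := 0) (O := setT)) //; try by apply: Ck_coord; exact: openT.
  by rewrite pd_coord mulr2n mulrDl mul1r.
under eq_bigr do rewrite E.
rewrite (bigD1 i) //= eqxx big1 ?addr0 ?mulr1 // => j ji.
by rewrite eq_sym (negbTE ji) !mulr0.
Qed.

Lemma continuous_nsq : continuous nsq.
Proof. by move=> x; have [h _] := Ck_nsq 0 openT; exact: h. Qed.

Lemma derive_affine_lin q O u a r x v : Ck q.+1 O u -> O (a + r *: x) ->
  is_derive x v (fun x => u (a + r *: x)) (\sum_(i < m) v 0 i * (r * pd i u (a + r *: x))).
Proof.
move=> uk Ox.
have [c xE] : exists c, x = c + 0 *: v by exists x; rewrite scale0r addr0.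
rewrite {1}xE; apply/is_derive_line.
have E : (fun s : R => u (a + r *: (c + s *: v))) = (fun s => u ((a + r *: c) + s *: (r *: v))).
  by apply/funext => s; rewrite scalerDr !scalerA [s * r]mulrC addrA.
rewrite E; apply/is_derive_line.
have -> : a + r *: c + 0 *: (r *: v) = a + r *: x by rewrite xE !scale0r !addr0.
have := Ck_derive (r *: v) uk Ox.
by under eq_bigr do rewrite mxE -mulrA mulrCA.
Qed.

Lemma pd_affine q O u a r i x : Ck q.+1 O u -> O (a + r *: x) ->
  pd i (fun x => u (a + r *: x)) x = r * pd i u (a + r *: x).
Proof.
move=> uk; apply: (@pd_eq _ _ [set x | O (a + r *: x)] _ (fun i x => r * pd i u (a + r *: x))) => y v Oy.
exact: derive_affine_lin uk Oy.
Qed.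

Lemma continuous_affine (a : 'rV[R]_m) (r : R) : continuous (fun x : 'rV[R]_m => a + r *: x).
Proof. move=> x; apply: continuousD; first exact: cst_continuous.
exact: scaler_continuous. Qed.

Lemma open_affine O a r : open O -> open [set x | O (a + r *: x)].
Proof. by move=> oO; apply: (open_comp (f := fun x => a + r *: x)) => // x _; exact: continuous_affine. Qed.

Lemma Ck_affine q O u a r : open O -> Ck q O u ->
  Ck q [set x | O (a + r *: x)] (fun x => u (a + r *: x)).
Proof.
move=> oO; have oO' := @open_affine O a r oO; elim: q u => [|q IH] u uk.
  by split=> // x Ox; have := continuous_comp (@continuous_affine a r x) (Ck_cont uk Ox).
apply: (@Ck_build _ _ _ _ _ (fun i x => r * pd i u (a + r *: x))) => // [x Ox|x v Ox|i].
- by have := continuous_comp (@continuous_affine a r x) (Ck_cont uk Ox).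
- exact: derive_affine_lin uk Ox.
- by apply: CkZ => //; apply: (IH (pd i u)); exact: Ck_pd.
Qed.

Lemma nsq_le_coord (t : R) x i : 0 <= t -> nsq x <= t ^+ 2 -> `|x 0 i| <= t.
Proof.
move=> t0 xt; rewrite -(ger0_norm t0) -ler_sqr ?nnegrE ?normr_ge0 // !real_normK ?num_real //.
exact: le_trans (nsq_coord x i) xt.
Qed.

Definition Cc (P : R) f := continuous f /\ forall x i, P < `|x 0 i| -> f x = 0.

Lemma open_coord_gt (P : R) i : open [set x : 'rV[R]_m | P < `|x 0 i|].
Proof.
have -> : [set x : 'rV[R]_m | P < `|x 0 i|] = (fun x : 'rV[R]_m => `|x 0 i|) @^-1` [set t | P < t] by [].
apply: open_comp; last exact: open_gt.
move=> x _; apply: (continuous_comp (@coord_continuous _ _ _ _ _ x)); exact: norm_continuous.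
Qed.

Lemma Cc_bounded P f : Cc P f -> exists2 C, 0 <= C & forall x, `|f x| <= C.
Proof.
(* For negative [P] the function vanishes identically, unless m = 0, where the space is a single
   point without coordinates. *)
move=> [fc fP]; have [P0|P0] := ltP P 0.
  case: (posnP m) => [m0|m0].
    exists `|f 0| => // x; suff -> : x = 0 by [].
    by apply/rowP => i; have := ltn_ord i; rewrite {2}m0.
  by exists 0 => // x; rewrite (fP x (Ordinal m0)) ?normr0 // (lt_le_trans P0).
pose K := [set x : 'rV[R]_m | forall i, `|x 0 i| <= P].
have cK : compact K.
  apply: bounded_closed_compact.
    exists P; split; first exact: num_real.
    move=> M PM x Kx /=; rewrite [X in X <= _]mx_normrE; apply/bigmax_leP; split=> [|[i j] _ /=].
      by rewrite (le_trans P0) // ltW.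
    by rewrite (ord1 i) (le_trans (Kx j)) // ltW.
  rewrite (_ : K = ~` \bigcup_(i in setT) [set x : 'rV[R]_m | P < `|x 0 i|]).
    by apply: open_closedC; apply: bigcup_open => i _; exact: open_coord_gt.
  apply/seteqP; split => [x Kx [i _ /=]|x Kx i]; first by rewrite ltNge Kx.
  by rewrite leNgt; apply/negP => h; apply: Kx; exists i.
have [||c cK' cmax] := @EVT_max_rV R m (fun x => `|f x|) K _ cK.
- by exists 0 => i; rewrite mxE normr0.
- apply: continuous_subspaceT => x; apply: (continuous_comp (fc x)); exact: norm_continuous.
exists `|f c| => // x; have [Kx|nKx] := pselect (K x); first by apply: cmax; rewrite inE.
have /existsNP[i /negP] := nKx; rewrite -ltNge => h.
by rewrite (fP x i h) normr0.
Qed.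

Lemma Cc_vbaire P f : Cc P f -> exists C, vbaire P C f.
Proof. by move=> fc; have [C _ fC] := Cc_bounded fc; exists C; case: fc => ? ?; exact: vbaire_cont. Qed.

Lemma Cc_pd P q u i : Ck q.+1 setT u -> Cc P u -> Cc P (pd i u).
Proof.
move=> uk [uc uP]; split=> [x|x j Px]; first exact: (Ck_cont (Ck_pd i uk)).
by rewrite (pd_ext i (@open_coord_gt P j) (g := fun=> 0) _ Px) ?pd_cst // => y; exact: uP.
Qed.

(** By translation invariance the integral of u(x + t e_i) does not depend on t; differentiating
    under the integral sign at t = 0 gives the claim. *)
Lemma rint_pd P q u i : 0 <= P -> Ck q.+1 setT u -> Cc P u -> rint (pd i u) = 0.
Proof.
move=> P0 uk uc.
have [C ub] := Cc_vbaire uc; have [C' _ dC] := Cc_bounded (Cc_pd i uk uc).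
have pd' t x : is_derive t (1 : R) (fun t : R => u (x + t *: 'e_i)) (pd i u (x + t *: 'e_i)).
  apply/is_derive_line; have := Ck_derive 'e_i uk (x := x + t *: 'e_i) I.
  by rewrite sum_delta_row.
have [t t1||_] := @is_derive_rint R m (P + 1) C C' 0 1 (fun t x => u (x + t *: 'e_i))
   (fun t x => pd i u (x + t *: 'e_i)) (addr_ge0 P0 ler01) ltr01.
- rewrite subr0 in t1; apply: vbaire_cont => [x|x|x j Px].
  + apply: continuous_comp; last exact: (Ck_cont uk).
    apply: continuousD; [exact: cvg_id|exact: cst_continuous].
  + exact: vbaire_bound ub.
  + apply: uc.2 (j) _; rewrite -(ltrD2r 1) (lt_le_trans Px) // -{1}(addrK (t *: 'e_i) x).
    rewrite !mxE (le_trans (ler_normB _ _)) // lerD2l normrM.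
    by rewrite eqxx; case: (j == i); rewrite ?normr1 ?mulr1 ?normr0 ?mulr0 ?ltW.
- by move=> t x _; exact: dC.
have -> : (fun t : R => rint (fun x => u (x + t *: 'e_i))) = fun=> rint u.
  by apply/funext => t; exact: rint_shift ub.
move=> [_]; rewrite derive_cst => ->.
by congr rint; apply/funext => x; rewrite scale0r addr0.
Qed.

End PosComposition.

(** * Algebra of compactly supported functions and cutoffs *)

Section CompactSupport.
Variables (R : realType) (m : nat).
Implicit Types (f g u : 'rV[R]_m -> R) (x y v : 'rV[R]_m) (O : set 'rV[R]_m).
Notation pd i f := ('D_('e_i) f).

Lemma CcM P f g : Cc P f -> continuous g -> Cc P (fun x => f x * g x).
Proof.
move=> [fc fP] gc; split=> [x|x i Px]; first exact: (cvgM (fc x) (gc x)).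
by rewrite (fP x i) // mul0r.
Qed.

Lemma CcD P f g : Cc P f -> Cc P g -> Cc P (fun x => f x + g x).
Proof.
move=> [fc fP] [gc gP]; split=> [x|x i Px]; first exact: (cvgD (fc x) (gc x)).
by rewrite (fP x i) // (gP x i) // addr0.
Qed.

Lemma CcZ P c f : Cc P f -> Cc P (fun x => c * f x).
Proof.
move=> [fc fP]; split=> [x|x i Px]; last by rewrite (fP x i) // mulr0.
exact: (cvgM (@cst_continuous _ _ c x) (fc x)).
Qed.

Lemma Cc_mono P P' f : P <= P' -> Cc P f -> Cc P' f.
Proof. by move=> PP [fc fP]; split=> // x i Px; apply: (fP x i); exact: le_lt_trans Px. Qed.

Lemma Cc0 P : Cc P (fun _ : 'rV[R]_m => 0).
Proof. by split=> // x; exact: cst_continuous. Qed.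

Lemma Cc_sum P (I : Type) (r : seq I) (F : I -> 'rV[R]_m -> R) :
  (forall i, Cc P (F i)) -> Cc P (fun x => \sum_(i <- r) F i x).
Proof.
move=> FP; elim: r => [|i r IH].
  by rewrite (_ : (fun _ => _) = fun=> 0); [exact: Cc0|apply/funext => x; rewrite big_nil].
rewrite (_ : (fun _ => _) = fun x => F i x + \sum_(j <- r) F j x); first exact: CcD.
by apply/funext => x; rewrite big_cons.
Qed.

Lemma rintD_Cc P f g : 0 <= P -> Cc P f -> Cc P g ->
  rint (fun x => f x + g x) = rint f + rint g.
Proof. by move=> P0 /Cc_vbaire[C1 fb] /Cc_vbaire[C2 gb]; exact: rintD fb gb. Qed.

Lemma rintZ_Cc P c f : 0 <= P -> Cc P f -> rint (fun x => c * f x) = c * rint f.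
Proof. by move=> P0 /Cc_vbaire[C1 fb]; exact: rintZ fb. Qed.

Lemma rint_sum_Cc P (I : Type) (r : seq I) (F : I -> 'rV[R]_m -> R) : 0 <= P ->
  (forall i, Cc P (F i)) -> rint (fun x => \sum_(i <- r) F i x) = \sum_(i <- r) rint (F i).
Proof.
move=> P0 FP; elim: r => [|i r IH].
  by rewrite big_nil -[RHS](rint0 R m); congr rint; apply/funext => x; rewrite big_nil.
rewrite big_cons -IH -(rintD_Cc P0 (FP i) (Cc_sum r FP)).
by congr rint; apply/funext => x; rewrite big_cons.
Qed.

Lemma CkT_cont q u : Ck q setT u -> continuous u.
Proof. by move=> uk x; exact: (Ck_cont uk). Qed.

Lemma continuous_sum (I : Type) (r : seq I) (F : I -> 'rV[R]_m -> R) :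
  (forall i, continuous (F i)) -> continuous (fun x => \sum_(i <- r) F i x).
Proof.
move=> Fc; apply: (@CkT_cont 0); apply: Ck_sum; first exact: openT.
by move=> i _; split=> // x _; exact: Fc.
Qed.

Lemma continuousMf f g : continuous f -> continuous g -> continuous (fun x => f x * g x).
Proof. by move=> fc gc x; exact: (cvgM (fc x) (gc x)). Qed.

(** This lets results on the whole space be used for functions that are regular only on [O]. In the
    cutoff [eta] the parameter [s] runs from 0 to 1 as the squared distance to c runs from a to b;
    positive parts to the power q + 1 are C^q, and [eta] is 1 below a and 0 above b. Near a point of
    the closed ball the product is regular because [O] is, elsewhere because it vanishes. *)
Lemma cutoff_extension q O u c (a b : R) : open O -> 0 <= b -> a < b ->
  (forall z, nsq (- c + 1 *: z) <= b -> O z) -> Ck q O u ->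
  exists P, exists V, [/\ 0 <= P, Ck q setT V, Cc P V &
    forall z, nsq (- c + 1 *: z) <= a -> V z = u z].
Proof.
move=> oO b0 ab bO uk.
pose s (z : 'rV[R]_m) := (b - a)^-1 * (nsq (- c + 1 *: z) + - a).
pose eta z := posp q.+1 (1 + (-1) * posp q.+1 (s z)).
have ba0 : 0 < b - a by rewrite subr_gt0.
have sk : Ck q setT s.
  apply: CkZ; first exact: openT.
  apply: CkD; [exact: openT| |apply: Ck_cst; exact: openT].
  have h := @Ck_affine R m q setT (@nsq R m) (- c) 1 (@openT _) (Ck_nsq q (@openT _)).
  by apply: (Ck_sub (O := [set x | setT (- c + 1 *: x)])).
have ek : Ck q setT eta.
  apply: Ck_posp => //; first exact: openT.
  apply: CkD; [exact: openT|apply: Ck_cst; exact: openT|].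
  by apply: CkZ; [exact: openT|apply: Ck_posp => //; exact: openT].
have e0 z : b <= nsq (- c + 1 *: z) -> eta z = 0.
  move=> bz; rewrite /eta posp_le // mulN1r subr_le0.
  have s1 : 1 <= s z by rewrite /s mulrC ler_pdivlMr // mul1r lerD2r.
  by rewrite posp_gt ?(le_trans ler01) // exprn_ege1.
(* On the support each coordinate of z - c is at most 1 + b, because b <= (1 + b)^2; the sum
   accounts for the centre. *)
exists (1 + b + \sum_j `|c 0 j|); exists (fun z => eta z * u z); split.
- by rewrite addr_ge0 ?sumr_ge0 // addr_ge0.
- apply: Ck_local => x _; have [xb|xb] := leP (nsq (- c + 1 *: x)) b.
    exists O; split; first exact: bO.
    by apply: CkM => //; exact: Ck_sub ek.
  pose D' := (fun z : 'rV[R]_m => - c + 1 *: z) @^-1` ((@nsq R m) @^-1` [set t | b < t]).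
  have oD : open D'.
    apply: open_comp; first by move=> z _; exact: continuous_affine.
    apply: open_comp; last exact: open_gt.
    by move=> z _; exact: continuous_nsq.
  exists D'; split => //.
  apply: (Ck_ext oD _ (Ck_cst q 0 oD)) => z Dz.
  by rewrite e0 ?mul0r // ltW.
- split=> [x|x i Px].
    have [xb|xb] := leP (nsq (- c + 1 *: x)) b.
      exact: (cvgM (Ck_cont ek (x := x) I) (Ck_cont uk (bO x xb))).
    pose D' := (fun z : 'rV[R]_m => - c + 1 *: z) @^-1` ((@nsq R m) @^-1` [set t | b < t]).
    have oD : open D'.
      apply: open_comp; first by move=> z _; exact: continuous_affine.
      apply: open_comp; last exact: open_gt.
      by move=> z _; exact: continuous_nsq.
    apply: (continuous_ext (O := D') (f := fun=> 0)) => //; last exact: cst_continuous.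
    by move=> z Dz; rewrite e0 ?mul0r // ltW.
  rewrite e0 ?mul0r //; rewrite leNgt; apply/negP => xb; move: Px; apply/negP; rewrite -leNgt.
  have h : `|(- c + 1 *: x) 0 i| <= 1 + b.
    by apply: nsq_le_coord; nra.
  rewrite -(subrK (c 0 i) (x 0 i)) (le_trans (ler_normD _ _)) // lerD //.
    by move: h; rewrite !mxE mul1r addrC.
  by rewrite (bigD1 i) //= lerDl sumr_ge0.
- move=> z za; rewrite /eta [posp _ (s z)]posp_le; last first.
    by rewrite /s mulr_ge0_le0 ?invr_ge0 ?subr_le0 //; exact: ltW.
  by rewrite mulr0 addr0 posp_gt // expr1n mul1r.
Qed.

End CompactSupport.

(** * Integration by parts against the weights (t - |x|^2)_+^N *)

Section Green.
Variables (R : realType) (m : nat).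
Implicit Types (f g u V : 'rV[R]_m -> R) (x y v : 'rV[R]_m) (O : set 'rV[R]_m).
Notation pd i f := ('D_('e_i) f).

Definition euler u x : R := \sum_(i < m) x 0 i * pd i u x.
Definition lap u x : R := \sum_(i < m) pd i (pd i u) x.

Definition wt (N : nat) (t : R) x : R := posp N (t - nsq x).

Lemma Ck_wt q N t : (q <= N)%N -> Ck q setT (wt N.+1 t).
Proof.
move=> qN; apply: Ck_posp => //; first exact: openT.
have := CkD (@openT _) (Ck_cst q t (@openT _)) (CkZ (-1) (@openT _) (Ck_nsq (R := R) (m := m) q (@openT _))).
by apply: Ck_ext; [exact: openT|move=> x _; rewrite mulN1r].
Qed.

Lemma pd_wt N t i x : pd i (wt N.+2 t) x = - (2 * N.+2%:R) * x 0 i * wt N.+1 t x.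
Proof.
have k : Ck 1 setT (fun x : 'rV[R]_m => t + -1 * nsq x).
  by apply: CkD; [exact: openT|apply: Ck_cst; exact: openT|apply: CkZ; [exact: openT|apply: Ck_nsq; exact: openT]].
have -> : wt N.+2 t = (fun x => posp N.+2 (t + -1 * nsq x)).
  by apply/funext => y; rewrite /wt mulN1r.
rewrite (pd_posp N i k) // (pdD i (Ck_cst 1 t (@openT _)) (CkZ (-1) (@openT _) (Ck_nsq (R := R) (m := m) 1 (@openT _)))) //.
rewrite pd_cst add0r (pdZ (-1) i (@openT _) (Ck_nsq (R := R) (m := m) 1 (@openT _))) // pd_nsq.
by rewrite /wt mulN1r; ring.
Qed.

Lemma wt0 N t x : t <= nsq x -> wt N.+1 t x = 0.
Proof. by move=> tx; rewrite /wt posp_le // subr_le0. Qed.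

Lemma Cc_wt N t : 0 <= t -> Cc (1 + t) (wt N.+1 t).
Proof.
move=> t0; split; first exact: (CkT_cont (@Ck_wt N N t (leqnn _))).
move=> x i Px; apply: wt0; rewrite leNgt; apply/negP => xt; move: Px; apply/negP; rewrite -leNgt.
by apply: nsq_le_coord; nra.
Qed.

Lemma continuous_euler u : Ck 1 setT u -> continuous (euler u).
Proof.
move=> uk; apply: continuous_sum => i; apply: continuousMf.
  by move=> x; exact: coord_continuous.
exact: (CkT_cont (Ck_pd i uk)).
Qed.

Lemma continuous_lap u : Ck 2 setT u -> continuous (lap u).
Proof. by move=> uk; apply: continuous_sum => i; exact: (CkT_cont (Ck_pd i (Ck_pd i uk))). Qed.

(* Integration by parts, from [wt N.+2]' = - 2 (N + 2) x wt N.+1. *)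
Lemma green_wt N t V : 0 <= t -> Ck 2 setT V ->
  rint (fun x => wt N.+1 t x * euler V x) =
  (2 * N.+2%:R)^-1 * rint (fun x => wt N.+2 t x * lap V x).
Proof.
move=> t0 Vk; have P0 : 0 <= 1 + t by rewrite addr_ge0.
have N0 : (2 * N.+2%:R : R) != 0 by rewrite mulf_neq0 ?pnatr_eq0.
have Fk i : Ck 1 setT (fun x => wt N.+2 t x * pd i V x).
  by apply: CkM; [exact: openT|exact: Ck_wt|exact: Ck_pd].
have Fc i : Cc (1 + t) (fun x => wt N.+2 t x * pd i V x).
  by apply: CcM; [exact: Cc_wt|exact: (CkT_cont (Ck_pd i Vk))].
have F0 i := rint_pd i P0 (Fk i) (Fc i).
have FE i x : pd i (fun x => wt N.+2 t x * pd i V x) x =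
    wt N.+2 t x * pd i (pd i V) x + - (2 * N.+2%:R) * (wt N.+1 t x * (x 0 i * pd i V x)).
  rewrite (pdM i (Ck_wt t (ltn0Sn N)) (Ck_pd i Vk)) // pd_wt.
  by ring.
have A : Cc (1 + t) (fun x => wt N.+2 t x * lap V x).
  by apply: CcM; [exact: Cc_wt|exact: continuous_lap].
have B : Cc (1 + t) (fun x => wt N.+1 t x * euler V x).
  by apply: CcM; [exact: Cc_wt|apply: continuous_euler; exact: CkW].
have : rint (fun x => wt N.+2 t x * lap V x + - (2 * N.+2%:R) * (wt N.+1 t x * euler V x)) = 0.
  transitivity (rint (fun x => \sum_(i <- index_enum 'I_m) pd i (fun x => wt N.+2 t x * pd i V x) x)).
    congr rint; apply/funext => x; under eq_bigr do rewrite FE.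
    by rewrite big_split /= -!mulr_sumr.
  rewrite (rint_sum_Cc _ P0) => [|i]; last exact: Cc_pd (Fk i) (Fc i).
  by rewrite big1.
rewrite (rintD_Cc P0 A (CcZ _ B)) (rintZ_Cc _ P0 B) mulNr => /eqP; rewrite subr_eq0 => /eqP ->.
by rewrite mulKf.
Qed.

End Green.

(** * Weights on the unit ball, including its indicator *)

Section BallWeights.
Variables (R : realType) (m : nat).
Implicit Types (f g u V : 'rV[R]_m -> R) (x y v : 'rV[R]_m) (O : set 'rV[R]_m).
Notation pd i f := ('D_('e_i) f).

(* The powers (1 - |x|^2)_+^N, the case N = 0 being the closed unit ball. *)
Definition bw (N : nat) x : R := if N is 0%N then (nsq x <= 1)%R%:R else wt N 1 x.

(* Continuous approximations of the indicator of the ball, and C^1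
   approximations of [bw 1] of which they are the radial derivative. *)
Definition bw0_approx (n : nat) x : R := n.+1%:R * (wt 1 (1 + n.+1%:R^-1) x - wt 1 1 x).
Definition bw1_approx (n : nat) x : R :=
  n.+1%:R / 2 * (wt 2 (1 + n.+1%:R^-1) x - wt 2 1 x).

Lemma wt1E t x : wt 1 t x = Num.max 0 (t - nsq x).
Proof. by rewrite /wt /posp expr1. Qed.

Lemma wt2E t x : wt 2 t x = Num.max 0 (t - nsq x) ^+ 2.
Proof. by []. Qed.

Let invn_gt0 n : 0 < n.+1%:R^-1 :> R. Proof. by rewrite invr_gt0. Qed.
Let invn_le1 n : n.+1%:R^-1 <= 1 :> R. Proof. by rewrite invf_le1 // ler1n. Qed.
Let mulinv n : n.+1%:R * n.+1%:R^-1 = 1 :> R. Proof. by rewrite divff. Qed.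

(** A majorant that does not depend on n and has compact support: the approximations lie between 0
    and 1 and vanish where |x|^2 > 2, while 3 - |x|^2 >= 1 where |x|^2 <= 2. *)
Lemma bw0_approx_bound n x : `|bw0_approx n x| <= wt 1 3 x.
Proof.
rewrite /bw0_approx !wt1E; set k : R := n.+1%:R.
have k0 := invn_gt0 n; have k1 := invn_le1 n; have kk := mulinv n.
have s0 := nsq_ge0 x; rewrite -/k in k0 k1 kk; set d := k^-1 in k0 k1 kk *.
have kp : 0 < k by rewrite /k.
case: (leP 0 (1 + d - nsq x)) => h1; case: (leP 0 (1 - nsq x)) => h2;
  case: (leP 0 (3 - nsq x)) => h3; rewrite ?subr0 ?subrr ?mulr0 ?normr0 //; try lra.
- by rewrite ger0_norm; nra.
- by rewrite ger0_norm; nra.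
Qed.

Lemma bw1_approx_bound n x : `|bw1_approx n x| <= wt 1 3 x.
Proof.
rewrite /bw1_approx !wt2E wt1E; set k : R := n.+1%:R.
have k0 := invn_gt0 n; have k1 := invn_le1 n; have kk := mulinv n.
have s0 := nsq_ge0 x; rewrite -/k in k0 k1 kk; set d := k^-1 in k0 k1 kk *.
have kp : 0 < k by rewrite /k.
have E (A B : R) : k / 2 * (A ^+ 2 - B ^+ 2) = (k * (A - B)) * ((A + B) / 2) by field.
rewrite E.
case: (leP 0 (1 + d - nsq x)) => h1; case: (leP 0 (1 - nsq x)) => h2;
  case: (leP 0 (3 - nsq x)) => h3; rewrite ?subr0 ?subrr ?mulr0 ?mul0r ?normr0 //; try lra.
- have -> : k * (1 + d - nsq x - (1 - nsq x)) = 1 by rewrite -kk; ring.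
  by rewrite mul1r ger0_norm; lra.
- have a : k * (1 + d - nsq x) <= 1 by nra.
  have b : 0 <= k * (1 + d - nsq x) by rewrite mulr_ge0 // ltW.
  by rewrite ger0_norm ?mulr_ge0 //; nra.
Qed.

Let near_pos x : nsq x > 1 -> \forall n \near \oo, 1 + n.+1%:R^-1 - nsq x <= 0 :> R.
Proof.
move=> x1; have d0 : 0 < nsq x - 1 by rewrite subr_gt0.
have := near_infty_natSinv_lt (PosNum d0); apply: filterS => n /=.
by move=> /ltW h; rewrite subr_le0 addrC -lerBrDr.
Qed.

Lemma bw0_approx_cvg x : bw0_approx n x @[n --> \oo] --> bw 0 x.
Proof.
rewrite /bw; case: (leP (nsq x) 1) => x1.
  apply: cvg_near_cst; apply: nearW => n; rewrite /bw0_approx !wt1E.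
  rewrite !max_r ?subr_ge0 //; last by rewrite (le_trans x1) // lerDl ltW.
  by rewrite opprB addrA subrK addrAC subrr add0r mulinv.
apply: cvg_near_cst; have := near_pos x1; apply: filterS => n h.
by rewrite /bw0_approx !wt1E !max_l ?subrr ?mulr0 // subr_le0 ltW.
Qed.

Lemma bw1_approx_cvg x : bw1_approx n x @[n --> \oo] --> bw 1 x.
Proof.
rewrite /bw; case: (leP (nsq x) 1) => x1; last first.
  rewrite wt1E max_l ?subr_le0 ?ltW //.
  apply: cvg_near_cst; have := near_pos x1; apply: filterS => n h.
  by rewrite /bw1_approx !wt2E !max_l ?expr0n ?subrr ?mulr0 // subr_le0 ltW.
have E n : bw1_approx n x = wt 1 1 x + 2^-1 * n.+1%:R^-1.
  rewrite /bw1_approx !wt2E wt1E !max_r ?subr_ge0 //; last by rewrite (le_trans x1) // lerDl ltW.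
  have h := mulinv n; set d := _^-1 in h *; set k := n.+1%:R in h *.
  have -> : k / 2 * ((1 + d - nsq x) ^+ 2 - (1 - nsq x) ^+ 2) = 2^-1 * ((k * d) * (d + 2 * (1 - nsq x))) by field.
  by rewrite h; field.
under eq_fun do rewrite E.
suff : wt 1 1 x + 2^-1 * n.+1%:R^-1 @[n --> \oo] --> wt 1 1 x + 2^-1 * 0 by rewrite mulr0 addr0.
by apply: cvgD; [exact: cvg_cst|apply: cvgMr; exact: cvg_harmonic].
Qed.

Lemma continuous_bw0_approx n : continuous (bw0_approx n).
Proof.
apply: (@CkT_cont _ _ 0); apply: CkZ; first exact: openT.
apply: (Ck_ext (f := fun x => wt 1 (1 + n.+1%:R^-1) x + -1 * wt 1 1 x)); first exact: openT.
  by move=> x _; rewrite mulN1r.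
by apply: CkD; [exact: openT|exact: Ck_wt|apply: CkZ; [exact: openT|exact: Ck_wt]].
Qed.

Lemma continuous_bw1_approx n : continuous (bw1_approx n).
Proof.
apply: (@CkT_cont _ _ 0); apply: CkZ; first exact: openT.
apply: (Ck_ext (f := fun x => wt 2 (1 + n.+1%:R^-1) x + -1 * wt 2 1 x)); first exact: openT.
  by move=> x _; rewrite mulN1r.
by apply: CkD; [exact: openT|exact: Ck_wt|apply: CkZ; [exact: openT|exact: Ck_wt]].
Qed.

(** The half-width 4 of the box, used from here on, is the [1 + t] of [Cc_wt] at t = 3. *)
Let dominated_vbaire (w g : 'rV[R]_m -> R) : continuous w -> (forall x, `|w x| <= wt 1 3 x) -> continuous g ->
  forall C : R, (forall x, `|wt 1 3 x * g x| <= C) -> vbaire 4 C (fun x => w x * g x).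
Proof.
move=> wc wb gc C hC; apply: vbaire_cont => [|x|x i Px].
- exact: continuousMf.
- rewrite (le_trans _ (hC x)) // !normrM ler_wpM2r // (le_trans (wb x)) // ler_norm //.
- have [_ h] := @Cc_wt R m 0 3 (ler0n _ 3).
  have := wb x; rewrite (h x i) ?normr_le0 => [/eqP ->|]; first by rewrite mul0r.
  by rewrite (_ : 1 + 3 = 4) //; ring.
Qed.

Let Cc_wt13 g : continuous g -> exists C, forall x, `|wt 1 3 x * g x| <= C.
Proof.
move=> gc; have [C _ h] := Cc_bounded (CcM (@Cc_wt R m 0 3 (ler0n _ 3)) gc).
by exists C.
Qed.

Lemma bw_le1 N x : 0 <= bw N x <= 1.
Proof.
case: N => [|N]; first by rewrite /bw; case: (nsq x <= 1); rewrite ?lexx ler01.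
by rewrite /= /wt posp_ge0 posp_le1 // gerBl nsq_ge0.
Qed.

Lemma bw_gt1 N x : 1 < nsq x -> bw N x = 0.
Proof. by case: N => [|N] x1; [rewrite /bw leNgt x1|rewrite /= wt0 // ltW]. Qed.

Lemma bwM_eq N g h x : (nsq x <= 1 -> g x = h x) -> bw N x * g x = bw N x * h x.
Proof. by have [x1 ->|x1 _] := leP (nsq x) 1; rewrite // bw_gt1 // !mul0r. Qed.

(** For N = 0 the weight is discontinuous and belongs to the class only as the limit of
    [bw0_approx]. *)
Lemma vbaire_bw N g : continuous g -> exists C, vbaire 4 C (fun x => bw N x * g x).
Proof.
move=> gc; case: N => [|N].
  have [C hC] := Cc_wt13 gc; exists C.
  apply: (@vbaire_lim _ _ _ _ (fun n x => bw0_approx n x * g x)) => [n|x].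
    have h := dominated_vbaire (@continuous_bw0_approx n) (@bw0_approx_bound n) gc hC.
    exact: h.
  by apply: cvgMl; exact: bw0_approx_cvg.
have h := CcM (@Cc_wt R m N 1 ler01) gc.
apply: (Cc_vbaire (P := 4)); apply: Cc_mono h.
by rewrite (_ : 4 = 1 + 3) ?lerD2l ?ler1n //; ring.
Qed.

(** The case N = 0 is the limit of a difference quotient in t of [green_wt], taken between t = 1 and
    t = 1 + 1/(n+1). *)
Lemma green_bw N V : Ck 2 setT V ->
  rint (fun x => bw N x * euler V x) =
  (2 * N.+1%:R)^-1 * rint (fun x => bw N.+1 x * lap V x).
Proof.
case: N => [|N] Vk; last exact: green_wt.
have Ec : continuous (euler V) by apply: continuous_euler; exact: CkW.
have Lc : continuous (lap V) by exact: continuous_lap.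
have [C1 h1] := Cc_wt13 Ec; have [C2 h2] := Cc_wt13 Lc.
have l1 : rint (fun x => bw0_approx n x * euler V x) @[n --> \oo] --> rint (fun x => bw 0 x * euler V x).
  apply: (rint_cvg (ler0n R 4)) => [n|x].
    exact: (dominated_vbaire (@continuous_bw0_approx n) (@bw0_approx_bound n) Ec h1).
  by apply: cvgMl; exact: bw0_approx_cvg.
have l2 : rint (fun x => bw1_approx n x * lap V x) @[n --> \oo] --> rint (fun x => bw 1 x * lap V x).
  apply: (rint_cvg (ler0n R 4)) => [n|x].
    exact: (dominated_vbaire (@continuous_bw1_approx n) (@bw1_approx_bound n) Lc h2).
  by apply: cvgMl; exact: bw1_approx_cvg.
apply: (cvg_unique _ l1) => //.
rewrite mulr1.
have E n : rint (fun x => bw0_approx n x * euler V x) = 2^-1 * rint (fun x => bw1_approx n x * lap V x).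
  have t0 : 0 <= 1 + n.+1%:R^-1 :> R by rewrite addr_ge0 // ltW.
  have P1 : 1 + (1 + n.+1%:R^-1) <= 4 :> R by move: (n.+1%:R^-1) (invn_le1 n) => d d1; lra.
  have P2 : 1 + 1 <= 4 :> R by lra.
  have c1 := Cc_mono P1 (CcM (@Cc_wt R m 0 _ t0) Ec).
  have c2 := Cc_mono P2 (CcM (@Cc_wt R m 0 1 ler01) Ec).
  have c3 := Cc_mono P1 (CcM (@Cc_wt R m 1 _ t0) Lc).
  have c4 := Cc_mono P2 (CcM (@Cc_wt R m 1 1 ler01) Lc).
  have -> : (fun x => bw0_approx n x * euler V x) = (fun x => n.+1%:R *
     (wt 1 (1 + n.+1%:R^-1) x * euler V x + -1 * (wt 1 1 x * euler V x))).
    by apply/funext => x; rewrite /bw0_approx; ring.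
  have -> : (fun x => bw1_approx n x * lap V x) = (fun x => (n.+1%:R / 2) *
     (wt 2 (1 + n.+1%:R^-1) x * lap V x + -1 * (wt 2 1 x * lap V x))).
    by apply/funext => x; rewrite /bw1_approx; ring.
  rewrite (rintZ_Cc _ (ler0n R 4) (CcD c1 (CcZ (-1) c2))) (rintZ_Cc _ (ler0n R 4) (CcD c3 (CcZ (-1) c4))).
  rewrite (rintD_Cc (ler0n R 4) c1 (CcZ (-1) c2)) (rintD_Cc (ler0n R 4) c3 (CcZ (-1) c4)).
  rewrite (rintZ_Cc _ (ler0n R 4) c2) (rintZ_Cc _ (ler0n R 4) c4) !green_wt //.
  by field.
have l2' : 2^-1 * rint (fun x => bw1_approx n x * lap V x) @[n --> \oo] --> 2^-1 * rint (fun x => bw 1 x * lap V x).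
  exact: cvgMr.
by apply: cvg_trans l2'; apply: near_eq_cvg; apply: nearW => n /=; rewrite E.
Qed.

End BallWeights.

(** * Pizzetti's formula for weighted ball means *)

Section MeanValues.
Variables (R : realType) (m : nat).
Implicit Types (f g u U V : 'rV[R]_m -> R) (x y v : 'rV[R]_m) (O : set 'rV[R]_m).
Notation pd i f := ('D_('e_i) f).

(** The integral runs over the fixed unit ball, so that r = 0 is allowed and only [U] depends on r;
    it is not divided by the mass of the weight. *)
Definition bmean (N : nat) x (r : R) U : R := rint (fun y => bw N y * U (x + r *: y)).

Lemma eq_bmean N x r U V :
  (forall y, nsq y <= 1 -> U (x + r *: y) = V (x + r *: y)) -> bmean N x r U = bmean N x r V.
Proof.
move=> UV; congr rint; apply/funext => y.
exact: (@bwM_eq R m N (fun y => U (x + r *: y)) (fun y => V (x + r *: y)) y (UV y)).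
Qed.

Lemma continuous_scale_shift x (r : R) U : continuous U -> continuous (fun y => U (x + r *: y)).
Proof. by move=> Uc y; have := continuous_comp (@continuous_affine R m x r y) (Uc _). Qed.

Lemma CkT_affine q U x (r : R) : Ck q setT U -> Ck q setT (fun y => U (x + r *: y)).
Proof.
move=> Uk; have h := @Ck_affine R m q setT U x r (@openT _) Uk.
by apply: (Ck_sub (O := [set y | setT (x + r *: y)])).
Qed.

Lemma coord_le1 y i : nsq y <= 1 -> `|y 0 i| <= 1.
Proof. by move=> y1; apply: nsq_le_coord; rewrite ?expr1n. Qed.

Lemma derive_bmean q P N x r V : Ck q.+1 setT V -> Cc P V ->
  is_derive r (1 : R) (fun r => bmean N x r V)
    (rint (fun y => bw N y * \sum_(i < m) y 0 i * pd i V (x + r *: y))).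
Proof.
move=> Vk Vc; have [C C0 hC] := Cc_bounded Vc.
have /choice[D hD] : forall i : 'I_m, exists D : R, forall x, `|pd i V x| <= D.
  move=> i; by have [D _ h] := Cc_bounded (Cc_pd i Vk Vc); exists D.
have V_ t : vbaire 4 C (fun y => bw N y * V (x + t *: y)).
  have [C' h] := vbaire_bw N (@continuous_scale_shift x t V (CkT_cont Vk)).
  apply: (vbaire_sharp C0 h) => y; rewrite normrM -[leRHS]mul1r ler_pM //.
  by have /andP[a b] := bw_le1 N y; rewrite ger0_norm.
have dV t y : is_derive t (1 : R) (fun t => bw N y * V (x + t *: y))
   (bw N y * \sum_(i < m) y 0 i * pd i V (x + t *: y)).
  have h : is_derive t (1 : R) (fun t : R => V (x + t *: y)) (\sum_(i < m) y 0 i * pd i V (x + t *: y)).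
    by apply/is_derive_line; exact: Ck_derive Vk _.
  have := is_deriveM (is_derive_cst (bw N y) t (1 : R)) h.
  by rewrite scaler0 addr0.
have bD t y : `|bw N y * \sum_(i < m) y 0 i * pd i V (x + t *: y)| <= \sum_i D i.
  have D0 i : 0 <= D i by rewrite (le_trans _ (hD i 0)).
  have [y1|y1] := leP (nsq y) 1; last first.
    by rewrite bw_gt1 // mul0r normr0 sumr_ge0.
  rewrite normrM -[leRHS]mul1r ler_pM //.
    by have /andP[a b] := bw_le1 N y; rewrite ger0_norm.
  rewrite (le_trans (ler_norm_sum _ _ _)) // ler_sum // => i _.
  by rewrite normrM -[leRHS]mul1r ler_pM // coord_le1.
by have [_] := @is_derive_rint R m 4 C (\sum_i D i) r 1 (fun t y => bw N y * V (x + t *: y))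
  (fun t y => bw N y * \sum_(i < m) y 0 i * pd i V (x + t *: y)) (ler0n R 4) ltr01
  (fun t _ => V_ t) (fun t y _ => dV t y) (fun t y _ => bD t y).
Qed.

(** The derivative is 1/r times the integral of the Euler operator on y |-> V(x + r y); Green's
    formula replaces it by the Laplacian of that function, which brings a factor r^2, and raises the
    weight. *)
Lemma derive_bmean_lap P N x r V : r != 0 -> Ck 2 setT V -> Cc P V ->
  is_derive r (1 : R) (fun r => bmean N x r V) (r / (2 * N.+1%:R) * bmean N.+1 x r (lap V)).
Proof.
move=> r0 Vk Vc; have h := derive_bmean N x r Vk Vc.
apply: is_derive_eq h _.
have Wk := CkT_affine x r Vk.
have gW := green_bw N Wk.
have E y : euler (fun y => V (x + r *: y)) y = r * \sum_(i < m) y 0 i * pd i V (x + r *: y).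
  rewrite /euler mulr_sumr; apply: eq_bigr => i _.
  by rewrite (pd_affine (q := 0) (O := setT) i (CkW Vk)) // mulrCA.
have L y : lap (fun y => V (x + r *: y)) y = r ^+ 2 * lap V (x + r *: y).
  rewrite /lap mulr_sumr; apply: eq_bigr => i _.
  have -> : pd i (fun y => V (x + r *: y)) = (fun y => r * pd i V (x + r *: y)).
    by apply/funext => z; rewrite (pd_affine (q := 0) (O := setT) i (CkW Vk)).
  have -> := @pdZ R m 0 setT r (fun y => pd i V (x + r *: y)) i y (@openT _) (CkT_affine x r (Ck_pd i Vk)) I.
  by rewrite (pd_affine (q := 0) (O := setT) i (Ck_pd i Vk)) // mulrA.
have c1 : continuous (fun y => \sum_(i < m) y 0 i * pd i V (x + r *: y)).
  apply: continuous_sum => i; apply: continuousMf; first by move=> ?; exact: coord_continuous.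
  exact: (@continuous_scale_shift x r (pd i V) (CkT_cont (Ck_pd i Vk))).
have c2 : continuous (fun y => lap V (x + r *: y)).
  exact: (@continuous_scale_shift x r (lap V) (continuous_lap Vk)).
have [C1 b1] := vbaire_bw N c1; have [C2 b2] := vbaire_bw N.+1 c2.
move: gW.
have -> : (fun y => bw N y * euler (fun y => V (x + r *: y)) y) =
  (fun y => r * (bw N y * \sum_(i < m) y 0 i * pd i V (x + r *: y))).
  by apply/funext => y; rewrite E mulrCA.
have -> : (fun y => bw N.+1 y * lap (fun y => V (x + r *: y)) y) =
  (fun y => r ^+ 2 * (bw N.+1 y * lap V (x + r *: y))).
  by apply/funext => y; rewrite L mulrCA.
rewrite (rintZ r (ler0n R 4) b1) (rintZ (r ^+ 2) (ler0n R 4) b2) => gW.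
apply: (mulfI r0); rewrite gW /bmean.
have N0 : N.+1%:R != 0 :> R by rewrite pnatr_eq0.
by field.
Qed.

(** The equation lap^p U = 0, where each Laplacian in the chain is only asked to be C^2; higher
    regularity is the content of [polyh_Ck]. *)
Fixpoint polyh (p : nat) O U : Prop :=
  if p is p'.+1 then Ck 2 O U /\ polyh p' O (lap U) else forall x, O x -> U x = 0.

Definition bmass (N : nat) : R := rint (fun y : 'rV[R]_m => bw N y).

(* The coefficients of Pizzetti's formula [bmean_polyh]. *)
Fixpoint pizz (N l : nat) : R :=
  if l is l'.+1 then pizz N.+1 l' / (4 * N.+1%:R * l'.+1%:R) else bmass N.

Lemma lap_ext O U V x : open O -> (forall y, O y -> U y = V y) -> O x -> lap U x = lap V x.
Proof.
move=> oO UV Ox; apply: eq_bigr => i _; apply: (pd_ext i oO) => // y Oy.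
exact: (pd_ext i oO).
Qed.

Lemma bmass_cst N (c : R) : rint (fun y : 'rV[R]_m => bw N y * c) = bmass N * c.
Proof.
have [C h] := vbaire_bw (m := m) N (@cst_continuous _ R (1 : R)).
have -> : (fun y : 'rV[R]_m => bw N y * c) = (fun y => c * (bw N y * 1)).
  by apply/funext => y; rewrite mulr1 mulrC.
rewrite (rintZ c (ler0n R 4) h) mulrC; congr (_ * _); congr rint.
by apply/funext => y; rewrite mulr1.
Qed.

Lemma is_derive_sumf (n : nat) (F : 'I_n -> R -> R) (dF : 'I_n -> R) (s : R) :
  (forall i, is_derive s (1 : R) (F i) (dF i)) ->
  is_derive s (1 : R) (fun s => \sum_(i < n) F i s) (\sum_(i < n) dF i).
Proof.
move=> Fd; have := is_derive_sum Fd.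
by rewrite (_ : \sum_(i < n) F i = fun s => \sum_(i < n) F i s) //; apply/funext => z; rewrite fct_sumE.
Qed.

Lemma is_derive_monom (n : nat) (a c s : R) :
  is_derive s (1 : R) (fun s => a * s ^+ n * c) (a * (n%:R * s ^+ n.-1) * c).
Proof.
have h : is_derive s (1 : R) (fun x : R => x ^+ n) (n%:R * s ^+ n.-1).
  by split; [exact: exprn_derivable|rewrite exp_derive; exact: mulr1].
have := is_deriveM (is_derive_cst (a * c) s (1 : R)) h.
rewrite scaler0 addr0 => h'.
have -> : (fun s => a * s ^+ n * c) = (cst (a * c) * (fun x : R => x ^+ n)) by apply/funext => z; rewrite mulrAC.
by have -> : a * (n%:R * s ^+ n.-1) * c = a * c * (n%:R * s ^+ n.-1) by rewrite mulrAC.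
Qed.

(** The denominators of [pizz] are those for which the polynomial obeys the same differential
    relation as the means in [derive_bmean_lap]. *)
Lemma derive_pizz N p U x (s : R) :
  is_derive s (1 : R) (fun s => \sum_(l < p.+1) pizz N l * s ^+ l.*2 * iter l (@lap R m) U x)
    (s / (2 * N.+1%:R) * \sum_(l < p) pizz N.+1 l * s ^+ l.*2 * iter l (@lap R m) (lap U) x).
Proof.
have := is_derive_sumf (fun l : 'I_p.+1 => is_derive_monom (l : nat).*2 (pizz N l) (iter l (@lap R m) U x) s).
rewrite big_ord_recl /= mul0r mulr0 mul0r add0r.
rewrite mulr_sumr; under eq_bigr => l _.
  have -> : pizz N.+1 l / (4 * N.+1%:R * l.+1%:R) * ((l.+1).*2%:R * s ^+ (l.+1).*2.-1) * iter l.+1 (@lap R m) U x =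
    s / (2 * N.+1%:R) * (pizz N.+1 l * s ^+ l.*2 * iter l (@lap R m) (lap U) x).
    rewrite -iterSr doubleS /= exprS -doubleS -muln2 natrM.
    have a0 : N.+1%:R != 0 :> R by rewrite pnatr_eq0.
    have b0 : l.+1%:R != 0 :> R by rewrite pnatr_eq0.
    by move: (N.+1%:R : R) (l.+1%:R : R) a0 b0 => a b a0 b0; field; rewrite a0 b0.
  over.
by [].
Qed.

(** The part of the complement of [O] with squared distance at most t + 1 is compact. If it is
    nonempty, the squared distance to x has a minimum there, which exceeds t, and b is taken
    halfway. *)
Lemma ball_enlarge O x (t : R) : open O -> 0 <= t ->
  (forall y, nsq (- x + 1 *: y) <= t -> O y) ->
  exists b, t < b /\ forall y, nsq (- x + 1 *: y) <= b -> O y.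
Proof.
move=> oO t0 tO; pose f y := nsq (- x + 1 *: y).
have fc : continuous f.
  by move=> z; apply: (continuous_comp (@continuous_affine R m (-x) 1 z)); exact: continuous_nsq.
pose K := [set y | f y <= t + 1] `&` ~` O.
have cK : compact K.
  apply: bounded_closed_compact.
    exists (1 + (t + 1) + `|x|); split; first exact: num_real.
    move=> M PM y [Ky _] /=; rewrite -(subrK x y) (le_trans (ler_normD _ _)) //.
    rewrite (le_trans _ (ltW PM)) // lerD2r [X in X <= _]mx_normrE.
    apply/bigmax_leP; split=> [|[i j] _ /=]; first by rewrite !addr_ge0.
    rewrite (ord1 i) addrC -[y]scale1r; apply: nsq_le_coord; first by rewrite !addr_ge0.
    by rewrite (le_trans Ky) //; nra.
  apply: closedI; last exact: open_closedC.
  by apply: (closed_comp (f := f) (D := [set s | s <= t + 1])); [move=> ? _; exact: fc|exact: closed_le].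
have [K0|/set0P K0] := eqVneq K set0.
  exists (t + 1); split; first by rewrite ltrDl.
  move=> y yt; apply: contrapT => nO; suff : K y by rewrite K0.
  by split.
have [c cK' cmin] := EVT_min_rV K0 cK (continuous_subspaceT fc).
move: cK'; rewrite inE => -[c1 c2].
have tc : t < f c by rewrite ltNge; apply/negP => h; apply: c2; exact: tO.
exists ((t + f c) / 2); split; first by lra.
move=> y yb; apply: contrapT => nO.
have yK : K y by split=> //=; rewrite (le_trans yb) //; move: c1 => /=; lra.
have : f c <= f y by apply: cmin; rewrite inE.
by rewrite leNgt => /negP; apply; rewrite (le_lt_trans yb) //; lra.
Qed.

(** Induction on p with N free. Both sides agree at r = 0, and their derivatives agree by the case
    of [lap U] with weight N + 1; the mean value theorem concludes. The derivative of the mean is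
    taken on a cutoff [V] of [U]. *)
Lemma bmean_polyh p N O U x (r0 : R) : open O -> polyh p O U ->
  (forall y, nsq (- x + 1 *: y) <= r0 ^+ 2 -> O y) ->
  forall r, 0 <= r <= r0 ->
  bmean N x r U = \sum_(l < p) pizz N l * r ^+ l.*2 * iter l (@lap R m) U x.
Proof.
move=> oO; elim: p N U => [|p IH] N U Uk xO r /andP[rr0 rr].
  rewrite big_ord0 (@eq_bmean N x r U (fun=> 0)); last first.
    move=> y y1; apply: Uk; apply: xO.
    rewrite scale1r addKr nsqZ -[leRHS]mulr1 ler_pM ?nsq_ge0 ?sqr_ge0 //.
    by rewrite ler_sqr ?nnegrE // (le_trans rr0).
  by rewrite /bmean bmass_cst mulr0.
have r00 : 0 <= r0 by exact: le_trans rr.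
have [b [b1 bO]] : exists b, r0 ^+ 2 < b /\ forall y, nsq (- x + 1 *: y) <= b -> O y.
  exact: ball_enlarge (sqr_ge0 r0) xO.
pose a := (r0 ^+ 2 + b) / 2.
have ab : a < b by rewrite /a; lra.
have ra : r0 ^+ 2 < a by rewrite /a; lra.
have b0 : 0 <= b by rewrite ltW // (le_lt_trans (sqr_ge0 r0)).
have [Uk2 Lk] := Uk.
have [P [V [P0 Vk Vc VU]]] := cutoff_extension oO b0 ab bO Uk2.
pose D := [set y | nsq (- x + 1 *: y) < a].
have oD : open D.
  apply: (open_comp (f := fun y => nsq (- x + 1 *: y)) (D := [set t | t < a])); last exact: open_lt.
  move=> z _; apply: (continuous_comp (@continuous_affine R m (-x) 1 z)); exact: continuous_nsq.
have DU y : D y -> V y = U y by move=> /ltW; exact: VU.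
have Dx y s : 0 <= s <= r0 -> nsq y <= 1 -> D (x + s *: y).
  move=> /andP[s0 sr] y1; rewrite /D /= scale1r addKr nsqZ (le_lt_trans _ ra) // -[leRHS]mulr1.
  by rewrite ler_pM ?nsq_ge0 ?sqr_ge0 // ler_sqr ?nnegrE.
pose poly (s : R) := \sum_(l < p.+1) pizz N l * s ^+ l.*2 * iter l (@lap R m) U x.
pose diff s := bmean N x s V - poly s.
have dpoly s : is_derive s (1 : R) poly (s / (2 * N.+1%:R) * \sum_(l < p) pizz N.+1 l * s ^+ l.*2 * iter l (@lap R m) (lap U) x).
  exact: derive_pizz.
have ddiff s : 0 < s < r0 -> is_derive s (1 : R) diff 0.
  move=> /andP[s0 sr].
  have := is_deriveB (derive_bmean_lap N x (lt0r_neq0 s0) Vk Vc) (dpoly s).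
  rewrite (@eq_bmean N.+1 x s (lap V) (lap U)); last first.
    by move=> y y1; apply: (lap_ext oD DU); apply: Dx => //; rewrite !ltW.
  rewrite (IH N.+1 (lap U)) //; last by rewrite !ltW.
  by rewrite subrr.
have cdiff : continuous diff.
  move=> s; apply: cvgB; first exact: is_derive_continuous (derive_bmean N x s Vk Vc).
  exact: is_derive_continuous (dpoly s).
have diff0 : diff 0 = 0.
  rewrite /diff /bmean; under [X in rint X]eq_fun do rewrite scale0r addr0.
  rewrite bmass_cst VU; last by rewrite scale1r addNr nsq0 ltW // (le_lt_trans _ ra) // sqr_ge0.
  rewrite /poly big_ord_recl /= expr0 mulr1 big1 ?addr0 ?subrr // => i _.
  by rewrite /= doubleS expr0n mulr0 mul0r.
have [|c _] := @MVT_segment R diff (fun=> 0) 0 r rr0 _ (continuous_subspaceT cdiff).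
  move=> t; rewrite in_itv /= => /andP[t0 tr]; apply: ddiff; rewrite t0 /=.
  exact: lt_le_trans tr rr.
rewrite mul0r diff0 subr0 /diff => /eqP; rewrite subr_eq0 => /eqP E; rewrite -[RHS]/(poly r) -E.
apply: eq_bmean => y y1; apply/esym/VU/ltW.
by apply: Dx => //; rewrite rr0.
Qed.

End MeanValues.

(** * Wallis integrals *)

Section Wallis.
Variable R : realType.
Local Notation mu := (@lebesgue_measure R).

Lemma FTC_Rintegral (f F : R -> R) (a b : R) : a < b -> continuous f -> continuous F ->
  (forall x, a < x < b -> is_derive x (1 : R) F (f x)) ->
  Rintegral mu `[a, b] f = F b - F a.
Proof.
move=> ab fc Fc Fd.
rewrite /Rintegral (@continuous_FTC2 _ f F) //.
- exact: continuous_subspaceT.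
- split=> [x||]; rewrite ?in_itv /=.
  + by move=> /Fd [].
  + by apply: cvg_at_right_filter; exact: Fc.
  + by apply: cvg_at_left_filter; exact: Fc.
- by move=> x; rewrite in_itv /= => /Fd [_ <-]; rewrite derive1E.
Qed.

Definition semicircle (t : R) : R := Num.sqrt (1 - t ^+ 2).

Lemma continuous_semicircle : continuous semicircle.
Proof.
move=> t; apply: (continuous_comp (f := fun t : R => 1 - t ^+ 2)); last exact: sqrt_continuous.
apply: continuousB; first exact: cst_continuous.
exact: exprn_continuous.
Qed.

Lemma continuous_semicircleX k : continuous (fun t => semicircle t ^+ k).
Proof.
move=> t; apply: (continuous_comp (g := fun s : R => s ^+ k)); first exact: continuous_semicircle.
exact: exprn_continuous.
Qed.

Definition wallis k : R := Rintegral mu `[-1, 1] (fun t => semicircle t ^+ k).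

Lemma wallis0 : wallis 0 = 2.
Proof.
rewrite /wallis (@FTC_Rintegral _ id).
- by rewrite opprK.
- by apply: gtrN; exact: ltr01.
- exact: continuous_semicircleX.
- by move=> x; exact: cvg_id.
Qed.

Lemma is_derive_semicircle (t : R) : -1 < t < 1 ->
  is_derive t (1 : R) semicircle (- t / semicircle t).
Proof.
move=> /andP[t1 t2]; have q0 : 0 < 1 - t ^+ 2 by nra.
have dq : is_derive t (1 : R) (fun t : R => 1 - t ^+ 2) (- (2 * t)).
  have h : is_derive t (1 : R) (fun x : R => x ^+ 2) (2%:R * t).
    by split; [exact: exprn_derivable|rewrite exp_derive expr1; exact: mulr1].
  by have := is_deriveB (is_derive_cst (1 : R) t (1 : R)) h; rewrite sub0r.
have ds := is_derive1_sqrt q0.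
have := @is_derive1_comp _ Num.sqrt (fun t : R => 1 - t ^+ 2) t _ _ ds dq.
rewrite (_ : _ * - (2 * t) = - t / semicircle t) // /semicircle.
have s0 : Num.sqrt (1 - t ^+ 2) != 0 by rewrite gt_eqF // sqrtr_gt0.
by field.
Qed.

(** With w = [semicircle], the derivative of t w^(k+2) is (k+3) w^(k+2) - (k+2) w^k, and t w^(k+2)
    vanishes at both endpoints. *)
Lemma wallis_rec k : k.+3%:R * wallis k.+2 = k.+2%:R * wallis k.
Proof.
pose F t := t * semicircle t ^+ k.+2.
have F1 : F 1 - F (-1) = 0 by rewrite /F /semicircle expr1n sqrrN expr1n subrr sqrtr0 expr0n /= !mulr0 subr0.
have mI : measurable (`[-1, 1] : set R) by exact: measurable_itv.
have I j c : mu.-integrable `[-1, 1] (EFin \o (fun t => c * semicircle t ^+ j)).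
  apply: continuous_compact_integrable; first exact: segment_compact.
  apply: continuous_subspaceT => t; apply: (cvgM (@cst_continuous _ _ c t)).
  exact: continuous_semicircleX.
have I' j : mu.-integrable `[-1, 1] (EFin \o (fun t => semicircle t ^+ j)).
  apply: continuous_compact_integrable; first exact: segment_compact.
  exact/continuous_subspaceT/continuous_semicircleX.
apply/eqP; rewrite -subr_eq0 -RintegralZl // -RintegralZl // -RintegralB //; apply/eqP.
rewrite -F1; apply: FTC_Rintegral.
- by apply: gtrN; exact: ltr01.
- move=> t; apply: cvgB.
    apply: (cvgM (@cst_continuous _ _ _ t)); exact: continuous_semicircleX.
  apply: (cvgM (@cst_continuous _ _ _ t)); exact: continuous_semicircleX.
- by move=> t; apply: (cvgM (@cvg_id _ _)); exact: continuous_semicircleX.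
move=> t tI.
have s0 : semicircle t != 0.
  by rewrite gt_eqF // sqrtr_gt0; move: tI => /andP[t1 t2]; nra.
have s2 : t ^+ 2 = 1 - semicircle t ^+ 2.
  by rewrite sqr_sqrtr; [ring|move: tI => /andP[t1 t2]; nra].
have dq := is_derive_semicircle tI.
have dX : is_derive (semicircle t) (1 : R) (fun x : R => x ^+ k.+2) (k.+2%:R * semicircle t ^+ k.+1).
  by split; [exact: exprn_derivable|rewrite exp_derive; exact: mulr1].
have dc := @is_derive1_comp _ (fun x : R => x ^+ k.+2) semicircle t _ _ dX dq.
have := is_deriveM (is_derive_id t (1 : R)) dc.
rewrite (_ : id t *: _ + _ *: 1 = k.+3%:R * semicircle t ^+ k.+2 - k.+2%:R * semicircle t ^+ k) //.
rewrite [_ *: 1]mulr1 /= /GRing.scale /=.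
transitivity (- k.+2%:R * t ^+ 2 * semicircle t ^+ k + semicircle t ^+ k.+2).
  by rewrite !exprS; field.
by rewrite s2 !exprS -[k.+3%:R]natr1; ring.
Qed.

Lemma wallis1 : wallis 1 = pi / 2.
Proof.
have pi0 := pi_gt0 R.
(* The substitution t = sin(theta) turns the area of the half disc into the integral of cos^2. *)
have sub := @integration_by_substitution_increasing R (@sin R) semicircle (- (pi / 2)) (pi / 2).
have sin1 : sin (pi / 2) = 1 :> R := sin_pihalf R.
have sin2 : sin (- (pi / 2)) = -1 :> R by rewrite sinN sin1.
have dsin : (@sin R)^`()%classic = @cos R.
  by apply/funext => x; rewrite derive1E; have [_ ->] := is_derive_sin x.
rewrite sin1 sin2 dsin in sub.
have -> : wallis 1 = Rintegral mu `[(- (pi / 2)), (pi / 2)] (fun t => cos t ^+ 2).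
  rewrite /wallis /Rintegral; congr fine.
  under eq_integral do rewrite expr1.
  rewrite sub.
  - apply: eq_integral => t; rewrite inE /= in_itv /= => tI; congr EFin.
    rewrite /GRing.mul /= /semicircle -cos2sin2 sqrtr_sqr ger0_norm ?expr2 //.
    exact: cos_ge0_pihalf.
  - by lra.
  - by move=> x y xI yI; rewrite ltr_sin.
  - by move=> x _; exact: continuous_cos.
  - by apply/cvg_ex; eexists; apply: cvg_at_right_filter; exact: continuous_cos.
  - by apply/cvg_ex; eexists; apply: cvg_at_left_filter; exact: continuous_cos.
  - split=> [x _||]; first exact: derivable_sin.
      by apply: cvg_at_right_filter; exact: continuous_sin.
    by apply: cvg_at_left_filter; exact: continuous_sin.
  - exact/continuous_subspaceT/continuous_semicircle.
have D (t : R) : is_derive t (1 : R) (fun t : R => (t + sin t * cos t) / 2) (cos t ^+ 2).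
  have h := is_deriveD (is_derive_id t (1 : R)) (is_deriveM (is_derive_sin t) (is_derive_cos t)).
  have := is_deriveM h (is_derive_cst (2^-1 : R) t (1 : R)).
  have -> : (id + @sin R * @cos R) t *: 0 + cst (2^-1 : R) t *: (1 + (sin t *: - sin t + cos t *: cos t)) = cos t ^+ 2.
    rewrite scaler0 add0r /GRing.scale /=.
    have -> : sin t * - sin t = cos t ^+ 2 - 1 by rewrite -(cos2Dsin2 t); ring.
    by field.
  by [].
rewrite (@FTC_Rintegral (fun t => cos t ^+ 2) _ _ _ _ _ _ (fun x _ => D x)).
- by rewrite cosN cos_pihalf !mulr0 !addr0; field.
- by lra.
- move=> t; apply: (continuous_comp (g := fun s : R => s ^+ 2)); first exact: continuous_cos.
  exact: exprn_continuous.
- by move=> t; exact: is_derive_continuous (D t).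
Qed.

(** By [wallis_rec] the left-hand side does not depend on k, so k = 0 suffices. This is how pi
    enters the ball volumes, two dimensions at a time. *)
Lemma wallis_mul k : k.+2%:R * (wallis k.+1 * wallis k) = 2 * pi.
Proof.
elim: k => [|k IH].
  by rewrite wallis0 wallis1; field.
by rewrite -IH [wallis k.+2 * _]mulrC mulrCA wallis_rec; ring.
Qed.

End Wallis.

(** * Masses of the ball weights *)

Section BallMass.
Variable R : realType.
Local Notation mu := (@lebesgue_measure R).

(** Green's formula for |x|^2: its Euler derivative is 2 |x|^2, its Laplacian is 2 m, and |x|^2
    [bw N] is [bw N] minus [bw N.+1]. *)
Lemma bmass_rec m N : 2 * N.+1%:R * bmass R m N = (m%:R + 2 * N.+1%:R) * bmass R m N.+1.
Proof.
have k2 : Ck 2 setT (@nsq R m) by apply: Ck_nsq; exact: openT.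
have pE (i : 'I_m) : 'D_('e_i) (@nsq R m) = (fun x => 2 * x 0 i) by apply/funext => x; exact: pd_nsq.
have Ee x : euler (@nsq R m) x = 2 * nsq x.
  rewrite /euler [X in 2 * X]/nsq mulr_sumr; apply: eq_bigr => i _.
  by rewrite pd_nsq expr2 mulrCA.
have Le x : lap (@nsq R m) x = 2 * m%:R.
  rewrite /lap (eq_bigr (fun=> 2)) => [|i _].
    by rewrite sumr_const card_ord mulr_natr.
  rewrite pE (pdZ (q := 0) (O := setT) 2 i (@openT _)) //; last by apply: Ck_coord; exact: openT.
  by rewrite pd_coord eqxx mulr1.
have W x : bw N x * (2 * nsq x) = 2 * (bw N x * 1) - 2 * (bw N.+1 x * 1).
  have -> : bw N.+1 x = (1 - nsq x) * bw N x.
    case: N => [|N] /=.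
      rewrite wt1E; case: leP => x1; rewrite ?mulr1 ?mulr0.
        by rewrite max_r // subr_ge0.
      by rewrite max_l // subr_le0 ltW.
    rewrite /wt /posp [in LHS]exprS.
    by case: (leP 0 (1 - nsq x)) => //; rewrite mul0r expr0n mulr0.
  by ring.
have := green_bw N k2.
under [X in rint X]eq_fun do rewrite Ee W.
under [X in _ = _ * rint X]eq_fun do rewrite Le.
have [C1 b1] := vbaire_bw N (@cst_continuous 'rV[R]_m R (1 : R)).
have [C2 b2] := vbaire_bw N.+1 (@cst_continuous 'rV[R]_m R (1 : R)).
rewrite (rintB (ler0n R 4) (vbaireZ 2 b1) (vbaireZ 2 b2)).
rewrite (rintZ 2 (ler0n R 4) b1) (rintZ 2 (ler0n R 4) b2) !bmass_cst !mulr1.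
have N0 : N.+1%:R != 0 :> R by rewrite pnatr_eq0.
move=> E; have {}E : 2 * N.+1%:R * (2 * bmass R m N - 2 * bmass R m N.+1) = 2 * m%:R * bmass R m N.+1.
  by rewrite E; field.
by apply: (mulfI (_ : 2 != 0 :> R)); rewrite ?pnatr_eq0 //; move: E => E; nra.
Qed.

(** The slice at first coordinate t is a ball of radius w = [semicircle t]; rescaling it to radius 1
    gives w^m from the volume and w^2 from the weight. *)
Lemma bmass1_wallis m : bmass R m.+1 1 = wallis R m.+2 * bmass R m 1.
Proof.
have [C b] := vbaire_bw (m := m) 1 (@cst_continuous 'rV[R]_m R (1 : R)).
have b1 : vbaire 4 C (@bw R m 1).
  by move: b; rewrite (_ : (fun y => _) = @bw R m 1) //; apply/funext => y; rewrite mulr1.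
have slice t : iint m (fun s => bw 1 (rowseq m.+1 (t :: s))) =
    bmass R m 1 * semicircle t ^+ m.+2.
  have nE s : nsq (rowseq m.+1 (t :: s)) = t ^+ 2 + nsq (rowseq m s) :> R.
    rewrite /nsq big_ord_recl /= !mxE /=; congr (_ + _); apply: eq_bigr => i _.
    by rewrite !mxE.
  have [t3|t3] := leP (1 - t ^+ 2) 0.
    rewrite /semicircle ler0_sqrtr // expr0n /= mulr0 -[RHS](iint0 R m).
    by apply: eq_iint => s _; rewrite /= wt0 // nE; have := nsq_ge0 (rowseq m s); lra.
  have q0 : 0 < semicircle t by rewrite sqrtr_gt0.
  have qi : 0 < (semicircle t)^-1 by rewrite invr_gt0.
  have := rint_affine 0 (ler0n R 4) qi (vbaireZ (semicircle t ^+ 2) b1).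
  rewrite (rintZ _ (ler0n R 4) b1) invrK mulrA -exprD addn2 mulrC => <-.
  apply: eq_iint => s _ /=; rewrite !wt1E maxr_pMr ?sqr_ge0 // mulr0 addr0 nsqZ nE.
  congr Num.max; rewrite mulrBr mulrA -exprMn mulfV ?gt_eqF // expr1n mul1r mulr1.
  by rewrite sqr_sqrtr ?ltW // opprD addrA.
have supp (t : R) : 1 < `|t| -> semicircle t ^+ m.+2 = 0.
  move=> t1; rewrite /semicircle ler0_sqrtr ?expr0n // subr_le0.
  by rewrite -real_normK ?num_real // exprn_ege1 // ltW.
have fb : bsupp 1 1 (fun t : R => semicircle t ^+ m.+2).
  split=> // [|t].
    apply: continuous_measurable_fun; exact: continuous_semicircleX.
  have s0 : 0 <= semicircle t by exact: sqrtr_ge0.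
  rewrite ger0_norm ?exprn_ge0 // exprn_ile1 //.
  by rewrite -[leRHS]sqrtr1 ler_wsqrtr // gerBl sqr_ge0.
rewrite {1}/bmass rintE iintS /=.
under eq_fun do rewrite slice.
rewrite RintegralZl //; last exact: bsupp_integrable fb.
rewrite mulrC; congr (_ * _); rewrite /wallis [RHS]Rintegral_mkcond; apply: eq_Rintegral => t _.
rewrite patchE; case: ifPn => // tI; apply: supp.
rewrite ltNge; apply/negP => t1; move: tI; rewrite notin_setE; apply.
by rewrite /= in_itv /= -ler_norml.
Qed.

End BallMass.

Section BallMassValues.
Variable R : realType.

(** Positivity at N = 1 follows from the product formula in the dimension, and [bmass_rec], read in
    both directions, carries it to every N. It permits solving Pizzetti's formula for the value at
    the centre. *)
Lemma bmass_gt0 m N : 0 < bmass R m N.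
Proof.
have H1 k : 0 < bmass R k 1 /\ 0 < wallis R k.
  elim: k => [|k [b0 w0]].
    split; last by rewrite wallis0.
    rewrite /bmass rintE /= /wt /posp /nsq big_ord0 subr0 expr1.
    by rewrite max_r.
  have w1 : 0 < wallis R k.+1.
    have := wallis_mul R k => E.
    have : 0 < k.+2%:R * (wallis R k.+1 * wallis R k) by rewrite E mulr_gt0 ?pi_gt0.
    by rewrite pmulr_rgt0 ?ltr0n // pmulr_lgt0.
  split=> //; rewrite bmass1_wallis mulr_gt0 //.
  have : 0 < k.+3%:R * wallis R k.+2 by rewrite wallis_rec mulr_gt0 ?ltr0n.
  by rewrite pmulr_rgt0 ?ltr0n.
have step N' : 0 < bmass R m N' <-> 0 < bmass R m N'.+1.
  have a0 : 0 < 2 * N'.+1%:R :> R by rewrite mulr_gt0 ?ltr0n.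
  have b0 : 0 < m%:R + 2 * N'.+1%:R :> R by rewrite ltr_wpDl.
  by rewrite -(pmulr_rgt0 _ a0) bmass_rec pmulr_rgt0.
have b0 : 0 < bmass R m 0 by apply: (step 0%N).2; have [] := H1 m.
by elim: N => // N IH; exact: (step N).1 IH.
Qed.

End BallMassValues.

(** * Smoothness of polyharmonic functions *)

Section Regularity.
Variables (R : realType) (m : nat).
Implicit Types (f g u U V : 'rV[R]_m -> R) (x y v : 'rV[R]_m) (O : set 'rV[R]_m).
Notation pd i f := ('D_('e_i) f).

(* Convolution at scale r; all derivatives fall on psi. *)
Lemma Ck_convolution q P Q r psi V : r != 0 -> 0 <= P -> Ck q setT psi -> Cc P psi ->
  Cc Q V -> Ck q setT (fun x => rint (fun y => psi y * V (x + r *: y))).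
Proof.
move=> r0 P0 + + Vc; have [C2 C20 h2] := Cc_bounded Vc.
have vb phi C1 w : continuous phi -> Cc P phi -> 0 <= C1 -> (forall y, `|phi y| <= C1) ->
    vbaire P (C1 * C2) (fun y => phi y * V (w + r *: y)).
  move=> pk pc C10 h1; apply: vbaire_cont => [|y|y i Py].
  - by apply: continuousMf => //; apply: continuous_scale_shift; case: Vc.
  - by rewrite normrM ler_pM.
  - by rewrite (pc.2 y i) // mul0r.
elim: q psi => [|q IH] psi pk pc.
  split=> // x _; apply: continuous_seqP => u ux.
  have [C1 C10 h1] := Cc_bounded pc.
  apply: (rint_cvg (C := C1 * C2) P0) => [n|y]; first exact: vb (CkT_cont pk) pc C10 h1.
  apply: cvgMr; apply: (continuous_cvg _ (Vc.1 _)).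
  by apply: cvgD => //; exact: cvg_cst.
have dk i : Ck q setT (fun y => - r^-1 * pd i psi y) by apply: CkZ; [exact: openT|exact: Ck_pd].
have dc i : Cc P (fun y => - r^-1 * pd i psi y) by apply: CcZ; exact: Cc_pd pk pc.
have IHi i := IH _ (dk i) (dc i).
have I0 := IH psi (CkW pk) pc.
apply: (@Ck_build R m q setT _ (fun i x => rint (fun y => - r^-1 * pd i psi y * V (x + r *: y)))) => //.
- exact: openT.
- by move=> x _; exact: (CkT_cont I0).
move=> x v _.
(* Translating y by s v' cancels the displacement s v of x, so that s appears in the argument of
   [psi] alone. *)
pose v' := - r^-1 *: v.
have [C1 C10 h1] := Cc_bounded pc.
have /choice[D hD] : forall i : 'I_m, exists D : R, forall x, `|pd i psi x| <= D.
  by move=> i; have [D _ h] := Cc_bounded (Cc_pd i pk pc); exists D.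
have [c xE] : exists c, x = c + 0 *: v by exists x; rewrite scale0r addr0.
rewrite {1}xE; apply/is_derive_line.
have -> : (fun s : R => rint (fun y => psi y * V (c + s *: v + r *: y))) =
          (fun s : R => rint (fun y => psi (y + s *: v') * V (c + r *: y))).
  apply/funext => s.
  rewrite -(rint_shift (s *: v') P0 (vb psi C1 (c + s *: v) (CkT_cont pk) pc C10 h1)).
  congr rint; apply/funext => y; congr (_ * V _).
  by apply/rowP => i; rewrite !mxE; field.
have S t : `|t - 0| < 1 -> forall y i, P + \sum_j `|v' 0 j| < `|y 0 i| -> P < `|(y + t *: v') 0 i|.
  move=> t1 y i Py; rewrite subr0 in t1.
  rewrite -(ltrD2r (\sum_j `|v' 0 j|)) (lt_le_trans Py) // -{1}(addrK (t *: v') y).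
  rewrite !mxE (le_trans (ler_normB _ _)) // lerD2l normrM (bigD1 i) //=.
  rewrite -[leLHS]addr0 lerD ?sumr_ge0 //.
  by rewrite [X in _ <= `|X|]mxE ler_piMl // ltW.
have [|t t1|t y t1||_] := @is_derive_rint R m (P + \sum_j `|v' 0 j|) (C1 * C2) ((\sum_i `|v' 0 i| * D i) * C2) 0 1
   (fun t y => psi (y + t *: v') * V (c + r *: y))
   (fun t y => (\sum_i v' 0 i * pd i psi (y + t *: v')) * V (c + r *: y)) _ ltr01.
- by rewrite addr_ge0 ?sumr_ge0.
- apply: vbaire_cont => [|y|y i Py].
  + apply: continuousMf; last by apply: continuous_scale_shift; case: Vc.
    move=> y; apply: (continuous_comp (f := fun y => y + t *: v')).
      by apply: continuousD; [exact: cvg_id|exact: cst_continuous].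
    exact: (pc.1).
  + by rewrite normrM ler_pM.
  + by rewrite (pc.2 _ i (S t t1 y i Py)) mul0r.
- have h : is_derive t (1 : R) (fun t : R => psi (y + t *: v')) (\sum_i v' 0 i * pd i psi (y + t *: v')).
    by apply/is_derive_line; exact: Ck_derive pk _.
  apply: is_derive_eq (is_deriveM h (is_derive_cst (V (c + r *: y)) t (1 : R))) _.
  by rewrite scaler0 add0r; exact: mulrC.
- move=> t y t1; rewrite normrM ler_pM // (le_trans (ler_norm_sum _ _ _)) // ler_sum // => i _.
  by rewrite normrM ler_pM.
move=> h; apply: is_derive_eq h _.
have cx : c = x by rewrite xE scale0r addr0.
have PC i : Cc P (fun y => - r^-1 * pd i psi y * V (x + r *: y)).
  by apply: CcM; [exact: dc|apply: continuous_scale_shift; case: Vc].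
transitivity (rint (fun y => \sum_(i <- index_enum 'I_m) v 0 i * (- r^-1 * pd i psi y * V (x + r *: y)))).
  congr rint; apply/funext => y; rewrite scale0r addr0 mulr_suml cx; apply: eq_bigr => i _.
  by rewrite /v' mxE !mulrA [v 0 i * _]mulrC.
rewrite (rint_sum_Cc _ P0) => [|i]; last by apply: CcZ; exact: PC.
by apply: eq_bigr => i _; rewrite (rintZ_Cc _ P0).
Qed.

Lemma open_nsq_ball O x : open O -> O x ->
  exists b, 0 < b /\ forall y, nsq (- x + 1 *: y) <= b -> O y.
Proof.
move=> oO Ox; have /nbhs_ballP[e /= e0 He] := open_nbhs_nbhs (conj oO Ox).
exists ((e / 2) ^+ 2); split; first by rewrite exprn_gt0 // divr_gt0.
move=> y yb; apply: He; rewrite -ball_normE /= [X in X < _]mx_normrE.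
apply/bigmax_ltP; split=> // -[i j] _ /=; rewrite (ord1 i).
apply: (@le_lt_trans _ _ (e / 2)); last by rewrite ltr_pdivrMr // ltr_pMr // ltr1n.
rewrite (_ : (x - y) 0 j = - (- x + 1 *: y) 0 j) ?normrN; last by rewrite !mxE mul1r opprD opprK.
by apply: nsq_le_coord => //; rewrite divr_ge0 // ltW.
Qed.

Lemma nsqD_le x y : nsq (x + y) <= 2 * nsq x + 2 * nsq y.
Proof.
rewrite /nsq !mulr_sumr -big_split /=; apply: ler_sum => i _; rewrite mxE.
have := sqr_ge0 (x 0 i - y 0 i); nra.
Qed.

Lemma Ck_lap q O U : open O -> Ck q.+2 O U -> Ck q O (lap U).
Proof. by move=> oO Uk; apply: Ck_sum => // i _; apply: Ck_pd; exact: Ck_pd. Qed.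

(** Pizzetti's formula at a fixed radius with weight [bw q.+1] is solved for its term l = 0. The
    mean is a convolution with a C^q kernel, and the terms l > 0 involve the iterated Laplacians of
    [U], regular to all orders by induction on p. *)
Lemma polyh_Ck p O U : open O -> polyh p O U -> forall q, Ck q O U.
Proof.
move=> oO; elim: p U => [|p IH] U Uk q.
  by apply: (Ck_ext oO _ (Ck_cst q 0 oO)) => x Ox; rewrite Uk.
have [Uk2 Lk] := Uk.
have itk l : forall q, Ck q O (iter l.+1 (@lap R m) U).
  by elim: l => [|l IHl] q'; [exact: IH|rewrite iterS; apply: Ck_lap].
apply: Ck_local => x0 Ox0.
have [b [b0 bO]] := open_nsq_ball oO Ox0.
have [P [V [P0 Vk Vc VU]]] : exists P, exists V, [/\ 0 <= P, Ck 2 setT V, Cc P V &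
    forall z, nsq (- x0 + 1 *: z) <= b / 2 -> V z = U z].
  by apply: (cutoff_extension oO _ _ bO Uk2); [exact: ltW|lra].
(* If x is within squared distance b/8 of x0, and z within b/8 of x, then [nsqD_le] puts z within
   b/2 of x0, where [V] equals [U]. *)
pose r := Num.sqrt (b / 8).
have r2 : r ^+ 2 = b / 8 by rewrite sqr_sqrtr // divr_ge0 // ltW.
have r0 : 0 < r by rewrite sqrtr_gt0 divr_gt0.
pose D := [set x | nsq (- x0 + 1 *: x) < b / 8].
have oD : open D.
  apply: (open_comp (f := fun y => nsq (- x0 + 1 *: y)) (D := [set t | t < b / 8])); last exact: open_lt.
  move=> z _; apply: (continuous_comp (@continuous_affine R m (-x0) 1 z)); exact: continuous_nsq.
have DO x z : D x -> nsq (- x + 1 *: z) <= r ^+ 2 -> nsq (- x0 + 1 *: z) <= b / 2.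
  move=> Dx zr; have := nsqD_le (- x0 + 1 *: x) (- x + 1 *: z).
  rewrite (_ : - x0 + 1 *: x + (- x + 1 *: z) = - x0 + 1 *: z); last first.
    by rewrite !scale1r addrA addrK.
  by move: Dx zr; rewrite /D /= r2; lra.
exists D; split; first by rewrite /D /= scale1r addNr nsq0 divr_gt0.
have DsubO : D `<=` O by move=> x Dx; apply: bO; move: Dx; rewrite /D /=; lra.
have M0 := bmass_gt0 R m q.+1.
pose W x := (bmass R m q.+1)^-1 * (bmean q.+1 x r V +
   -1 * \sum_(l < p) (pizz R m q.+1 l.+1 * r ^+ l.+1.*2) * iter l.+1 (@lap R m) U x).
apply: (@Ck_ext _ _ q D W) => // [x Dx|].
  have xO z : nsq (- x + 1 *: z) <= r ^+ 2 -> O z.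
    by move=> zr; apply: bO; rewrite (le_trans (DO x z Dx zr)) // ler_pdivrMr //; nra.
  rewrite /W (@eq_bmean _ _ _ _ _ _ U) => [|y y1]; last first.
    apply: VU; apply: (DO x) => //; rewrite scale1r addKr nsqZ -[leRHS]mulr1.
    by rewrite ler_pM ?nsq_ge0 ?sqr_ge0.
  rewrite (bmean_polyh q.+1 oO Uk xO); last by rewrite lexx ltW.
  rewrite big_ord_recl /= mulr1 mulN1r addrK mulrA mulVf ?mul1r //.
  by rewrite gt_eqF.
apply: CkZ => //; apply: CkD => //; last first.
  apply: CkZ => //; apply: Ck_sum => // l _; apply: CkZ => //.
  exact: Ck_sub DsubO (itk l q).
apply: (Ck_sub (O := setT)) => //.
apply: (@Ck_convolution q (1 + 1) P r (@bw R m q.+1) V) => //.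
- by rewrite gt_eqF.
- exact: Ck_wt.
- exact: Cc_wt.
Qed.

End Regularity.

(** * The sphere integral as a ball integral *)

Section SphereIntegral.
Variables (R : realType) (m : nat).
Implicit Types (f g u U V : 'rV[R]_m -> R) (x y v : 'rV[R]_m) (O : set 'rV[R]_m).
Notation pd i f := ('D_('e_i) f).

Lemma enormE x : enorm x = Num.sqrt (nsq x).
Proof. by []. Qed.

Lemma enorm_le1 x : (enorm x <= 1) = (nsq x <= 1).
Proof. by rewrite enormE -{1}(sqrtr1 R) ler_sqrt. Qed.

Lemma continuous_enorm : continuous (@enorm R m).
Proof.
by move=> x; apply: (continuous_comp (@continuous_nsq R m x)); exact: sqrt_continuous.
Qed.

Definition sproj x : 'rV[R]_m := (enorm x)^-1 *: x.

Lemma sprojZ (t : R) x : 0 < t -> sproj (t *: x) = sproj x.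
Proof.
move=> t0; rewrite /sproj enormE nsqZ sqrtrM ?sqr_ge0 // sqrtr_sqr gtr0_norm //.
by rewrite scalerA invfM mulrAC mulVf ?mul1r // gt_eqF.
Qed.

Lemma nsq_sproj x : nsq x != 0 -> nsq (sproj x) = 1.
Proof.
move=> x0; rewrite /sproj nsqZ exprVn enormE sqr_sqrtr ?nsq_ge0 //.
by rewrite mulVf.
Qed.

Lemma nsq_eq0 x : nsq x = 0 -> x = 0.
Proof.
move=> x0; apply/rowP => i; rewrite mxE; apply/eqP; rewrite -sqrf_eq0.
by rewrite eq_le sqr_ge0 andbT -x0 nsq_coord.
Qed.

Lemma sproj0 : sproj 0 = 0.
Proof. by rewrite /sproj scaler0. Qed.

Lemma continuous_sproj x : nsq x != 0 -> {for x, continuous sproj}.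
Proof.
move=> x0.
have ne : enorm x != 0 by rewrite enormE gt_eqF // sqrtr_gt0 lt_neqAle eq_sym x0 nsq_ge0.
have h : (enorm y)^-1 @[y --> x] --> (enorm x)^-1 by exact: (cvgV ne (@continuous_enorm x)).
exact: (cvgZ (f := id) (s := fun y => (enorm y)^-1) h (@cvg_id _ _)).
Qed.

Lemma continuous_pM f g x : {for x, continuous f} -> {for x, continuous g} ->
  {for x, continuous (fun x => f x * g x)}.
Proof. by move=> fc gc; exact: (cvgM fc gc). Qed.

Lemma continuous_pB f g x : {for x, continuous f} -> {for x, continuous g} ->
  {for x, continuous (fun x => f x - g x)}.
Proof. by move=> fc gc; exact: (cvgB fc gc). Qed.

Lemma continuous_nsq_affine (a b : R) : continuous (fun x => a * nsq x - b).
Proof.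
move=> x; apply: continuous_pB; last exact: cst_continuous.
by apply: continuous_pM; [exact: cst_continuous|exact: continuous_nsq].
Qed.

Definition smoothstep (s : R) : R := posp 2 (1 - posp 2 s).
Definition smoothstep' (s : R) : R := - (4 * posp 1 (1 - posp 2 s) * posp 1 s).

Lemma is_derive_smoothstep (s : R) : is_derive s (1 : R) smoothstep (smoothstep' s).
Proof.
have h1 := is_derive_posp 0 s.
have h2 := is_deriveB (is_derive_cst (1 : R) s (1 : R)) h1.
have h3 := is_derive_posp 0 (1 - posp 2 s).
have := @is_derive1_comp _ (posp 2) (cst (1 : R) - posp 2) s _ _ h3 h2.
rewrite (_ : _ * _ = smoothstep' s) //.
by rewrite /smoothstep'; ring.
Qed.

Lemma smoothstep_le0 s : s <= 0 -> smoothstep s = 1.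
Proof. by move=> s0; rewrite /smoothstep [posp 2 s]posp_le // subr0 posp_gt // expr1n. Qed.

Lemma smoothstep_ge1 s : 1 <= s -> smoothstep s = 0.
Proof.
move=> s1; rewrite /smoothstep posp_le // subr_le0 posp_gt ?(le_trans ler01) //.
by rewrite exprn_ege1.
Qed.

Lemma smoothstep'_le0 s : s <= 0 -> smoothstep' s = 0.
Proof. by move=> s0; rewrite /smoothstep' (posp_le 0 s0) mulr0 oppr0. Qed.

Lemma smoothstep'_ge1 s : 1 <= s -> smoothstep' s = 0.
Proof.
move=> s1; rewrite /smoothstep' (@posp_le R 0) ?mulr0 ?mul0r ?oppr0 //.
by rewrite subr_le0 posp_gt ?(le_trans ler01) // exprn_ege1.
Qed.

Lemma smoothstep_bound s : 0 <= smoothstep s <= 1.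
Proof. by rewrite posp_ge0 posp_le1 // gerBl posp_ge0. Qed.

Lemma smoothstep'_bound s : `|smoothstep' s| <= 4.
Proof.
have [s1|s1] := leP 1 s; first by rewrite smoothstep'_ge1 ?normr0.
rewrite /smoothstep' normrN ger0_norm ?mulr_ge0 ?posp_ge0 // -[leRHS]mulr1.
apply: ler_pM; rewrite ?mulr_ge0 ?posp_ge0 //; last by rewrite posp_le1 // ltW.
by rewrite -[leRHS]mulr1 ler_wpM2l // posp_le1 // gerBl posp_ge0.
Qed.

(* A C^1 cutoff of the unit ball from outside, which also kills a
   neighbourhood of the origin. *)
Definition shell (n : nat) x : R :=
  (1 - smoothstep (n.+1%:R * nsq x - 1)) * smoothstep (n.+1%:R * (nsq x - 1)).

(* The radial derivative [euler (shell n)]. *)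
Definition shell' (n : nat) x : R := 2 * (n.+1%:R * nsq x) *
  ((1 - smoothstep (n.+1%:R * nsq x - 1)) * smoothstep' (n.+1%:R * (nsq x - 1))
   - smoothstep' (n.+1%:R * nsq x - 1) * smoothstep (n.+1%:R * (nsq x - 1))).

Lemma continuous_smoothstep : continuous smoothstep.
Proof. by move=> s; exact: is_derive_continuous (is_derive_smoothstep s). Qed.

Lemma continuous_shell n : continuous (shell n).
Proof.
move=> x; apply: continuous_pM.
  apply: continuous_pB; first exact: cst_continuous.
  by apply: (continuous_comp (@continuous_nsq_affine _ _ x)); exact: continuous_smoothstep.
rewrite (_ : (fun x => smoothstep _) = (fun x => smoothstep (n.+1%:R * nsq x - n.+1%:R))); last first.
  by apply/funext => y; rewrite mulrBr mulr1.
by apply: (continuous_comp (@continuous_nsq_affine _ _ x)); exact: continuous_smoothstep.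
Qed.

Lemma shell_bound n x : `|shell n x| <= 1.
Proof.
have /andP[a1 a2] := smoothstep_bound (n.+1%:R * nsq x - 1).
have /andP[b1 b2] := smoothstep_bound (n.+1%:R * (nsq x - 1)).
rewrite /shell normrM !ger0_norm // ?subr_ge0 //.
by rewrite -[leRHS]mulr1 ler_pM ?subr_ge0 // gerBl.
Qed.

Lemma shell_near0 n x : n.+1%:R * nsq x <= 1 -> shell n x = 0.
Proof. by move=> h; rewrite /shell smoothstep_le0 ?subr_le0 // subrr mul0r. Qed.

Lemma shell_out n x : 2 <= nsq x -> shell n x = 0 /\ shell' n x = 0.
Proof.
move=> x2; have k1 : 1 <= n.+1%:R :> R by rewrite ler1n.
have h1 : 1 <= n.+1%:R * (nsq x - 1) by nra.
have h2 : 1 <= n.+1%:R * nsq x - 1 by nra.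
rewrite /shell /shell' (smoothstep_ge1 h1) mulr0; split=> //.
by rewrite (smoothstep'_ge1 h1) (smoothstep'_ge1 h2) mulr0 mul0r subrr mulr0.
Qed.

Lemma shell_cvg x : shell n x @[n --> \oo] --> bw 0 x * (nsq x != 0)%:R.
Proof.
have [x0|x0] := eqVneq (nsq x) 0.
  rewrite mulr0; apply: cvg_near_cst; apply: nearW => n.
  by rewrite shell_near0 // x0 mulr0.
have xp : 0 < nsq x by rewrite lt_neqAle eq_sym x0 nsq_ge0.
rewrite mulr1; apply: cvg_near_cst; near=> n.
have a1 : 1 <= n.+1%:R * nsq x - 1.
  rewrite lerBrDl -ler_pdivrMr // -[1 + 1]/(2 : R).
  have : 2 / nsq x <= n%:R by near: n; exact: nbhs_infty_ger.
  by move=> /le_trans; apply; rewrite ler_nat.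
rewrite /shell (smoothstep_ge1 a1) subr0 mul1r /bw.
have [x1|x1] := leP (nsq x) 1.
  by rewrite smoothstep_le0 // mulr_ge0_le0 // subr_le0.
rewrite smoothstep_ge1 // -ler_pdivrMr ?subr_gt0 // mul1r.
have : (nsq x - 1)^-1 <= n%:R by near: n; exact: nbhs_infty_ger.
by move=> /le_trans; apply; rewrite ler_nat.
Unshelve. all: by end_near. Qed.

Lemma shell'_cvg x : shell' n x @[n --> \oo] --> (0 : R).
Proof.
have [x0|x0] := eqVneq (nsq x) 0.
  by apply: cvg_near_cst; apply: nearW => n; rewrite /shell' x0 !mulr0 mul0r.
have xp : 0 < nsq x by rewrite lt_neqAle eq_sym x0 nsq_ge0.
apply: cvg_near_cst; near=> n.
have a1 : 1 <= n.+1%:R * nsq x - 1.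
  rewrite lerBrDl -ler_pdivrMr // -[1 + 1]/(2 : R).
  have : 2 / nsq x <= n%:R by near: n; exact: nbhs_infty_ger.
  by move=> /le_trans; apply; rewrite ler_nat.
rewrite /shell' (smoothstep'_ge1 a1) mul0r subr0.
have [x1|x1] := leP (nsq x) 1.
  by rewrite smoothstep'_le0 ?mulr0 // mulr_ge0_le0 // subr_le0.
rewrite smoothstep'_ge1 ?mulr0 // -ler_pdivrMr ?subr_gt0 // mul1r.
have : (nsq x - 1)^-1 <= n%:R by near: n; exact: nbhs_infty_ger.
by move=> /le_trans; apply; rewrite ler_nat.
Unshelve. all: by end_near. Qed.

(* The shell where the outer part of [shell'] lives has width 1/n, which is
   compensated by [F] being O(|x|^2 - 1) there. *)
Lemma shell'_mul_bound n x (F B L : R) : `|F| <= B -> 0 <= L ->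
  (1 <= nsq x -> `|F| <= L * (nsq x - 1)) -> `|shell' n x * F| <= 16 * (B + L).
Proof.
move=> FB L0 FL; have B0 : 0 <= B := le_trans (normr_ge0 F) FB.
set k : R := n.+1%:R; have k1 : 1 <= k by rewrite ler1n.
set a := k * nsq x - 1; set b := k * (nsq x - 1).
have /andP[a1 a2] := smoothstep_bound a; have /andP[b1 b2] := smoothstep_bound b.
have s0 := nsq_ge0 x.
have ks0 : 0 <= k * nsq x by rewrite mulr_ge0 // (le_trans ler01).
have E : shell' n x * F = 2 * (k * nsq x) * smoothstep' b * F * (1 - smoothstep a)
   - 2 * (k * nsq x) * smoothstep' a * F * smoothstep b.
  by rewrite /shell' -/k -/a -/b; ring.
have T1 : `|2 * (k * nsq x) * smoothstep' b * F| <= 16 * L.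
  have [hb|hb] := leP b 0; first by rewrite smoothstep'_le0 // mulr0 mul0r normr0 mulr_ge0.
  have [hb'|hb'] := leP 1 b; first by rewrite smoothstep'_ge1 // mulr0 mul0r normr0 mulr_ge0.
  have x1 : 1 < nsq x by move: hb; rewrite /b pmulr_rgt0 ?subr_gt0 // (lt_le_trans ltr01).
  have x2 : nsq x <= 2 by move: hb'; rewrite /b; nra.
  have FL' := FL (ltW x1).
  have kF : k * `|F| <= L.
    by apply: (le_trans (_ : _ <= k * (L * (nsq x - 1)))); [rewrite ler_wpM2l // (le_trans ler01)|rewrite mulrCA -/b ler_piMr // ltW].
  rewrite !normrM (ger0_norm (ler0n R 2)) (ger0_norm s0) (@ger0_norm _ k) ?(le_trans ler01) //.
  have := smoothstep'_bound b; have := normr_ge0 (smoothstep' b); have := normr_ge0 F.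
  move: (`|F|) (`|smoothstep' b|) kF => f s kF f0 s0' s4.
  have -> : 2 * (k * nsq x) * s * f = (2 * nsq x * s) * (k * f) by ring.
  have h16 : 2 * nsq x * s <= 16 by nra.
  by apply: ler_pM; rewrite ?mulr_ge0 // (le_trans ler01).
have T2 : `|2 * (k * nsq x) * smoothstep' a * F| <= 16 * B.
  have [hb'|hb'] := leP 1 a; first by rewrite smoothstep'_ge1 // mulr0 mul0r normr0 mulr_ge0.
  have x2 : k * nsq x <= 2 by move: hb'; rewrite /a; lra.
  rewrite !normrM -normrM (ger0_norm (ler0n R 2)) (ger0_norm ks0).
  have := smoothstep'_bound a; have := normr_ge0 (smoothstep' a); have := normr_ge0 F.
  move: (`|F|) (`|smoothstep' a|) FB => f s FB f0 s0' s4.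
  by apply: ler_pM; rewrite ?mulr_ge0 //; nra.
rewrite E (_ : 16 * (B + L) = 16 * L + 16 * B); last by ring.
rewrite (le_trans (ler_normB _ _)) // lerD // normrM.
  by rewrite -[leRHS]mulr1 ler_pM // ger0_norm // ?subr_ge0 // gerBl.
by rewrite -[leRHS]mulr1 ler_pM // ger0_norm.
Qed.

Lemma derive_shell n (t : R) x : 0 < t ->
  is_derive t (1 : R) (fun t => shell n (t *: x)) (t^-1 * shell' n (t *: x)).
Proof.
move=> t0.
have dn (a b : R) : is_derive t (1 : R) (fun t : R => a * nsq (t *: x) - b) (a * (2 * t * nsq x)).
  have h : is_derive t (1 : R) (fun x : R => x ^+ 2) (2%:R * t).
    by split; [exact: exprn_derivable|rewrite exp_derive expr1; exact: mulr1].
  have h2 := is_deriveB (is_deriveM (is_derive_cst (a * nsq x) t (1 : R)) h) (is_derive_cst b t (1 : R)).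
  have -> : (fun t : R => a * nsq (t *: x) - b) = cst (a * nsq x) * (fun s : R => s ^+ 2) - cst b.
    by apply/funext => s; rewrite nsqZ mulrCA mulrC; congr (_ - _); rewrite /= mulrC mulrA mulrAC.
  apply: is_derive_eq h2 _; rewrite scaler0 addr0 subr0 /GRing.scale /=; ring.
have da := dn n.+1%:R 1; have db := dn n.+1%:R n.+1%:R.
have ca := @is_derive1_comp _ smoothstep (fun t : R => n.+1%:R * nsq (t *: x) - 1) t _ _ (is_derive_smoothstep _) da.
have cb := @is_derive1_comp _ smoothstep (fun t : R => n.+1%:R * nsq (t *: x) - n.+1%:R) t _ _ (is_derive_smoothstep _) db.
have h := is_deriveM (is_deriveB (is_derive_cst (1 : R) t (1 : R)) ca) cb.
have -> : (fun t => shell n (t *: x)) = (cst (1 : R) - (smoothstep \o (fun t : R => n.+1%:R * nsq (t *: x) - 1))) *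
   (smoothstep \o (fun t : R => n.+1%:R * nsq (t *: x) - n.+1%:R)).
  by apply/funext => s; rewrite /shell mulrBr mulr1.
apply: is_derive_eq h _.
transitivity ((1 - smoothstep (n.+1%:R * nsq (t *: x) - 1)) *
    (smoothstep' (n.+1%:R * nsq (t *: x) - n.+1%:R) * (n.+1%:R * (2 * t * nsq x))) +
  smoothstep (n.+1%:R * nsq (t *: x) - n.+1%:R) *
    (0 - smoothstep' (n.+1%:R * nsq (t *: x) - 1) * (n.+1%:R * (2 * t * nsq x)))); first by [].
have -> : n.+1%:R * nsq (t *: x) - n.+1%:R = n.+1%:R * (nsq (t *: x) - 1) by ring.
rewrite /shell'.
move: (smoothstep _) (smoothstep _) (smoothstep' _) (smoothstep' _) => a b c d.
by rewrite nsqZ; field; rewrite gt_eqF.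
Qed.

(** The divergence theorem without surface integrals. The function F(x) = V(x) - V(x/|x|) vanishes
    on the sphere and has the same Euler derivative as [V] off the origin. For the cut-off product H
    of [shell n] with F, scaling invariance gives that m H plus the Euler derivative of H has
    integral 0. In the limit m times the integral of F over the ball plus that of [euler V] is 0,
    which is the claim, by the cone formula for the sphere. *)
Lemma sphint_vol O g : open O -> (forall x, enorm x <= 1 -> O x) -> Ck 1 O g ->
  sphint_real g = m%:R * bmean 0 0 1 g + bmean 0 0 1 (euler g).
Proof.
move=> oO BO gk.
have [b [b1 bO]] : exists b, 1 < b /\ forall y, nsq (- 0 + 1 *: y) <= b -> O y.
  apply: ball_enlarge => // y; rewrite oppr0 add0r scale1r => y1.
  by apply: BO; rewrite enorm_le1.
pose a := (1 + b) / 2.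
have ab : a < b by rewrite /a; lra.
have a1 : 1 < a by rewrite /a; lra.
have b0 : 0 <= b by lra.
have [P [V [P0 Vk Vc Vg0]]] := cutoff_extension oO b0 ab bO gk.
have Vg z : nsq z <= a -> V z = g z by move=> za; apply: Vg0; rewrite oppr0 add0r scale1r.
have [C C0 hC] := Cc_bounded Vc.
have /choice[D hD] : forall i : 'I_m, exists D : R, forall x, `|pd i V x| <= D.
  by move=> i; have [D _ h] := Cc_bounded (Cc_pd i Vk Vc); exists D.
pose L := \sum_i D i.
have D0 i : 0 <= D i by rewrite (le_trans _ (hD i 0)).
have L0 : 0 <= L by apply: sumr_ge0.
pose F x := V x - V (sproj x).
have FB x : `|F x| <= C + C by rewrite (le_trans (ler_normB _ _)) // lerD.
(* The mean value bound along the ray from x/|x| to x, where |x| - 1 <= |x|^2 - 1; this compensates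
   the steep outer edge of [shell n]. *)
have FL x : 1 <= nsq x -> `|F x| <= L * (nsq x - 1).
  move=> x1; pose u := sproj x.
  have e1 : 1 <= enorm x by rewrite enormE -{1}(sqrtr1 R) ler_sqrt // nsq_ge0.
  have en : enorm x ^+ 2 = nsq x by rewrite sqr_sqrtr ?nsq_ge0.
  have xE : x = 0 + enorm x *: u.
    by rewrite add0r /u /sproj scalerA mulfV ?scale1r // gt_eqF // (lt_le_trans ltr01).
  have u1 : nsq u <= 1 by rewrite nsq_sproj // gt_eqF // (lt_le_trans ltr01).
  have := @lipschitz_MVT R (fun t => V (0 + t *: u)) (fun t => \sum_i u 0 i * pd i V (0 + t *: u)) 1 (enorm x) L.
  rewrite -xE scale1r add0r -/u.
  move=> H; apply: (le_trans (H _ _)).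
  - by move=> t _; apply/is_derive_line; exact: Ck_derive Vk _.
  - move=> t _; rewrite (le_trans (ler_norm_sum _ _ _)) // ler_sum // => i _.
    by rewrite normrM -[leRHS]mul1r ler_pM // coord_le1.
  - rewrite ler_wpM2l // ger0_norm ?subr_ge0 // -en; nra.
pose H n x := shell n x * F x.
(* The Euler operator applied to [H n]: the term V(x/|x|) is constant along rays and contributes
   nothing. *)
pose T n x := shell' n x * F x + shell n x * euler V x.
(* The projection to the sphere can be discontinuous only at the origin, near which [shell n]
   vanishes. *)
have cH n : continuous (H n).
  move=> x; have [x1|x1] := ltP (n.+1%:R * nsq x) 1.
    pose D' := (fun x : 'rV[R]_m => n.+1%:R * nsq x) @^-1` [set t | t < 1].
    have oD : open D'.
      apply: open_comp; last exact: open_lt.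
      by move=> z _; apply: continuous_pM; [exact: cst_continuous|exact: continuous_nsq].
    apply: (continuous_ext (O := D') (f := fun=> 0)) => //; last exact: cst_continuous.
    by move=> z Dz; rewrite /H shell_near0 ?mul0r // ltW.
  have x0 : nsq x != 0 by apply: contraTneq x1 => ->; rewrite mulr0 -ltNge ltr01.
  apply: continuous_pM; first exact: continuous_shell.
  apply: continuous_pB; first exact: Vc.1.
  by apply: (continuous_comp (continuous_sproj x0)); exact: Vc.1.
have cE : continuous (euler V) by apply: continuous_euler.
have euler_out n x : shell n x != 0 -> nsq x <= 2.
  by apply: contraNle => /ltW /(shell_out n) [-> _].
have Hsupp n x : 2 <= nsq x -> H n x = 0 by move=> /(shell_out n) [h _]; rewrite /H h mul0r.
have euler_bound x : nsq x <= 4 -> `|euler V x| <= 2 * L.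
  move=> x4; rewrite /euler (le_trans (ler_norm_sum _ _ _)) // mulr_sumr ler_sum // => i _.
  by rewrite normrM ler_pM // nsq_le_coord // (le_trans x4) // -natrX.
pose B := 16 * ((C + C) + L) + 2 * L.
have B0 : 0 <= B by rewrite /B; lra.
have TB n x : `|T n x| <= B.
  rewrite /T (le_trans (ler_normD _ _)) // lerD //; first by apply: shell'_mul_bound => //; exact: FL.
  have [->|sn] := eqVneq (shell n x) 0; first by rewrite mul0r normr0 mulr_ge0.
  rewrite normrM -[leRHS]mul1r ler_pM ?shell_bound // euler_bound //.
  by rewrite (le_trans (euler_out n x sn)) // ler_nat.
have HB n x : `|H n x| <= C + C.
  by rewrite /H normrM -[leRHS]mul1r ler_pM // shell_bound.
have vH n : vbaire 4 (C + C) (H n).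
  apply: vbaire_cont => // x i x4; apply: Hsupp; rewrite leNgt; apply/negP => x2.
  move: x4; apply/negP; rewrite -leNgt nsq_le_coord // (le_trans (ltW x2)) // -natrX ler_nat //.
have dH (n : nat) (t : R) x : 0 < t -> is_derive t (1 : R) (fun t => H n (t *: x)) (t^-1 * T n (t *: x)).
  move=> t0.
  have dn : is_derive t (1 : R) (fun t : R => nsq (t *: x)) (2 * t * nsq x).
    have h : is_derive t (1 : R) (fun x : R => x ^+ 2) (2%:R * t).
      by split; [exact: exprn_derivable|rewrite exp_derive expr1; exact: mulr1].
    have := is_deriveM h (is_derive_cst (nsq x) t (1 : R)).
    rewrite (_ : (fun s : R => s ^+ 2) * cst (nsq x) = (fun t : R => nsq (t *: x))); last first.
      by apply/funext => s; rewrite nsqZ.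
    by move=> h'; apply: is_derive_eq h' _; rewrite scaler0 add0r; exact: mulrC.
  have dV : is_derive t (1 : R) (fun s : R => V (s *: x)) (\sum_i x 0 i * pd i V (t *: x)).
    have h := Ck_derive x Vk (x := 0 + t *: x) I; have := (is_derive_line V 0 x t _).2 h.
    rewrite add0r; congr (is_derive _ _ _ _); apply/funext => s; by rewrite add0r.
  have dF : is_derive t (1 : R) (fun s : R => F (s *: x)) (\sum_i x 0 i * pd i V (t *: x)).
    have := is_deriveB dV (is_derive_cst (V (sproj x)) t (1 : R)); rewrite subr0.
    apply: near_eq_is_derive; near=> s; rewrite /F sprojZ //.
    by near: s; exact: lt_nbhsr.
  have ds := @derive_shell n t x t0.
  have := is_deriveM ds dF.
  move=> h; apply: is_derive_eq h _.
  rewrite /T /GRing.scale /= /euler.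
  have -> : \sum_(i < m) (t *: x) 0 i * pd i V (t *: x) = t * \sum_i x 0 i * pd i V (t *: x).
    by rewrite mulr_sumr; apply: eq_bigr => i _; rewrite mxE mulrA.
  by field; rewrite gt_eqF.
have half0 : 0 < 2^-1 :> R by rewrite invr_gt0.
have tpos (t : R) : `|t - 1| < 2^-1 -> 2^-1 < t.
  rewrite ltr_norml => /andP[h _]; move: h; rewrite ltrBrDr => h.
  by apply: le_lt_trans h; lra.
(* Here t > 1/2: the box of half-width 4 grows to at most 8, and below 1/t contributes a factor of
   at most 2 to the bound. *)
have vHt (n : nat) (t : R) : `|t - 1| < 2^-1 -> vbaire 8 (C + C) (fun x => H n (t *: x)).
  move=> /tpos t2; apply: vbaire_cont => // [x|x i x8].
    by apply: (continuous_comp (f := fun x => t *: x)); [exact: scaler_continuous|exact: cH].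
  apply: (vbaire_supp (i := i) (vH n)); rewrite mxE normrM gtr0_norm; last by lra.
  by nra.
have dT n : vbaire 8 (2 * B) (T n) /\
    is_derive (1 : R) (1 : R) (fun t => rint (fun x => H n (t *: x))) (rint (T n)).
  have := @is_derive_rint R m 8 (C + C) (2 * B) 1 (2^-1) (fun t x => H n (t *: x))
    (fun t x => t^-1 * T n (t *: x)) (ler0n R 8) half0 (vHt n).
  rewrite (_ : (fun x => 1^-1 * T n (1 *: x)) = T n); last first.
    by apply/funext => x; rewrite invr1 mul1r scale1r.
  apply=> t x /tpos t2; first by apply: dH; lra.
  have t0 : 0 < t by lra.
  rewrite normrM ler_pM // normfV gtr0_norm // -[leRHS]invrK lef_pV2 ?posrE //.
  exact: ltW.
have key n : rint (fun x => m%:R * H n x + T n x) = 0.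
  have [vT dJ] := dT n.
  have vH8 := vbaire_mono (ler_nat R 4 8) (lexx _) (vH n).
  rewrite (rintD (ler0n R 8) (vbaireZ m%:R vH8) vT) (rintZ m%:R (ler0n R 8) vH8).
  have dX : is_derive (1 : R) (1 : R) (fun s : R => s ^+ m) (m%:R * 1 ^+ m.-1).
    by split; [exact: exprn_derivable|rewrite exp_derive; exact: mulr1].
  have dP := is_deriveM dX dJ.
  (* By scaling, t^m times the integral of H(t x) is constant near t = 1; comparison with [dP]
     yields the identity. *)
  have dC : is_derive (1 : R) (1 : R) ((fun s : R => s ^+ m) *
      (fun t => rint (fun x => H n (t *: x)))) 0.
    apply: near_eq_is_derive (is_derive_cst (rint (H n)) (1 : R) (1 : R)).
    near=> t; have t0 : 0 < t by near: t; exact: lt_nbhsr.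
    have e := rint_affine 0 (ler0n R 4) t0 (vH n).
    rewrite /GRing.mul /= (_ : (fun x => H n (t *: x)) = (fun x => H n (t *: x + 0))).
      by rewrite e exprVn mulrA divff ?mul1r // expf_neq0 // gt_eqF.
    by apply/funext => x; rewrite addr0.
  have [_ e1] := dP; have [_ e2] := dC; have := etrans (esym e1) e2.
  rewrite !expr1n (_ : (fun x => H n (1 *: x)) = H n); last by apply/funext => x; rewrite scale1r.
  by rewrite /GRing.scale /= mul1r mulr1 addrC mulrC.
have lH x : H n x @[n --> \oo] --> bw 0 x * F x.
  (* At the origin [shell n] tends to 0 instead of 1; this does no harm because [sproj 0 = 0] makes
     [F] vanish there. *)
  have -> : bw 0 x * F x = bw 0 x * (nsq x != 0)%:R * F x.
    have [/nsq_eq0 ->|_] := eqVneq (nsq x) 0; last by rewrite mulr1.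
    by rewrite /F sproj0 subrr !mulr0.
  by apply: cvgMl; exact: shell_cvg.
have lT x : T n x @[n --> \oo] --> bw 0 x * euler V x.
  have -> : bw 0 x * euler V x = 0 * F x + bw 0 x * (nsq x != 0)%:R * euler V x.
    have [/nsq_eq0 ->|_] := eqVneq (nsq x) 0; last by rewrite mulr1 mul0r add0r.
    by rewrite /euler big1 ?mulr0 ?mul0r ?addr0 // => i _; rewrite mxE mul0r.
  by apply: cvgD; apply: cvgMl; [exact: shell'_cvg|exact: shell_cvg].
have vH8 n := vbaire_mono (ler_nat R 4 8) (lexx _) (vH n).
have vF : vbaire 4 (C + C) (fun x => bw 0 x * F x) by exact: vbaire_lim vH lH.
have [C1 vE] := vbaire_bw 0 cE.
have [C2 vV] := vbaire_bw 0 Vc.1.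
have lim0 : rint (fun x => m%:R * (bw 0 x * F x) + bw 0 x * euler V x) = 0.
  have l : rint (fun x => m%:R * H n x + T n x) @[n --> \oo] -->
           rint (fun x => m%:R * (bw 0 x * F x) + bw 0 x * euler V x).
    apply: (rint_cvg (ler0n R 8)) => [n|x]; first by have [vT _] := dT n; exact: vbaireD (vbaireZ m%:R (vH8 n)) vT.
    by apply: cvgD; [apply: cvgMr; exact: lH|exact: lT].
  have E0 : (fun n => rint (fun x => m%:R * H n x + T n x)) = cst 0 by apply/funext => n; exact: key.
  by rewrite -(cvg_lim _ l) // E0 lim_cst.
have E1 : sphint_real g = m%:R * rint (fun x => bw 0 x * V x - bw 0 x * F x).
  rewrite /sphint_real; congr (_ * _); congr rint; apply/funext => x.
  rewrite -mulrBr /F opprB addrC subrK enorm_le1 /bw; case: ifP => _; rewrite ?mul1r ?mul0r //.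
  rewrite Vg //; have [/nsq_eq0 ->|x0] := eqVneq (nsq x) 0.
    by rewrite sproj0 nsq0 ltW // (lt_trans ltr01).
  by rewrite nsq_sproj // ltW.
rewrite E1 (rintB (ler0n R 4) vV vF) mulrBr.
move: lim0; rewrite (rintD (ler0n R 4) (vbaireZ m%:R vF) vE) (rintZ _ (ler0n R 4) vF) => /eqP.
rewrite addr_eq0 => /eqP ->; rewrite opprK.
have oa : open [set x : 'rV[R]_m | nsq x < a].
  apply: (open_comp (f := @nsq R m) (D := [set t | t < a])); last exact: open_lt.
  by move=> z _; exact: continuous_nsq.
congr (_ * _ + _); rewrite /bmean; congr rint; apply/funext => x; rewrite scale1r add0r.
  by apply: bwM_eq => x1; rewrite Vg // (le_trans x1) // ltW.
apply: bwM_eq => x1; rewrite /euler; apply: eq_bigr => i _; congr (_ * _).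
apply: (pd_ext i oa); last exact: le_lt_trans a1.
by move=> y /ltW; exact: Vg.
Unshelve. all: by end_near. Qed.

End SphereIntegral.

(** * Shifted Euler operators on ball means and on the sphere *)

Section EulerShift.
Variables (R : realType) (m : nat).
Implicit Types (f g u U V : 'rV[R]_m -> R) (x y v : 'rV[R]_m) (O : set 'rV[R]_m).
Notation pd i f := ('D_('e_i) f).

Definition eshift (c : R) U x : R := 2^-1 * euler U x + c * U x.

Lemma Ck_euler q O U : open O -> Ck q.+1 O U -> Ck q O (euler U).
Proof.
move=> oO Uk; apply: Ck_sum => // i _; apply: CkM => //; first exact: Ck_coord.
exact: Ck_pd.
Qed.

Lemma Ck_eshift q O c U : open O -> Ck q.+1 O U -> Ck q O (eshift c U).
Proof.
by move=> oO Uk; apply: CkD => //; apply: CkZ => //; [exact: Ck_euler|exact: CkW].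
Qed.

Lemma euler_ext O U V x : open O -> (forall y, O y -> U y = V y) -> O x -> euler U x = euler V x.
Proof. by move=> oO UV Ox; apply: eq_bigr => i _; rewrite (pd_ext i oO UV Ox). Qed.

Lemma eshift_ext O c U V x : open O -> (forall y, O y -> U y = V y) -> O x ->
  eshift c U x = eshift c V x.
Proof. by move=> oO UV Ox; rewrite /eshift (euler_ext oO UV Ox) UV. Qed.

Lemma eshift_sum O c (I : Type) (r : seq I) (P : pred I) (F : I -> 'rV[R]_m -> R) x : open O ->
  (forall i, P i -> Ck 1 O (F i)) -> O x ->
  eshift c (fun x => \sum_(i <- r | P i) F i x) x = \sum_(i <- r | P i) eshift c (F i) x.
Proof.
move=> oO Fk Ox; rewrite /eshift big_split /= -!mulr_sumr; congr (_ * _ + _).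
rewrite /euler exchange_big /=; apply: eq_bigr => i _.
by rewrite (pd_sum r i oO Fk Ox) mulr_sumr.
Qed.

(* With s = m/2, this is the effect on U of (d/dr^2)^j r^(m-2) at r = 1. *)
Fixpoint rad (s : R) (j : nat) U : 'rV[R]_m -> R :=
  if j is j'.+1 then eshift (s - j%:R) (rad s j' U) else U.

Lemma Ck_rad s q j O U : open O -> Ck (q + j) O U -> Ck q O (rad s j U).
Proof.
move=> oO; elim: j q => [|j IH] q /= Uk; first by rewrite addn0 in Uk.
by apply: Ck_eshift => //; apply: IH; rewrite addSnnS.
Qed.

Lemma rad_sum s j O (I : Type) (r : seq I) (P : pred I) (F : I -> 'rV[R]_m -> R) x : open O ->
  (forall i, P i -> Ck j O (F i)) -> O x ->
  rad s j (fun x => \sum_(i <- r | P i) F i x) x = \sum_(i <- r | P i) rad s j (F i) x.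
Proof.
move=> oO; elim: j x => [|j IH] x Fk Ox //=.
rewrite (eshift_ext _ oO _ Ox (V := fun x => \sum_(i <- r | P i) rad s j (F i) x)).
  by rewrite (eshift_sum _ _ oO _ Ox) // => i Pi; apply: Ck_rad => //; exact: Fk.
by move=> y Oy; apply: IH => // i Pi; exact: CkW (Fk i Pi).
Qed.

(** The mean of [euler U] is r d/dr of the mean of [U], computed on the polynomial. Linearity of the
    mean in [eshift] is proved alongside because it relies on the same cutoff. *)
Lemma bmean_euler O U (r0 r : R) (p : nat) (d : nat -> R) : open O -> Ck 1 O U ->
  (forall y, nsq y <= r0 ^+ 2 -> O y) ->
  (forall s, 0 < s < r0 -> bmean 0 0 s U = \sum_(l < p) d l * s ^+ l.*2) -> 0 < r < r0 ->
  bmean 0 0 r (euler U) = \sum_(l < p) 2 * l%:R * d l * r ^+ l.*2 /\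
  (forall c, bmean 0 0 r (eshift c U) = 2^-1 * bmean 0 0 r (euler U) + c * bmean 0 0 r U).
Proof.
move=> oO Uk bO HU /andP[r1 r2].
have rr : r ^+ 2 < r0 ^+ 2 by rewrite ltr_pXn2r // ?nnegrE ltW // (lt_trans r1).
pose a := (r ^+ 2 + r0 ^+ 2) / 2.
have ra : r ^+ 2 < a by rewrite /a; lra.
have ab : a < r0 ^+ 2 by rewrite /a; lra.
have bO' z : nsq (- 0 + 1 *: z) <= r0 ^+ 2 -> O z by rewrite oppr0 add0r scale1r; exact: bO.
have [P [V [P0 Vk Vc Vg0]]] := cutoff_extension oO (sqr_ge0 r0) ab bO' Uk.
have VU z : nsq z <= a -> V z = U z by move=> za; apply: Vg0; rewrite oppr0 add0r scale1r.
pose D := [set z : 'rV[R]_m | nsq z < a].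
have oD : open D.
  apply: (open_comp (f := @nsq R m) (D := [set t | t < a])); last exact: open_lt.
  by move=> z _; exact: continuous_nsq.
have DVU z : D z -> V z = U z by move=> /ltW; exact: VU.
have Dy s y : s ^+ 2 < a -> nsq y <= 1 -> D (0 + s *: y).
  move=> sa y1; rewrite /D /= add0r nsqZ (le_lt_trans _ sa) // -[leRHS]mulr1.
  by rewrite ler_wpM2l ?sqr_ge0.
have dV := derive_bmean 0 0 r Vk Vc.
have eV : rint (fun y => bw 0 y * \sum_(i < m) y 0 i * pd i V (0 + r *: y)) = r^-1 * bmean 0 0 r (euler V).
  have [C vE] := vbaire_bw 0 (@continuous_scale_shift R m 0 r (euler V) (continuous_euler Vk)).
  rewrite /bmean -(rintZ _ (ler0n R 4) vE); congr rint; apply/funext => y.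
  rewrite mulrCA; congr (_ * _); rewrite /euler mulr_sumr; apply: eq_bigr => i _.
  rewrite {2}add0r mxE mulrA mulrA mulVf ?mul1r //.
  by rewrite gt_eqF.
have eVU : bmean 0 0 r (euler V) = bmean 0 0 r (euler U).
  by apply: eq_bmean => y y1; apply: (euler_ext oD DVU); exact: Dy.
split; last first.
  move=> c; have -> : bmean 0 0 r (eshift c U) = bmean 0 0 r (eshift c V).
    by apply: eq_bmean => y y1; apply/esym; apply: (eshift_ext c oD DVU); exact: Dy.
  rewrite -eVU (_ : bmean 0 0 r U = bmean 0 0 r V); last first.
    by apply: eq_bmean => y y1; apply/esym/DVU/Dy.
  have [C1 v1] := vbaire_bw 0 (@continuous_scale_shift R m 0 r (euler V) (continuous_euler Vk)).
  have [C2 v2] := vbaire_bw 0 (@continuous_scale_shift R m 0 r V (CkT_cont Vk)).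
  rewrite /bmean -(rintZ 2^-1 (ler0n R 4) v1) -(rintZ c (ler0n R 4) v2).
  rewrite -(rintD (ler0n R 4) (vbaireZ _ v1) (vbaireZ _ v2)); congr rint; apply/funext => y.
  by rewrite /eshift; ring.
rewrite -eVU; apply: (mulfI (_ : r^-1 != 0)); first by rewrite invr_eq0 gt_eqF.
rewrite -eV; have [_ <-] := dV.
have h : is_derive r (1 : R) (fun s => \sum_(l < p) d l * s ^+ l.*2 * 1)
   (\sum_(l < p) d l * ((l : nat).*2%:R * r ^+ (l : nat).*2.-1) * 1).
  by apply: is_derive_sumf => i; exact: is_derive_monom.
have h' : is_derive r (1 : R) (fun s => bmean 0 0 s V)
   (\sum_(l < p) d l * ((l : nat).*2%:R * r ^+ (l : nat).*2.-1) * 1).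
  apply: near_eq_is_derive h; near=> s.
  have s0 : 0 < s by near: s; exact: lt_nbhsr.
  have sr : s < r0 by near: s; exact: lt_nbhsl.
  have sa : s ^+ 2 < a.
    by near: s; have /(_ [set t | t < a]) := @exprn_continuous R 2 r; apply; exact: lt_nbhsl.
  rewrite (_ : bmean 0 0 s V = bmean 0 0 s U); last first.
    by apply: eq_bmean => y y1; apply/DVU/Dy.
  by rewrite HU ?s0 //; apply: eq_bigr => l _; rewrite mulr1.
have [_ ->] := h'; rewrite mulr_sumr; apply: eq_bigr => l _.
rewrite mulr1; case: (l : nat) => [|k]; first by rewrite !(mul0r, mulr0).
rewrite doubleS /= [r ^+ k.*2.+2]exprS (_ : k.*2.+2%:R = 2 * k.+1%:R :> R); last first.
  by rewrite -doubleS -muln2 natrM mulrC.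
by field; rewrite gt_eqF.
Unshelve. all: by end_near. Qed.

Lemma bmean_eshift O U (r0 r c : R) (p : nat) (d : nat -> R) : open O -> Ck 1 O U ->
  (forall y, nsq y <= r0 ^+ 2 -> O y) ->
  (forall s, 0 < s < r0 -> bmean 0 0 s U = \sum_(l < p) d l * s ^+ l.*2) -> 0 < r < r0 ->
  bmean 0 0 r (eshift c U) = \sum_(l < p) (l%:R + c) * d l * r ^+ l.*2.
Proof.
move=> oO Uk bO HU rr; have [e1 e2] := bmean_euler oO Uk bO HU rr.
rewrite e2 e1 HU // !mulr_sumr -big_split /=; apply: eq_bigr => l _.
by field.
Qed.

Lemma bmean_rad O U (s r0 r : R) (p j : nat) (d : nat -> R) : open O -> Ck j O U ->
  (forall y, nsq y <= r0 ^+ 2 -> O y) ->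
  (forall r, 0 < r < r0 -> bmean 0 0 r U = \sum_(l < p) d l * r ^+ l.*2) -> 0 < r < r0 ->
  bmean 0 0 r (rad s j U) =
  \sum_(l < p) (\prod_(i < j) (l%:R + s - i.+1%:R)) * d l * r ^+ l.*2.
Proof.
move=> oO; elim: j r => [|j IH] r Uk bO HU rr.
  by rewrite /= HU //; apply: eq_bigr => l _; rewrite big_ord0 mul1r.
rewrite /= (bmean_eshift (r0 := r0) (s - j.+1%:R) oO (Ck_rad s (q := 1) oO Uk) bO (p := p)
  (d := fun l => (\prod_(i < j) (l%:R + s - i.+1%:R)) * d l)) //; last first.
  by move=> t tt; apply: IH => //; exact: CkW.
by apply: eq_bigr => l _; rewrite big_ord_recr /=; congr (_ * _); ring.
Qed.

(** On the term r^(2l) the operator m + E of [sphint_vol] is multiplication by 2 (l + m/2). This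
    supplies the factor 2 and the factor i = 0 of the product, whose other j factors come from
    [rad]. *)
Lemma sphint_rad O U (p j : nat) : open O -> (forall x, enorm x <= 1 -> O x) -> polyh p O U ->
  sphint_real (rad (m%:R / 2) j U) =
  2 * \sum_(l < p) (\prod_(i < j.+1) (l%:R + m%:R / 2 - i%:R)) * pizz R m 0 l * iter l (@lap R m) U 0.
Proof.
move=> oO BO Up; have Uk := polyh_Ck oO Up.
have [b [b1 bO]] : exists b, 1 < b /\ forall y, nsq (- 0 + 1 *: y) <= b -> O y.
  apply: ball_enlarge => // y; rewrite oppr0 add0r scale1r => y1.
  by apply: BO; rewrite enorm_le1.
pose r0 := Num.sqrt b.
have b0 : 0 <= b by lra.
have r02 : r0 ^+ 2 = b by rewrite sqr_sqrtr.
have r01 : 1 < r0 by rewrite /r0 -{1}(sqrtr1 R) ltr_sqrt // (lt_trans ltr01).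
have bO' y : nsq y <= r0 ^+ 2 -> O y by rewrite r02 => h; apply: bO; rewrite oppr0 add0r scale1r.
have HU r : 0 < r < r0 -> bmean 0 0 r U = \sum_(l < p) (pizz R m 0 l * iter l (@lap R m) U 0) * r ^+ l.*2.
  move=> /andP[h1 h2]; rewrite (bmean_polyh (r0 := r0) 0 oO Up); last by rewrite !ltW.
    by apply: eq_bigr => l _; rewrite mulrAC.
  by move=> y; rewrite r02; exact: bO.
have one : 0 < (1 : R) < r0 by rewrite ltr01.
have W1 := Ck_rad (m%:R / 2) (q := 1) (j := j) oO (Uk _).
have HW r := @bmean_rad O U (m%:R / 2) r0 r p j (fun l => pizz R m 0 l * iter l (@lap R m) U 0) oO (Uk j) bO' HU.
rewrite (sphint_vol oO BO W1).
have [e1 _] := bmean_euler (d := fun l => (\prod_(i < j) (l%:R + m%:R / 2 - i.+1%:R)) *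
  (pizz R m 0 l * iter l (@lap R m) U 0)) oO W1 bO' HW one.
rewrite e1 HW // !mulr_sumr -big_split /=; apply: eq_bigr => l _.
rewrite expr1n big_ord_recl /= subr0.
under [X in _ = 2 * ((_ * X) * _ * _)]eq_bigr do rewrite -[bump 0 _]/(_.+1).
by move: (\prod_(i < j) _) => P; field.
Qed.

End EulerShift.

(** * Iterated derivatives with respect to r^2 *)

Section RadialDerivatives.
Variables (R : realType) (m : nat).
Implicit Types (U : 'rV[R]_m -> R) (x : 'rV[R]_m) (O : set 'rV[R]_m).

Definition rdr2 (g : R -> R) (r : R) : R := (2 * r)^-1 * derive1 g r.

Lemma Re_rM (a : R) (z : R[i]) : complex.Re (a%:C%C * z) = a * complex.Re z.
Proof. by case: z => u v /=; rewrite mul0r subr0. Qed.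

Lemma Im_rM (a : R) (z : R[i]) : complex.Im (a%:C%C * z) = a * complex.Im z.
Proof. by case: z => u v /=; rewrite mul0r addr0. Qed.

Lemma Re_iter_dr2 j (g : R -> R[i]) :
  (fun t => complex.Re (iter j (@dr2 R) g t)) = iter j rdr2 (fun t => complex.Re (g t)).
Proof.
by elim: j => // j IH; rewrite [RHS]iterS -IH; apply/funext => t; rewrite iterS /dr2 Re_rM.
Qed.

Lemma Im_iter_dr2 j (g : R -> R[i]) :
  (fun t => complex.Im (iter j (@dr2 R) g t)) = iter j rdr2 (fun t => complex.Im (g t)).
Proof.
by elim: j => // j IH; rewrite [RHS]iterS -IH; apply/funext => t; rewrite iterS /dr2 Im_rM.
Qed.

(** Used to pass from the integer power r^(m-2) to [powR]: the two are identified for positive r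
    only, which is enough for derivatives there. *)
Lemma eq_iter_rdr2 j (g1 g2 : R -> R) : (forall r, 0 < r -> g1 r = g2 r) ->
  forall r, 0 < r -> iter j rdr2 g1 r = iter j rdr2 g2 r.
Proof.
move=> g12; elim: j => [|j IH] r r0; first exact: g12.
rewrite !iterS /rdr2; congr (_ * _); rewrite !derive1E; apply: near_eq_derive.
by near=> t; apply: IH; near: t; exact: lt_nbhsr.
Unshelve. all: by end_near. Qed.

(** One application of d/d(r^2) to r^(2c) W(r x) gives r^(2c-2) times (E/2 + c) W at r x. Starting
    from c = s - 1, the j-th application has c = s - j, as in [rad]. *)
Lemma iter_rdr2 O U (s r0 : R) j x : open O -> (forall t, 0 < t < r0 -> O (t *: x)) ->
  Ck j O U -> forall r, 0 < r < r0 ->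
  iter j rdr2 (fun r => r `^ (2 * (s - 1)) * U (r *: x)) r =
  r `^ (2 * (s - 1 - j%:R)) * rad s j U (r *: x).
Proof.
move=> oO xO; elim: j => [|j IH] Uk r /andP[r1 r2]; first by rewrite /= subr0.
rewrite iterS; set G := iter j _ _.
have Wk := Ck_rad s (q := 1) (j := j) oO Uk.
have rO : O (0 + r *: x) by rewrite add0r; apply: xO; rewrite r1.
have h := (is_derive_line (rad s j U) 0 x r _).2 (Ck_derive x Wk rO).
have h2 := is_deriveM (is_derive1_powR (2 * (s - 1 - j%:R)) r1) h.
have dG : is_derive r (1 : R) G ((2 * (s - 1 - j%:R)) * r `^ (2 * (s - 1 - j%:R) - 1) * rad s j U (r *: x)
   + r `^ (2 * (s - 1 - j%:R)) * (r^-1 * euler (rad s j U) (r *: x))).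
  have e : r^-1 * euler (rad s j U) (r *: x) = \sum_(i < m) x 0 i * 'D_('e_i) (rad s j U) (0 + r *: x).
    rewrite /euler mulr_sumr add0r; apply: eq_bigr => i _.
    by rewrite mxE mulrA mulrA mulVf ?mul1r // gt_eqF.
  rewrite e; apply: near_eq_is_derive (is_derive_eq h2 _); last first.
    by rewrite add0r addrC /GRing.scale /= [rad _ _ _ _ * _]mulrC.
  near=> t; rewrite /GRing.mul /= add0r /G IH //; first exact: CkW.
  by apply/andP; split; near: t; [exact: lt_nbhsr|exact: lt_nbhsl].
rewrite /rdr2 derive1E; have [_ ->] := dG.
have r0' : r != 0 by rewrite gt_eqF.
have e1 : r `^ (2 * (s - 1 - j%:R) - 1) = r * r `^ (2 * (s - 1 - j.+1%:R)).
  rewrite -{2}[r]powRr1 ?ltW // -powRD ?r0' ?implybT //; congr (_ `^ _).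
  by rewrite -[j.+1]addn1 natrD; ring.
have e2 : r `^ (2 * (s - 1 - j%:R)) = r * (r * r `^ (2 * (s - 1 - j.+1%:R))).
  rewrite -e1 -{2}[r]powRr1 ?ltW // -powRD ?r0' ?implybT //; congr (_ `^ _).
  by ring.
rewrite e2 e1 /= /eshift -[j.+1]addn1 natrD.
by field.
Unshelve. all: by end_near. Qed.

Lemma eq_sphint_real (g1 g2 : 'rV[R]_m -> R) :
  (forall x, nsq x <= 1 -> g1 x = g2 x) -> sphint_real g1 = sphint_real g2.
Proof.
move=> g12; rewrite /sphint_real; congr (_ * rint _); apply/funext => x.
case: ifP => // _; apply: g12.
have [/nsq_eq0 ->|x0] := eqVneq (nsq x) 0; first by rewrite scaler0 nsq0.
by rewrite (nsq_sproj x0).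
Qed.

Lemma iter_rdr2_one O U j x : open O -> (forall y, enorm y <= 1 -> O y) -> Ck j O U -> nsq x <= 1 ->
  iter j rdr2 (fun r => r ^ (m%:Z - 2%:Z) * U (r *: x)) 1 = rad (m%:R / 2) j U x.
Proof.
move=> oO BO Uk x1.
have [b [b1 bO]] : exists b, 1 < b /\ forall y, nsq (- 0 + 1 *: y) <= b -> O y.
  apply: ball_enlarge => // y; rewrite oppr0 add0r scale1r => y1.
  by apply: BO; rewrite enorm_le1.
pose r0 := Num.sqrt b.
have b0 : 0 <= b by lra.
have r02 : r0 ^+ 2 = b by rewrite sqr_sqrtr.
have r01 : 1 < r0 by rewrite /r0 -{1}(sqrtr1 R) ltr_sqrt // (lt_trans ltr01).
have tO t : 0 < t < r0 -> O (t *: x).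
  move=> /andP[t0 tr]; apply: bO; rewrite oppr0 add0r scale1r nsqZ -r02 -[leRHS]mulr1.
  by rewrite ler_pM ?nsq_ge0 ?sqr_ge0 // ler_sqr ?nnegrE // ltW // (lt_trans t0).
have H := iter_rdr2 (m%:R / 2) oO tO Uk (r := 1).
rewrite ltr01 powR1 scale1r mul1r in H; rewrite -H //.
apply: eq_iter_rdr2 => // r r0'; congr (_ * _).
rewrite -powR_intmul ?ltW //; congr (_ `^ _).
by rewrite rmorphB /=; field.
Qed.

End RadialDerivatives.

(** * The Gamma function: functional equation and the values at 1 and 1/2 *)

Section GammaFunction.
Variable R : realType.
Local Notation mu := (@lebesgue_measure R).
Implicit Types (s t a b : R).

Definition gam s t : R := t `^ (s - 1) * expR (- t).

Lemma is_derive_expRN t : is_derive t (1 : R) (fun t => expR (- t)) (- expR (- t)).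
Proof.
have := @is_derive1_comp _ expR (-%R) t _ _ (is_derive_expR (- t)) (is_deriveN (is_derive_id t (1 : R))).
by rewrite mulrN1.
Qed.

Lemma is_derive_gam s t : 0 < t -> is_derive t (1 : R) (fun t => t `^ s * expR (- t)) (s * gam s t - gam (s + 1) t).
Proof.
move=> t0; have := is_deriveM (is_derive1_powR s t0) (is_derive_expRN t).
move=> h; apply: is_derive_eq h _; rewrite /gam addrK /GRing.scale /=; ring.
Qed.

Lemma continuous_gam s t : 0 < t -> {for t, continuous (gam s)}.
Proof. by move=> t0; exact: is_derive_continuous (is_derive_gam (s - 1) t0). Qed.

Lemma FTC_pos (f F : R -> R) a b : 0 < a -> a < b ->
  (forall t, 0 < t -> {for t, continuous f}) ->
  (forall t, 0 < t -> is_derive t (1 : R) F (f t)) ->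
  Rintegral mu `[a, b] f = F b - F a.
Proof.
move=> a0 ab fc Fd; have b0 : 0 < b by exact: lt_trans ab.
have Fc t : 0 < t -> {for t, continuous F} by move=> /Fd; exact: is_derive_continuous.
rewrite /Rintegral (@continuous_FTC2 _ f F) //.
- apply: continuous_in_subspaceT => t; rewrite inE /= in_itv /= => /andP[h _].
  by apply: fc; exact: lt_le_trans h.
- split=> [x||]; rewrite ?in_itv /=.
  + by move=> /andP[h _]; have [] := Fd x (lt_trans a0 h).
  + by apply: cvg_at_right_filter; exact: Fc.
  + by apply: cvg_at_left_filter; exact: Fc.
- by move=> x; rewrite in_itv /= derive1E => /andP[h _]; have [_ ->] := Fd x (lt_trans a0 h).
Qed.

Lemma integrable_pos (f : R -> R) a b : 0 < a -> (forall t, 0 < t -> {for t, continuous f}) ->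
  mu.-integrable `[a, b] (EFin \o f).
Proof.
move=> a0 fc; apply: continuous_compact_integrable; first exact: segment_compact.
apply: continuous_in_subspaceT => t; rewrite inE /= in_itv /= => /andP[h _].
by apply: fc; exact: lt_le_trans h.
Qed.

(** Compact intervals exhausting the positive half-line; the upper end n + 2 makes the interval
    nondegenerate already for n = 0. *)
Definition gamn s (n : nat) : R := Rintegral mu `[n.+1%:R^-1, n.+2%:R] (gam s).

Lemma inv_lt_n (n : nat) : (n.+1%:R^-1 : R) < n.+2%:R.
Proof.
apply: (@le_lt_trans _ _ 1); last by rewrite ltr1n.
by rewrite invf_le1 // ler1n.
Qed.

Lemma gamn_rec s n : gamn (s + 1) n = s * gamn s n +
  (n.+1%:R^-1 `^ s * expR (- n.+1%:R^-1) - n.+2%:R `^ s * expR (- n.+2%:R)).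
Proof.
have a0 : 0 < n.+1%:R^-1 :> R by rewrite invr_gt0.
have c s' := fun t => @continuous_gam s' t.
have i s' := integrable_pos n.+2%:R a0 (c s').
have cs t : 0 < t -> {for t, continuous (fun t => s * gam s t)}.
  by move=> t0; apply: (cvgM (cvg_cst s) (c s t t0)).
have := FTC_pos (f := fun t => s * gam s t - gam (s + 1) t) a0 (inv_lt_n n).
move=> /(_ (fun t => t `^ s * expR (- t))); rewrite RintegralB //; last exact: integrable_pos.
rewrite RintegralZl // -/(gamn s n) -/(gamn (s + 1) n) => H.
have := H (fun t tp => cvgB (cs t tp) (c (s + 1) t tp)) (@is_derive_gam s).
by move=> H'; rewrite -[X in _ = _ + X]opprB -H' opprB [RHS]addrC subrK.
Qed.

Lemma bigcup_itv_pos : \bigcup_n `[n.+1%:R^-1, n.+2%:R]%classic = `]0, +oo[%classic :> set R.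
Proof.
apply/seteqP; split=> t /=.
  by move=> [n _]; rewrite /= !in_itv /= andbT => /andP[h _]; apply: lt_le_trans h; rewrite invr_gt0.
rewrite in_itv /= andbT => t0.
pose n := Num.truncn (Num.max t t^-1).
have h : Num.max t t^-1 < n.+1%:R by exact: truncnS_gt.
move: h; rewrite gt_max => /andP[h1 h2]; exists n => //=; rewrite in_itv /=; apply/andP; split.
  by rewrite -[leRHS]invrK lef_pV2 ?posrE ?invr_gt0 // ltW.
by rewrite (le_trans (ltW h1)) // ler_nat.
Qed.

Lemma gam_ge0 s t : 0 <= gam s t.
Proof. by rewrite mulr_ge0 ?powR_ge0 ?expR_ge0. Qed.

Lemma gamn_cvg s : (gamn s n)%:E @[n --> \oo] --> (\int[mu]_(t in `]0%R, +oo[) (gam s t)%:E)%E.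
Proof.
have i n : mu.-integrable `[n.+1%:R^-1, n.+2%:R] (EFin \o gam s).
  by apply: integrable_pos => [|t]; [rewrite invr_gt0|exact: continuous_gam].
rewrite -bigcup_itv_pos.
have -> : (fun n => (gamn s n)%:E) = (fun n => \int[mu]_(t in `[(n.+1%:R^-1)%R, (n.+2%:R)%R]) (gam s t)%:E)%E.
  by apply/funext => n; rewrite /gamn /Rintegral fineK //; exact: integrable_fin_num (i n).
apply: (@ge0_nondecreasing_set_cvg_integral _ (measurableTypeR R) R
  (fun n : nat => `[n.+1%:R^-1 : R, n.+2%:R]%classic) (EFin \o gam s) mu).
- apply/nondecreasing_seqP => n; rewrite subsetEset; apply: subset_itv; rewrite bnd_simp ?ler_nat //.
  by rewrite lef_pV2 ?posrE // ler_nat.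
- by move=> n; exact: measurable_itv.
- by move=> n; exact: measurable_int (i n).
- by move=> n t _; rewrite /= lee_fin gam_ge0.
Qed.

Lemma gam_end0 s : 0 < s -> n.+1%:R^-1 `^ s * expR (- n.+1%:R^-1) @[n --> \oo] --> (0 : R).
Proof.
move=> s0.
have h : (n.+1%:R^-1 : R) `^ s @[n --> \oo] --> (0 : R).
  have c : (n.+1%:R^-1 : R) @[n --> \oo] --> (0 : R)^'+.
    move=> A hA; have : \forall n \near \oo, 0 < harmonic n -> A (harmonic n : R) := @cvg_harmonic R _ hA.
    by apply: filterS => n; apply; rewrite /harmonic invr_gt0.
  exact: cvg_comp c (powR_cvg0 s0).
apply: (@squeeze_cvgr _ _ _ _ (fun=> 0) (fun n : nat => n.+1%:R^-1 `^ s)) => //; last exact: cvg_cst.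
apply: nearW => n; rewrite mulr_ge0 ?powR_ge0 ?expR_ge0 //= ler_piMr ?powR_ge0 //.
Qed.

(** With N + 1 > s and t = n + 2 >= 1, t^s <= t^(N+1) and exp(t) >= t^(N+2)/(N+2)!, so the product
    is at most (N+2)!/t. *)
Lemma gam_endy s : n.+2%:R `^ s * expR (- n.+2%:R) @[n --> \oo] --> (0 : R).
Proof.
pose N := Num.truncn s.
have sN : s < N.+1%:R by exact: truncnS_gt.
apply: (@squeeze_cvgr _ _ _ _ (fun=> 0) (fun n : nat => N.+2`!%:R * n.+1%:R^-1)); last 2 first.
- exact: cvg_cst.
- by rewrite -[X in _ --> X](mulr0 N.+2`!%:R); apply: cvgMr; exact: cvg_harmonic.
apply: nearW => n; rewrite mulr_ge0 ?powR_ge0 ?expR_ge0 //= expRN ler_pdivrMr ?expR_gt0 //.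
have h := expR_ge1Dxn N.+1 (ler0n R n.+2).
apply: (@le_trans _ _ (n.+2%:R ^+ N.+1)).
  rewrite -powR_mulrn // ler_powR //; last exact: ltW.
  by rewrite ler1n.
rewrite -mulrA mulrCA ler_pdivlMl // -ler_pdivrMl ?ltr0n ?fact_gt0 //.
apply: le_trans h; rewrite mulrC.
apply: (@le_trans _ _ (n.+2%:R ^+ N.+2 / N.+2`!%:R)); last by rewrite lerDr.
rewrite ler_pM2r ?invr_gt0 ?ltr0n ?fact_gt0 // [leRHS]exprS ler_pM2r ?exprn_gt0 //.
by rewrite ler_nat.
Qed.

Lemma GammaE s : Gamma s = fine (\int[mu]_(t in `]0%R, +oo[) (gam s t)%:E)%E.
Proof. by []. Qed.

Lemma Gamma_rec s : 0 < s -> Gamma (s + 1) = s * Gamma s.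
Proof.
move=> s0; have l1 := @gamn_cvg (s + 1); have l2 := @gamn_cvg s.
have l3 : ((n.+1%:R^-1 `^ s * expR (- n.+1%:R^-1) - n.+2%:R `^ s * expR (- n.+2%:R)) : R)%:E @[n --> \oo] --> 0%E.
  apply: cvg_EFin; first by apply: nearW.
  by rewrite -[X in _ --> X](subr0 (0 : R)); apply: cvgB; [exact: gam_end0|exact: gam_endy].
have l4 := cvgeD (fin_num_adde_defl _ _) (cvgeZl (y := s%:E) _ l2) l3.
have E : (\int[mu]_(t in `]0%R, +oo[) (gam (s + 1) t)%:E = s%:E * \int[mu]_(t in `]0%R, +oo[) (gam s t)%:E)%E.
  rewrite -[RHS]adde0; apply: cvg_unique (l4 _ isT isT) => //.
  rewrite (_ : (fun n => _) = (fun n => (gamn (s + 1) n)%:E)) //.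
  by apply/funext => n; rewrite gamn_rec.
rewrite !GammaE E.
have : (0 <= \int[mu]_(t in `]0%R, +oo[) (gam s t)%:E)%E by apply: integral_ge0 => t _; rewrite lee_fin gam_ge0.
(* If the integral were +oo, so would be its product with s > 0, and [fine] sends both to 0. *)
case: (\int[mu]_(t in _) _)%E => [r| |] //= _.
by rewrite gt0_muley ?lte_fin //= mulr0.
Qed.

Lemma Gamma_lim s l : gamn s n @[n --> \oo] --> l -> Gamma s = l.
Proof.
move=> h; have h' : (gamn s n)%:E @[n --> \oo] --> l%:E by apply: cvg_EFin => //; apply: nearW.
by rewrite GammaE -(cvg_lim _ (@gamn_cvg s)) // (cvg_lim _ h').
Qed.

Lemma Gamma1 : Gamma (1 : R) = 1.
Proof.
apply: Gamma_lim.
have E n : gamn 1 n = expR (- harmonic n) - expR (- n.+2%:R).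
  have a0 : 0 < n.+1%:R^-1 :> R by rewrite invr_gt0.
  have d t : 0 < t -> is_derive t (1 : R) (fun t => - expR (- t)) (gam 1 t).
    move=> t0; apply: is_derive_eq (is_deriveN (is_derive_expRN t)) _.
    by rewrite opprK /gam subrr powRr0 mul1r.
  by have -> : gamn 1 n = _ := FTC_pos a0 (inv_lt_n n) (@continuous_gam 1) d; rewrite opprK addrC.
rewrite (funext E : gamn 1 = _).
rewrite [X in _ --> X](_ : 1 = expR (- 0) - 0); last by rewrite oppr0 expR0 addr0.
apply: cvgB.
  apply: (cvg_comp (fun n => - harmonic n) expR); last exact: continuous_expR.
  by apply: cvgN; exact: cvg_harmonic.
by have := @cvgn_expR R; rewrite -(cvg_shiftn 2); under eq_fun do rewrite addn2.
Qed.

(** An antiderivative of the Gaussian on the whole line, including a neighbourhood of 0; only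
    differences of its values matter. *)
Definition gauss_cdf (x : R) : R := Rintegral mu `]-oo, x] gauss_fun.

Lemma is_derive_gauss_cdf x : is_derive x (1 : R) gauss_cdf (gauss_fun x).
Proof.
have i : mu.-integrable [set` Interval (BInfty R true) (BRight (x + 1))] (EFin \o @gauss_fun R).
  by apply: integrableS integrableT_gauss => //.
have xx : x < x + 1 by rewrite ltrDl.
have [h1 h2] := continuous_FTC1 xx i (ltNyr _) (continuous_gauss_fun (x := x)).
exact: (DeriveDef h1 (etrans (esym (derive1E _ _)) h2)).
Qed.

(** The substitution t = x^2: the function 2 [gauss_cdf] (sqrt t) is an antiderivative of the
    integrand, and the Gaussian integral over the half-line is sqrt(pi)/2. *)
Lemma Gamma_half : Gamma (2^-1 : R) = Num.sqrt pi.
Proof.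
apply: Gamma_lim.
have Fc : continuous gauss_cdf by move=> x; exact: is_derive_continuous (is_derive_gauss_cdf x).
have E n : gamn 2^-1 n = 2 * gauss_integral_proof.integral0_gauss (Num.sqrt n.+2%:R)
   - 2 * (gauss_cdf (Num.sqrt (harmonic n)) - gauss_cdf 0).
  have a0 : 0 < n.+1%:R^-1 :> R by rewrite invr_gt0.
  have d t : 0 < t -> is_derive t (1 : R) (fun t => 2 * gauss_cdf (Num.sqrt t)) (gam 2^-1 t).
    move=> t0; have h := @is_derive1_comp _ gauss_cdf Num.sqrt t _ _ (is_derive_gauss_cdf _) (is_derive1_sqrt t0).
    apply: is_derive_eq (is_deriveM (is_derive_cst (2 : R) t (1 : R)) h) _.
    rewrite scaler0 addr0 /gam /gauss_fun sqr_sqrtr ?ltW // /GRing.scale /=.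
    rewrite (_ : 2^-1 - 1 = - 2^-1 :> R); last by field.
    rewrite powRN powR12_sqrt ?ltW //; field.
    by rewrite gt_eqF // sqrtr_gt0.
  have -> : gamn 2^-1 n = _ := FTC_pos a0 (inv_lt_n n) (@continuous_gam 2^-1) d.
  have -> : gauss_integral_proof.integral0_gauss (Num.sqrt n.+2%:R) = gauss_cdf (Num.sqrt n.+2%:R) - gauss_cdf 0.
    apply: FTC_Rintegral; [by rewrite sqrtr_gt0|exact: continuous_gauss_fun|exact: Fc|].
    by move=> x _; exact: is_derive_gauss_cdf.
  by rewrite /harmonic; ring.
rewrite (funext E : gamn 2^-1 = _).
have -> : Num.sqrt pi = 2 * (Num.sqrt pi / 2) - 2 * (gauss_cdf (Num.sqrt 0) - gauss_cdf 0).
  by rewrite sqrtr0 subrr mulr0 subr0 mulrC divfK.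
apply: cvgB; apply: cvgMr.
  have : Num.sqrt (@gauss_integral_proof.integral0_gauss R x ^+ 2) @[x --> +oo] --> Num.sqrt (pi / 4 : R).
    by apply: (cvg_comp _ Num.sqrt (@gauss_integral_proof.cvg_integral0_gauss_sqr R)); exact: sqrt_continuous.
  rewrite sqrtrM ?pi_ge0// sqrtrV// (_ : 4 = 2 ^+ 2 :> R); last by rewrite expr2 -natrM.
  rewrite sqrtr_sqr ger0_norm//.
  under eq_fun do rewrite sqrtr_sqr ger0_norm ?gauss_integral_proof.integral0_gauss_ge0 //.
  apply: cvg_comp; apply/cvgryPge => A; near=> n.
  apply: (le_trans (ler_norm A)); rewrite -sqrtr_sqr ler_sqrt //.
  apply: (@le_trans _ _ n%:R); last by rewrite ler_nat (leq_trans (leqnSn n)).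
  by near: n; exact: nbhs_infty_ger.
apply: cvgB; last exact: cvg_cst.
apply: (cvg_comp (fun n => Num.sqrt (harmonic n)) gauss_cdf); last exact: Fc.
apply: (cvg_comp (@harmonic R) Num.sqrt); first exact: cvg_harmonic.
exact: sqrt_continuous.
Unshelve. all: by end_near. Qed.

End GammaFunction.

(** * The area of the sphere and the constant of the theorem *)

Section SphereConstant.
Variable R : realType.

Lemma Gamma_half_gt0 k : 0 < Gamma (k.+1%:R / 2 : R).
Proof.
suff : 0 < Gamma (k.+1%:R / 2 : R) /\ 0 < Gamma (k.+2%:R / 2 : R) by case.
elim: k => [|k [IH1 IH2]].
  by rewrite mul1r Gamma_half divff // Gamma1 sqrtr_gt0 pi_gt0.
split; first exact: IH2.
rewrite (_ : k.+3%:R / 2 = k.+1%:R / 2 + 1); last by rewrite -[k.+3]addn2 natrD; field.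
have k0 : 0 < k.+1%:R / 2 :> R by rewrite divr_gt0.
by rewrite (Gamma_rec k0) (mulr_gt0 k0 IH1).
Qed.

Lemma bmass1_dim0 : bmass R 0 1 = 1.
Proof.
by rewrite /bmass /rint /= /wt /posp /nsq big_ord0 subr0 expr1; apply/max_idPr.
Qed.

(** Induction in steps of two dimensions: the mass is multiplied by 2 pi/(m+4) by [wallis_mul], and
    Gamma by m/2 + 2. *)
Lemma bmass1_value m : bmass R m 1 * Gamma (m%:R / 2 + 2 : R) = pi `^ (m%:R / 2).
Proof.
have G2 (s : R) : 0 < s -> Gamma (s + 2) = (s + 1) * s * Gamma s.
  move=> s0; rewrite (_ : s + 2 = s + 1 + 1); last by rewrite -addrA.
  by rewrite !Gamma_rec ?mulrA // addr_gt0.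
suff : bmass R m 1 * Gamma (m%:R / 2 + 2 : R) = pi `^ (m%:R / 2) /\
       bmass R m.+1 1 * Gamma (m.+1%:R / 2 + 2 : R) = pi `^ (m.+1%:R / 2) by case.
elim: m => [|m [IH1 IH2]]; split.
- rewrite bmass1_dim0 mul0r add0r powRr0 mul1r (_ : 2 = 1 + 1 :> R) // Gamma_rec // Gamma1 mulr1 //.
- rewrite bmass1_wallis bmass1_dim0 mulr1.
  have w2 : wallis R 2 = 4 / 3.
    have := wallis_rec R 0; rewrite wallis0 => h; apply: (mulfI (_ : 3 != 0 :> R)); first by [].
    by rewrite h; field.
  by rewrite w2 div1r G2 ?invr_gt0 // Gamma_half powR12_sqrt ?pi_ge0 //; field.
- exact: IH2.
have -> : m.+2%:R / 2 + 2 = (m%:R / 2 + 2) + 1 :> R by rewrite -[m.+2]addn2 natrD; field.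
rewrite Gamma_rec; last by rewrite ltr_wpDl // divr_ge0.
have -> : m.+2%:R / 2 = m%:R / 2 + 1 :> R by rewrite -[m.+2]addn2 natrD; field.
rewrite powRD ?(lt0r_neq0 (pi_gt0 R)) ?implybT // powRr1 ?pi_ge0 // -IH1 !bmass1_wallis.
have := wallis_mul R m.+2; rewrite (_ : m.+4%:R = m%:R + 4 :> R); last by rewrite -[m.+4]addn4 natrD.
move: (wallis R _) (wallis R _) (bmass R m 1) (Gamma _) (pi : R) => a b c d e h.
have -> : e = (m%:R + 4) * (b * a) / 2 by rewrite h; field.
by field.
Qed.

Lemma sphere_area m : (0 < m)%N ->
  m%:R * bmass R m 0 = 2 * pi `^ (m%:R / 2) / Gamma (m%:R / 2).
Proof.
case: m => // m _; have G0 := Gamma_half_gt0 m.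
rewrite -bmass1_value; set s : R := m.+1%:R / 2.
have s0 : 0 < s by rewrite divr_gt0.
rewrite (_ : s + 2 = s + 1 + 1); last by rewrite -addrA.
rewrite !Gamma_rec //; last by rewrite addr_gt0.
have e : m.+1%:R = 2 * s by rewrite /s mulrC divfK.
have := bmass_rec R m.+1 0; rewrite e => h.
have -> : bmass R m.+1 0 = (s + 1) * bmass R m.+1 1.
  by apply: (mulfI (_ : 2 != 0 :> R)); [by []|move: h; rewrite !mulr1 => ->; ring].
by field; rewrite gt_eqF.
Qed.

(** The number of factors in [rgamma] is one admissible choice; by the functional equation every
    other gives the same value. *)
Lemma rgamma_shift (z : R) K1 K2 : 0 < z + K1%:R -> 0 < z + K2%:R ->
  (\prod_(k < K1) (z + k%:R)) / Gamma (z + K1%:R) = (\prod_(k < K2) (z + k%:R)) / Gamma (z + K2%:R).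
Proof.
wlog le12 : K1 K2 / (K1 <= K2)%N.
  by move=> H; have [/H//|/ltnW/H h] := leqP K1 K2; move=> h1 h2; rewrite h.
rewrite -(subnKC le12) => z1 _; elim: (K2 - K1)%N => [|d IH]; first by rewrite addn0.
rewrite addnS big_ord_recr /= IH.
have h : 0 < z + (K1 + d)%:R by rewrite natrD addrA ltr_wpDr.
rewrite (_ : z + (K1 + d).+1%:R = z + (K1 + d)%:R + 1); last by rewrite -[(K1 + d).+1]addn1 natrD addrA.
rewrite (Gamma_rec h) [_ * Gamma _]mulrC -mulf_div divff; last by rewrite gt_eqF.
exact/esym/mulr1.
Qed.

Lemma rgamma_sub (s : R) n : 0 < s -> rgamma (s - n%:R) = (\prod_(i < n) (s - i.+1%:R)) / Gamma s.
Proof.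
move=> s0; have := rgamma_shift (z := s - n%:R) (K1 := (Num.truncn `|s - n%:R|).+1) (K2 := n).
rewrite subrK => h; have K0 : 0 < s - n%:R + (Num.truncn `|s - n%:R|).+1%:R.
  have := truncnS_gt `|s - n%:R|; have := ler_norm (- (s - n%:R)); rewrite normrN.
  by move=> h1 h2; rewrite -ltrBlDl sub0r (le_lt_trans h1).
rewrite /rgamma (h K0 s0).
congr (_ / _); rewrite (reindex_inj rev_ord_inj) /=; apply: eq_bigr => i _.
by rewrite (natrB _ (ltn_ord i)) addrA subrK.
Qed.

(** When m - 2n is one of 0, -2, -4, ..., the number m/2 is among 1, ..., n and the product has a
    zero factor, in accordance with the poles of Gamma. *)
Lemma sphere_constE m n : (0 < m)%N ->
  sphere_const R (m%:Z - 2 * n%:Z) = pi ^- n * (m%:R * bmass R m 0) * \prod_(i < n) (m%:R / 2 - i.+1%:R).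
Proof.
move=> m0; have s0 : 0 < m%:R / 2 :> R by rewrite divr_gt0 // ltr0n.
rewrite /sphere_const (_ : (m%:Z - 2 * n%:Z)%:~R / 2 = m%:R / 2 - n%:R :> R); last first.
  by rewrite rmorphB rmorphM /=; field.
have -> : pi `^ (m%:R / 2 - n%:R) = pi `^ (m%:R / 2) * pi ^- n :> R.
  by rewrite powRD ?(lt0r_neq0 (pi_gt0 R)) ?implybT // powR_invn ?pi_ge0.
rewrite (rgamma_sub n s0) sphere_area //.
by move: (\prod_(i < n) _) (_ `^ _) (_ ^- n) (Gamma _)^-1 => a b c d; ring.
Qed.

End SphereConstant.

(** * Blocks of two generators and their signs *)

Section GrassmannPairs.
Variable n : nat.
Local Open Scope set_scope.
Local Open Scope bool_scope.

Lemma half_ltn (a : 'I_(n.*2)) : (a./2 < n)%N.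
Proof. by rewrite ltn_half_double. Qed.

Definition pr (a : 'I_(n.*2)) : 'I_n := Ordinal (half_ltn a).

Lemma lo_ltn (p : 'I_n) : (p.*2 < n.*2)%N. Proof. by rewrite ltn_double. Qed.
Lemma hi_ltn (p : 'I_n) : (p.*2.+1 < n.*2)%N. Proof. by rewrite ltn_Sdouble. Qed.

Definition lo (p : 'I_n) : 'I_(n.*2) := Ordinal (lo_ltn p).
Definition hi (p : 'I_n) : 'I_(n.*2) := Ordinal (hi_ltn p).

Lemma pr_lo p : pr (lo p) = p.
Proof. by apply/val_inj; rewrite /= doubleK. Qed.

Lemma pr_hi p : pr (hi p) = p.
Proof. by apply/val_inj; rewrite /= uphalf_double. Qed.

Lemma lo_neq_hi p : lo p != hi p.
Proof. by rewrite -val_eqE /= neq_ltn ltnSn. Qed.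

Lemma pr_eq a p : (pr a == p) = (a == lo p) || (a == hi p).
Proof.
rewrite -!val_eqE /=; apply/eqP/orP => [<-|[/eqP ->|/eqP ->]]; last 2 first.
- by rewrite doubleK.
- by rewrite /= uphalf_double.
have := odd_double_half a; case: odd => e; [right|left]; first by rewrite -{1}e add1n.
by rewrite -{1}e add0n.
Qed.

(* Unions of blocks {x`_{2p-1}, x`_{2p}}: these index the monomials that occur
   in the powers of [xsq], and all signs attached to them are +1. *)
Definition pairs (K : {set 'I_n}) : {set 'I_(n.*2)} := [set a | pr a \in K].

Lemma in_pairs K a : (a \in pairs K) = (pr a \in K).
Proof. by rewrite inE. Qed.

Lemma pairsU K L : pairs (K :|: L) = pairs K :|: pairs L.
Proof. by apply/setP => a; rewrite !inE. Qed.

Lemma pairsC K : pairs (~: K) = ~: pairs K.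
Proof. by apply/setP => a; rewrite !inE. Qed.

Lemma pairs1 p : pairs [set p] = [set lo p; hi p].
Proof. by apply/setP => a; rewrite !inE pr_eq. Qed.

Lemma pairs0 : pairs finset.set0 = finset.set0.
Proof. by apply/setP => a; rewrite !inE. Qed.

Lemma disjoint_pairs K L : [disjoint pairs K & pairs L] = [disjoint K & L].
Proof.
rewrite !finset.disjoints_subset -pairsC; apply/fintype.subsetP/fintype.subsetP => H a.
  by move=> aK; have := H (lo a); rewrite !in_pairs pr_lo; exact.
by rewrite !in_pairs; exact: H.
Qed.

Lemma big_pairs (T : Type) (idx : T) (op : Monoid.com_law idx) (F : 'I_(n.*2) -> T) :
  \big[op/idx]_a F a = \big[op/idx]_p op (F (lo p)) (F (hi p)).
Proof.
rewrite (partition_big pr predT) //=; apply: eq_bigr => p _.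
rewrite (bigD1 (lo p)) /= ?pr_lo // (bigD1 (hi p)) /= ?pr_hi ?eqxx 1?eq_sym ?lo_neq_hi //.
rewrite big1 ?Monoid.mulm1 // => a; rewrite pr_eq => /andP[/andP[/orP[/eqP ->|/eqP ->]]];
  by rewrite eqxx.
Qed.

Lemma sum_adjacent (V : nmodType) (F : 'I_(n.*2) -> 'I_(n.*2) -> V) :
  \sum_(i < n.*2) \sum_(k < n.*2 | ~~ odd i && (k == i.+1 :> nat)) F i k = \sum_p F (lo p) (hi p).
Proof.
rewrite big_pairs; apply: eq_bigr => p _ /=.
rewrite [X in _ + X]big_pred0 => [|k]; last by rewrite odd_double.
rewrite addr0 (bigD1 (hi p)) /= ?odd_double ?eqxx // big1 ?addr0 // => k.
by rewrite (_ : (k != hi p) = ((k : nat) != p.*2.+1)) // => /andP[/andP[_ ->]].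
Qed.

(** Double counting: a set of size j with a point outside it amounts to a set of size j + 1 with a
    point inside it. *)
Lemma sum_setU1 (V : nmodType) (j : nat) (F : 'I_n -> {set 'I_n} -> V) :
  \sum_(K : {set 'I_n} | #|K| == j) \sum_(p | p \notin K) F p (p |: K) =
  \sum_(L : {set 'I_n} | #|L| == j.+1) \sum_(p in L) F p L.
Proof.
rewrite (exchange_big_dep predT) //= [RHS](exchange_big_dep predT) //=; apply: eq_bigr => p _.
rewrite [RHS](reindex_onto (fun K => p |: K) (fun L => L :\ p)) /=; last first.
  by move=> L /andP[_ pL]; rewrite finset.setD1K.
apply: eq_bigl => K; rewrite finset.setU11 andbT finset.cardsU1.
have [pK|pK] := boolP (p \in K); rewrite /= ?andbF ?andbT.
  apply/esym/negbTE; rewrite negb_and; apply/orP; right; apply/eqP => /setP/(_ p).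
  by rewrite !inE eqxx pK.
by rewrite add1n eqSS finset.setU1K ?eqxx ?andbT.
Qed.

Lemma even_card_pairs (K : {set 'I_n}) (P : pred 'I_(n.*2)) :
  (forall p, p \in K -> P (lo p) = P (hi p)) -> ~~ odd #|[set a in pairs K | P a]|.
Proof.
move=> HP; rewrite -sum1_card big_mkcond big_pairs /=.
apply: (big_ind (fun k => ~~ odd k)) => // [a b|p _]; first by rewrite oddD; do 2!case: odd.
by rewrite !inE pr_lo pr_hi; case: (boolP (p \in K)) => //= /HP ->; case: ifP.
Qed.

Lemma lo_lt_hi_lt p (y : 'I_(n.*2)) : pr y != p -> (lo p < y)%N = (hi p < y)%N.
Proof.
move=> yp; rewrite [LHS]leq_eqVlt; case: eqP => //= e; case/negP: yp.
by rewrite -val_eqE /= -e /= uphalf_double.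
Qed.

Lemma notin_pr (K : {set 'I_n}) y p : pr y \notin K -> p \in K -> pr y != p.
Proof. by move=> yK pK; apply: contraNneq yK => ->. Qed.

Lemma even_below_pairs (K : {set 'I_n}) (y : 'I_(n.*2)) : pr y \notin K ->
  ~~ odd #|[set a in pairs K | (a < y)%N]|.
Proof. by move=> yK; apply: even_card_pairs => p pK; exact/lo_lt_hi_lt/(notin_pr yK). Qed.

Lemma even_above_pairs (K : {set 'I_n}) (y : 'I_(n.*2)) : pr y \notin K ->
  ~~ odd #|[set a in pairs K | (y < a)%N]|.
Proof.
move=> yK; apply: even_card_pairs => p pK; have yp := notin_pr yK pK.
rewrite [RHS]ltnS [RHS]leq_eqVlt; case: eqP => //= e; case/negP: yp.
by rewrite pr_eq -val_eqE /= e eqxx.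
Qed.

(** A block not containing y lies entirely above or entirely below y, so each y in B contributes an
    even number of inversions. *)
Lemma gsign_pairs (R : realType) (K : {set 'I_n}) (B : {set 'I_(n.*2)}) :
  [disjoint pairs K & B] -> gsign R (pairs K) B = 1.
Proof.
move=> dKB; rewrite /gsign -signr_odd (_ : odd _ = false) ?expr0 //; apply/negbTE.
rewrite -sum1dep_card big_mkcond /= -(pair_bigA _ (fun x y : 'I_(n.*2) =>
   if (x \in pairs K) && (y \in B) && (y < x)%N then 1 else 0)%N) /=.
rewrite exchange_big /=.
apply: (big_ind (fun k => ~~ odd k)) => // [a b|y _]; first by rewrite oddD; do 2!case: odd.
have [yB|yB] := boolP (y \in B); last first.
  by rewrite big1 // => x _; rewrite andbF.
have yK : pr y \notin K by rewrite -in_pairs; apply: contraL yB => yK; rewrite (disjointFr dKB).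
have := even_above_pairs yK; rewrite -sum1_card big_mkcond.
by under eq_bigr do rewrite inE; under [in X in _ -> X]eq_bigr do rewrite andbT.
Qed.

End GrassmannPairs.

(** * Powers of [xsq], the Berezin integral and the super Laplacian on pair monomials *)

Section GrassmannExpansion.
Variables (R : realType) (n : nat).
Local Open Scope set_scope.
Local Open Scope bool_scope.

Lemma xsqE (S : {set 'I_(n.*2)}) : @xsq R n S = \sum_p (S == pairs [set p])%:R.
Proof.
by rewrite /xsq (sum_adjacent (fun i k => (S == [set i; k])%:R)); apply: eq_bigr => p _; rewrite pairs1.
Qed.

Lemma sum_delta (J I : finType) (P : pred I) (A : I -> J) (c : I -> R[i]) (G : J -> R[i]) :
  \sum_j (\sum_(k | P k) c k * (j == A k)%:R) * G j = \sum_(k | P k) c k * G (A k).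
Proof.
under eq_bigr do rewrite mulr_suml.
rewrite exchange_big /=; apply: eq_bigr => k _.
rewrite (bigD1 (A k)) //= eqxx mulr1 big1 ?addr0 // => j /negbTE ->.
by rewrite mulr0 mul0r.
Qed.

(** A left factor built from pair monomials makes every sign +1, so the product only unites disjoint
    index sets. *)
Lemma gmul_pairs (a b : grass R n) (I : finType) (P : pred I) (K : I -> {set 'I_n}) (c : I -> R[i])
   (S : {set 'I_(n.*2)}) : (forall A, a A = \sum_(k | P k) c k * (A == pairs (K k))%:R) ->
  gmul a b S = \sum_(k | P k) c k *
    \sum_(B : {set 'I_(n.*2)} | [disjoint pairs (K k) & B] && (pairs (K k) :|: B == S)) b B.
Proof.
move=> aE; transitivity (\sum_A a A *
  \sum_(B : {set 'I_(n.*2)} | [disjoint A & B] && (A :|: B == S)) gsign R A B * b B).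
  by apply: eq_bigr => A _; rewrite mulr_sumr; apply: eq_bigr => B _; rewrite [RHS]mulrCA mulrA.
under eq_bigr do rewrite aE; rewrite sum_delta; apply: eq_bigr => k _; congr (_ * _).
by apply: eq_bigr => B /andP[d _]; rewrite gsign_pairs ?mul1r.
Qed.

(** A set of j + 1 pairs arises once from each of its elements, which turns j! into (j + 1)!. *)
Lemma gexp_xsq j (S : {set 'I_(n.*2)}) :
  gexp (@xsq R n) j S = \sum_(K : {set 'I_n} | #|K| == j) j`!%:R * (S == pairs K)%:R.
Proof.
elim: j S => [|j IH] S.
  rewrite (big_pred1 finset.set0) ?pairs0 ?mul1r // => K; exact: finset.cards_eq0.
rewrite /gexp iterS -/(gexp _ j).
rewrite (@gmul_pairs _ _ 'I_n predT (fun p => [set p]) (fun=> 1)); last first.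
  by move=> A; rewrite xsqE; apply: eq_bigr => p _; rewrite mul1r.
transitivity (\sum_(K : {set 'I_n} | #|K| == j) \sum_(p | p \notin K) j`!%:R * (S == pairs (p |: K))%:R : R[i]).
  rewrite [RHS](exchange_big_dep predT) //=; apply: eq_bigr => p _; rewrite mul1r.
  under eq_bigr do rewrite IH.
  rewrite (exchange_big_dep (fun K : {set 'I_n} => #|K| == j)) //= [RHS]big_mkcondr /=; apply: eq_bigr => K Kj.
  rewrite big_mkcond (bigD1 (pairs K)) //= big1 ?addr0 => [|B /negbTE ->]; last by rewrite mulr0 if_same.
  rewrite disjoint_pairs -pairsU eqxx mulr1 disjoints1 eq_sym.
  by rewrite Kj andbT; case: (p \notin K) => //=; case: (S == _); rewrite ?mulr1 ?mulr0.
rewrite (sum_setU1 j (fun p L => j`!%:R * (S == pairs L)%:R : R[i])); apply: eq_bigr => L /eqP Lj.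
by rewrite sumr_const Lj factS natrM -mulrA [RHS]mulr_natl.
Qed.

(** The factorials cancel, and the top coefficient pairs each set of blocks with its complement. *)
Lemma berezin_pairs j (b : grass R n) :
  berezin (gmul (gscale (((j`!)%:R : R)^-1)%:C%C (gexp (@xsq R n) j)) b) =
  ((pi : R) ^- n)%:C%C * \sum_(C : {set 'I_n} | #|C| == j) b (pairs (~: C)).
Proof.
rewrite /berezin; congr (_ * _).
rewrite (@gmul_pairs _ _ _ (fun C : {set 'I_n} => #|C| == j) id (fun=> 1)); last first.
  move=> A; rewrite /gscale gexp_xsq mulr_sumr; apply: eq_bigr => K _.
  rewrite mulrA; congr (_ * _).
  rewrite -(rmorph_nat (real_complex R)) -rmorphM /= mulVf ?rmorph1 //.
apply: eq_bigr => K _; rewrite mul1r (big_pred1 (pairs (~: K))) // => B.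
rewrite pairsC finset.disjoints_subset; apply/andP/eqP => [[/fintype.subsetP h1 /eqP/setP h2]|->]; last first.
  by rewrite finset.setCK finset.setUCr.
by apply/setP => a; move: (h1 a) (h2 a); rewrite !inE; case: (a \in B); case: (pr a \in K) => //= ->.
Qed.

(** All other generators are passed in even number; the sign comes from [lo p] standing before
    [hi p]. It cancels the minus sign of the fermionic part of [slap]. *)
Lemma fder_pairs m (f : superfun R m n) (K : {set 'I_n}) p x :
  fder (lo p) (fder (hi p) f) (pairs K) x = if p \in K then 0 else - f (pairs (p |: K)) x.
Proof.
rewrite /fder in_pairs pr_lo; case: ifP => // /negbT pK.
have evK : ~~ odd #|[set a in pairs K | (a < lo p)%N]| by apply: even_below_pairs; rewrite pr_lo.
have evK' : ~~ odd #|[set a in pairs K | (a < hi p)%N]| by apply: even_below_pairs; rewrite pr_hi.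
rewrite -signr_odd (negbTE evK) mul1r in_setU1 in_pairs pr_hi (negbTE pK) orbF eq_sym (negbTE (lo_neq_hi p)).
have -> : [set a in lo p |: pairs K | (a < hi p)%N] = lo p |: [set a in pairs K | (a < hi p)%N].
  apply/setP => a; rewrite !inE; case: eqP => //= ->.
  by rewrite ltnSn.
rewrite finset.cardsU1 inE in_pairs pr_lo (negbTE pK) /= exprS -signr_odd (negbTE evK') mulr1 mulN1r.
by rewrite pairsU pairs1 finset.setUA [hi p |: _]finset.setUC.
Qed.

Lemma slap_pairs m (f : superfun R m n) (K : {set 'I_n}) x :
  slap f (pairs K) x = blap (f (pairs K)) x + 4 * \sum_(p | p \notin K) f (pairs (p |: K)) x.
Proof.
rewrite /slap (sum_adjacent (fun i k => fder i (fder k f) (pairs K) x)) -mulrN -sumrN; congr (_ + _ * _).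
rewrite [RHS]big_mkcond; apply: eq_bigr => p _; rewrite fder_pairs.
by case: ifP => _; rewrite ?oppr0 ?opprK.
Qed.

End GrassmannExpansion.

(** * Closed form of the Pizzetti coefficients and the alternating sum *)

Section FiniteSums.
Variable R : realType.

Lemma sum_triangle (V : zmodType) (T : nat -> nat -> V) n :
  \sum_(j < n.+1) \sum_(l < j.+1) T (j - l)%N l = \sum_(q < n.+1) \sum_(l < (n - q).+1) T q l.
Proof.
elim: n => [|n IH]; first by rewrite !big_ord1.
rewrite big_ord_recr /= IH [RHS]big_ord_recr /= subnn big_ord1.
under [in RHS]eq_bigr => q _ do rewrite subSn -1?ltnS // big_ord_recr /=.
rewrite big_split /= -addrA; congr (_ + _).
rewrite (reindex_inj rev_ord_inj) /= big_ord_recr /= subnn subn0; congr (_ + _).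
apply: eq_bigr => q _; have qn : (q <= n)%N by rewrite -ltnS.
by rewrite [(n.+2 - q.+1)%N]subSS (subKn (leqW qn)) subSn.
Qed.

Lemma sum_alt_bin k : \sum_(l < k.+1) (-1) ^+ l * 'C(k, l)%:R = (k == 0%N)%:R :> R.
Proof.
have := exprBn_comm k (commr1 (1 : R)); rewrite subrr expr0n => ->.
by apply: eq_bigr => l _; rewrite !expr1n !mulr1 mulr_natr.
Qed.

(** The recursion of [pizz] raises N at each step, and [bmass_rec] brings the mass back to the
    initial N. *)
Lemma pizz_closed m N l :
  4 ^+ l * l`!%:R * (\prod_(i < l) (m%:R / 2 + N%:R + i.+1%:R)) * pizz R m N l = bmass R m N.
Proof.
elim: l N => [|l IH] N; first by rewrite big_ord0 !mulr1 !mul1r.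
have e : \prod_(i < l.+1) (m%:R / 2 + N%:R + i.+1%:R) =
  (m%:R / 2 + N%:R + 1) * \prod_(i < l) (m%:R / 2 + N.+1%:R + i.+1%:R) :> R.
  rewrite big_ord_recl; congr (_ * _); apply: eq_bigr => i _.
  by rewrite (_ : (lift ord0 i : nat) = i.+1) // -[N.+1]addn1 -[i.+2]addn1 !natrD; ring.
have N0 : N.+1%:R != 0 :> R by rewrite pnatr_eq0.
have l0 : l.+1%:R != 0 :> R by rewrite pnatr_eq0.
have := bmass_rec R m N; rewrite -(IH N.+1) e /= factS natrM exprS => h.
apply: (mulfI (_ : 2 * N.+1%:R != 0)); first by rewrite mulf_neq0.
rewrite h; move: (\prod_(i < l) _) (pizz _ _ _ _) (4 ^+ l) (l`!%:R) => P z a b.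
have -> : N%:R = N.+1%:R - 1 :> R by rewrite -[N.+1]addn1 natrD addrK.
by move: (N.+1%:R) (l.+1%:R) N0 l0 => d f d0 f0; field; rewrite d0 f0.
Qed.

(** The first l factors of the product cancel the denominator of [pizz], and the rest depends on q
    alone; the powers of 4 and the factorials leave a signed binomial coefficient as the only
    dependence on l. *)
Lemma pizzetti_coef m n q l (v : R) : let s := m%:R / 2 in
  (\prod_(i < (q + l).+1) (l%:R + s - i%:R)) * pizz R m 0 l * ((-4) ^+ l * ((n - q) ^_ l)%:R * v) =
  bmass R m 0 * (\prod_(i < q.+1) (s - i%:R)) * v * ((-1) ^+ l * 'C(n - q, l)%:R).
Proof.
move=> s; rewrite -(pizz_closed m 0 l) addr0 -bin_ffact natrM.
have -> : \prod_(i < (q + l).+1) (l%:R + s - i%:R) =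
  (\prod_(i < l) (s + i.+1%:R)) * \prod_(i < q.+1) (s - i%:R).
  rewrite -addSn addnC big_split_ord /=; congr (_ * _).
    rewrite (reindex_inj rev_ord_inj) /=; apply: eq_bigr => i _.
    by rewrite (natrB _ (ltn_ord i)); ring.
  by apply: eq_bigr => i _; rewrite natrD; ring.
rewrite -mulN1r exprMn.
by rewrite -/s; move: (4 ^+ l) ((-1) ^+ l) => a b; ring.
Qed.

End FiniteSums.

(** * Chains of Laplacians and the sum over j *)

Section LaplaceChains.
Variables (R : realType) (m n : nat).
Implicit Types (U : 'rV[R]_m -> R) (x : 'rV[R]_m) (O : set 'rV[R]_m).
Notation pd i f := ('D_('e_i) f).

Lemma differentiable_line U x v : differentiable U x ->
  is_derive x v U (\sum_(i < m) v 0 i * pd i U x).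
Proof.
move=> dU; apply: DeriveDef; first exact: diff_derivable.
rewrite deriveE // {1}(row_sum_delta v) linear_sum; apply: eq_bigr => i _.
by rewrite linearZ /= deriveE.
Qed.

Lemma C2_on_Ck O U : C2_on O U -> Ck 2 O U.
Proof.
move=> [h1 h2 h3]; split=> [x Ox|]; first exact: differentiable_continuous (h1 x Ox).
split=> [x v Ox|i]; first exact: differentiable_line (h1 x Ox).
split=> [x Ox|]; first exact: differentiable_continuous (h2 i x Ox).
split=> [x v Ox|j]; first exact: differentiable_line (h2 i x Ox).
by split=> // x Ox; exact: h3.
Qed.

Lemma lap_sum O (I : Type) (r : seq I) (P : pred I) (F : I -> 'rV[R]_m -> R) x : open O ->
  (forall i, P i -> Ck 2 O (F i)) -> O x ->
  lap (fun x => \sum_(i <- r | P i) F i x) x = \sum_(i <- r | P i) lap (F i) x.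
Proof.
move=> oO Fk Ox; rewrite /lap exchange_big /=; apply: eq_bigr => j _.
rewrite (pd_ext j oO (g := fun x => \sum_(i <- r | P i) pd j (F i) x) _ Ox).
  by rewrite (pd_sum (q := 0) r j oO _ Ox) // => i Pi; exact: Ck_pd (Fk i Pi).
by move=> y Oy; rewrite (pd_sum (q := 0) r j oO _ Oy) // => i Pi; exact: CkW (Fk i Pi).
Qed.

Lemma lapZ O (c : R) U x : open O -> Ck 2 O U -> O x ->
  lap (fun x => c * U x) x = c * lap U x.
Proof.
move=> oO Uk Ox; rewrite /lap mulr_sumr; apply: eq_bigr => j _.
rewrite (pd_ext j oO (g := fun x => c * pd j U x) _ Ox).
  exact: pdZ oO (Ck_pd j Uk) Ox.
by move=> y Oy; exact: pdZ oO (CkW Uk) Oy.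
Qed.

Lemma eshiftZ O (a c : R) U x : open O -> Ck 1 O U -> O x ->
  eshift a (fun x => c * U x) x = c * eshift a U x.
Proof.
move=> oO Uk Ox; rewrite /eshift (_ : euler (fun x => c * U x) x = c * euler U x); first by ring.
rewrite /euler mulr_sumr; apply: eq_bigr => i _.
by rewrite (pdZ c i oO Uk Ox) mulrCA.
Qed.

Lemma radZ O s j (c : R) U x : open O -> Ck j O U -> O x ->
  rad s j (fun x => c * U x) x = c * rad s j U x.
Proof.
move=> oO; elim: j x => [|j IH] x Uk Ox //=.
rewrite (eshift_ext _ oO (V := fun x => c * rad s j U x) _ Ox) => [|y Oy]; last exact: IH (CkW Uk) Oy.
by rewrite (eshiftZ _ _ oO _ Ox) //; exact: Ck_rad.
Qed.

Lemma polyh_ext p O U V : open O -> (forall x, O x -> U x = V x) -> polyh p O U -> polyh p O V.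
Proof.
move=> oO; elim: p U V => [|p IH] U V UV; first by move=> U0 x Ox; rewrite -UV // U0.
move=> [Uk Up]; split; first exact: (Ck_ext oO UV Uk).
by apply: IH Up => x Ox; exact: lap_ext Ox.
Qed.

Lemma polyhZ p O c U : open O -> polyh p O U -> polyh p O (fun x => c * U x).
Proof.
move=> oO; elim: p U => [|p IH] U; first by move=> U0 x Ox; rewrite U0 // mulr0.
move=> [Uk Up]; split; first exact: CkZ.
by apply: polyh_ext (IH _ Up) => // x Ox; rewrite (lapZ c oO Uk Ox).
Qed.

Lemma polyh_sum p O (I : Type) (r : seq I) (P : pred I) (F : I -> 'rV[R]_m -> R) : open O ->
  (forall i, P i -> polyh p O (F i)) -> polyh p O (fun x => \sum_(i <- r | P i) F i x).
Proof.
move=> oO; elim: p F => [|p IH] F Fp; first by move=> x Ox; apply: big1 => i /Fp; exact.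
split; first by apply: Ck_sum => // i /Fp [].
apply: polyh_ext (IH (fun i => lap (F i)) _) => // [x Ox|i /Fp [_ //]].
by rewrite (lap_sum r oO _ Ox) // => i /Fp [].
Qed.

Variables (O : set 'rV[R]_m) (G : {set 'I_n} -> 'rV[R]_m -> R).
Hypothesis oO : open O.
Hypothesis Gk : forall C, Ck 2 O (G C).
Hypothesis lapG : forall C x, O x -> lap (G C) x = - 4 * \sum_(p in C) G (finset.setD C (finset.set1 p)) x.

(* When [G C] is the coefficient of h on the pairs outside C, [level j] is what
   the j-th term of the supersphere integral depends on. *)
Definition level j x : R := \sum_(C : {set 'I_n} | #|C| == j) G C x.

(** A set of j pairs is obtained by deleting one pair from exactly n - j sets of j + 1 pairs. *)
Lemma lap_levelS j x : O x -> lap (level j.+1) x = - 4 * (n - j)%:R * level j x.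
Proof.
move=> Ox; rewrite (lap_sum _ oO _ Ox) //.
under eq_bigr => C _ do rewrite lapG //.
rewrite -mulr_sumr -mulrA; congr (_ * _).
rewrite -(sum_setU1 j (fun p L => G (finset.setD L (finset.set1 p)) x)) /level mulr_sumr.
apply: eq_bigr => K /eqP Kj.
rewrite (eq_bigr (fun=> G K x)) => [|p pK]; last by rewrite finset.setU1K.
rewrite sumr_const [RHS]mulr_natl; congr (_ *+ _).
rewrite (_ : (n - j)%N = #|finset.setC K|); last first.
  by have := finset.cardsC K; rewrite card_ord Kj; lia.
by apply: eq_card => p; rewrite !inE.
Qed.

(** Each Laplacian removes one pair, and the component of the empty set is harmonic. *)
Lemma polyh_component (C : {set 'I_n}) : polyh #|C|.+1 O (G C).
Proof.
move: {2}#|C| (erefl #|C|) => k; elim: k C => [|k IH] C cardC; rewrite cardC; (split; first exact: Gk).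
  by move=> x Ox; rewrite lapG // (finset.cards0_eq cardC) finset.big_set0 mulr0.
apply: polyh_ext (polyhZ (- 4) oO (polyh_sum (index_enum _) (P := mem C)
  (F := fun p => G (finset.setD C (finset.set1 p))) oO _)) => // [x Ox|p pC]; first by rewrite lapG.
have Cp : #|finset.setD C (finset.set1 p)| = k.
  by move: cardC; rewrite (finset.cardsD1 p) (pC : p \in C) add1n => -[].
by have := IH _ Cp; rewrite Cp.
Qed.

Lemma polyh_level j : polyh j.+1 O (level j).
Proof. by apply: polyh_sum => // C /eqP <-; exact: polyh_component. Qed.

Lemma iter_lap_level l q x : O x ->
  iter l (@lap R m) (level (q + l)%N) x = (- 4) ^+ l * ((n - q) ^_ l)%:R * level q x.
Proof.
elim: l q x => [|l IH] q x Ox; first by rewrite /= addn0 expr0 !mul1r.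
rewrite iterS addnS -addSn.
rewrite (lap_ext oO (V := fun x => (- 4) ^+ l * ((n - q.+1) ^_ l)%:R * level q.+1 x) _ Ox); last first.
  by move=> y Oy; exact: IH.
rewrite (lapZ _ oO _ Ox); last by have [] := polyh_level q.+1.
rewrite lap_levelS // exprS ffactnS -subnS natrM; ring.
Qed.

Lemma sum_sphint_level : (forall x, enorm x <= 1 -> O x) ->
  \sum_(j < n.+1) sphint_real (rad (m%:R / 2) j (level j)) =
  m%:R * bmass R m 0 * (\prod_(i < n) (m%:R / 2 - i.+1%:R)) * G finset.setT 0.
Proof.
move=> BO; set s := m%:R / 2.
have O0 : O 0 by apply: BO; rewrite enorm_le1 nsq0.
(* The contribution of [level q] to the term j = q + l, reached after l Laplacians; for fixed q, the
   factors other than the alternating binomial do not depend on l. *)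
pose T q l : R := 2 * (bmass R m 0 * (\prod_(i < q.+1) (s - i%:R)) * level q 0 * ((-1) ^+ l * 'C(n - q, l)%:R)).
transitivity (\sum_(j < n.+1) \sum_(l < j.+1) T (j - l)%N l).
  apply: eq_bigr => j _; rewrite (sphint_rad j oO BO (polyh_level j)) mulr_sumr.
  apply: eq_bigr => l _; congr (_ * _).
  have lj : (l <= j)%N by rewrite -ltnS.
  by rewrite -pizzetti_coef -iter_lap_level // subnK.
rewrite sum_triangle.
under eq_bigr => q _.
  rewrite -mulr_sumr -mulr_sumr sum_alt_bin.
  over.
rewrite big_ord_recr /= subnn mulr1 big1 ?add0r => [|q _]; last first.
  by rewrite subn_eq0 leqNgt ltn_ord !mulr0.
have -> : level n 0 = G finset.setT 0.
  rewrite /level (big_pred1 finset.setT) // => C.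
  have Cn : (#|C| <= n)%N by have := max_card (mem C); rewrite card_ord.
  by rewrite /= finset.eqEcard finset.subsetT finset.cardsT card_ord eqn_leq Cn.
rewrite big_ord_recl subr0; have -> : m%:R = 2 * s by rewrite /s mulrC divfK.
rewrite (eq_bigr (fun i : 'I_n => s - i.+1%:R)) //.
by move: (\prod_(i < n) _) => P; ring.
Qed.

End LaplaceChains.

(** * Real and imaginary parts of the supersphere integral *)

Section Assembly.
Variables (R : realType) (m n : nat).

Lemma Re_blap (g : 'rV[R]_m -> R[i]) x : complex.Re (blap g x) = lap (fun y => complex.Re (g y)) x.
Proof. by rewrite /blap (big_morph (@complex.Re R) (id1 := 0) (op1 := +%R)) // => -[? ?] [? ?]. Qed.

Lemma Im_blap (g : 'rV[R]_m -> R[i]) x : complex.Im (blap g x) = lap (fun y => complex.Im (g y)) x.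
Proof. by rewrite /blap (big_morph (@complex.Im R) (id1 := 0) (op1 := +%R)) // => -[? ?] [? ?]. Qed.

Variables (O : set 'rV[R]_m) (h : superfun R m n).
Hypothesis m0 : (0 < m)%N.
Hypothesis oO : open O.
Hypothesis BO : forall x, enorm x <= 1 -> O x.
Hypothesis hL : forall S x, O x -> slap h S x = 0.

(* The instances of [part] are the real and the imaginary part. *)
Lemma ss_part (part : R[i] -> R) :
  (forall z w, part (z + w) = part z + part w) ->
  (forall a z, part (a%:C%C * z) = a * part z) ->
  (forall j g, (fun t => part (iter j (@dr2 R) g t)) = iter j (@rdr2 R) (fun t => part (g t))) ->
  (forall g x, part (@blap R m g x) = lap (fun y => part (g y)) x) ->
  (forall S, Ck 2 O (fun x => part (h S x))) ->
  \sum_(j < n.+1) sphint_real (fun xi => part (berezin (gmul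
    (gscale (((j`!)%:R : R)^-1)%:C%C (gexp (@xsq R n) j)) (radial_term h j xi)))) =
  sphere_const R (m%:Z - 2 * n%:Z) * part (h finset.set0 0).
Proof.
move=> pD pZ pI pL hk.
have p0 : part 0 = 0 by rewrite -[X in part X](mul0r (0 : R[i])) -(rmorph0 (real_complex R)) pZ mul0r.
have pS (I : finType) (P : pred I) (F : I -> R[i]) :
    part (\sum_(i | P i) F i) = \sum_(i | P i) part (F i) by exact: big_morph.
pose G0 C x := part (h (pairs (finset.setC C)) x).
have G0k C : Ck 2 O (G0 C) by exact: hk.
(* Passing to complements turns the addition of a pair in [slap_pairs] into its removal from C. *)
have lapG0 C x : O x -> lap (G0 C) x = - 4 * \sum_(p in C) G0 (finset.setD C (finset.set1 p)) x.
  move=> Ox; have := congr1 part (hL (pairs (finset.setC C)) Ox).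
  rewrite slap_pairs p0 pD pL -[4]/(4%:R) -(rmorph_nat (real_complex R)) pZ pS => /eqP.
  rewrite addr_eq0 => /eqP ->; rewrite mulNr; congr (- (_ * _)).
  apply: eq_big => [p|p]; rewrite !inE ?negbK // => pC; congr (part (h (pairs _) x)).
  by apply/setP => q; rewrite !inE negb_and negbK.
have G0s C j : Ck j O (G0 C) by exact: (polyh_Ck oO (polyh_component oO G0k lapG0 C)).
(* The normalisation of the Berezin integral is absorbed into [G], so that [sum_sphint_level]
   delivers it with the rest of the constant. *)
pose c : R := pi ^- n.
pose G C x := c * G0 C x.
have Gk C : Ck 2 O (G C) by exact: CkZ.
have lapG C x : O x -> lap (G C) x = - 4 * \sum_(p in C) G (finset.setD C (finset.set1 p)) x.
  by move=> Ox; rewrite (lapZ c oO (G0k C) Ox) lapG0 // -mulr_sumr mulrCA.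
rewrite sphere_constE // (_ : _ * part (h finset.set0 0) = m%:R * bmass R m 0 *
  (\prod_(i < n) (m%:R / 2 - i.+1%:R)) * G finset.setT 0); last first.
  by rewrite /G /G0 finset.setCT pairs0 -/c; ring.
rewrite -(sum_sphint_level oO Gk lapG BO); apply: eq_bigr => j _.
apply: eq_sphint_real => xi xi1; rewrite berezin_pairs pZ pS.
have Oxi : O xi by apply: BO; rewrite enorm_le1.
rewrite (@rad_sum R m (m%:R / 2) j O _ (index_enum _) (fun C : {set 'I_n} => #|C| == j) G xi oO _ Oxi) => [|C _]; last by apply: CkZ => //; exact: G0s.
rewrite mulr_sumr; apply: eq_bigr => C _.
rewrite (radZ _ c oO (G0s C j) Oxi); congr (_ * _).
rewrite -(iter_rdr2_one oO BO (G0s C j) xi1) /radial_term.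
rewrite -[LHS]/((fun t => part (iter j (@dr2 R) _ t)) 1) pI; congr (iter j _ _ 1).
by apply/funext => r; rewrite pZ.
Qed.

End Assembly.

Theorem theorem19 (R : realType) (m n : nat) (Omega : set 'rV[R]_m)
    (h : superfun R m n) :
  (1 <= m)%N ->
  open Omega ->
  [set x : 'rV[R]_m | enorm x <= 1] `<=` Omega ->
  (forall S, C2c_on Omega (h S)) ->
  (forall S x, Omega x -> slap h S x = 0) ->
  ss_integral h = ((sphere_const R (m%:Z - 2 * n%:Z))%:C)%C * h finset.set0 0.
Proof.
move=> m0 oO BO hC hL.
have ReD (z w : R[i]) : complex.Re (z + w) = complex.Re z + complex.Re w by case: z; case: w.
have ImD (z w : R[i]) : complex.Im (z + w) = complex.Im z + complex.Im w by case: z; case: w.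
have HRe := ss_part m0 oO BO hL ReD (@Re_rM R) (@Re_iter_dr2 R) (@Re_blap R m) (fun S => C2_on_Ck (hC S).1).
have HIm := ss_part m0 oO BO hL ImD (@Im_rM R) (@Im_iter_dr2 R) (@Im_blap R m) (fun S => C2_on_Ck (hC S).2).
rewrite [LHS]complex.complexE [RHS]complex.complexE Re_rM Im_rM -HRe -HIm /ss_integral.
by rewrite (big_morph _ ReD erefl) (big_morph _ ImD erefl).
Qed.
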